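(* Assume conditions [ID], [PEN], [CRIT], [LOC], [BCRIT], [PHI], [LQA] and [LQAB], with $|B_n^\omega-\|u_n^*\|^2|=o_{P_{V^\infty|Z^\infty}}(1)$ $wpa1(P_{Z^\infty})$ for the random variable $B_n^\omega$ in [LQAB]. Then: (1) $$\frac{\widehat{QLR}{}_n^B(\widehat\phi_n)}{\sigma_\omega^2}=\left(\sqrt n\,\frac{\mathbb Z_n^{\omega-1}}{\sigma_\omega\|u_n^*\|}\right)^2+o_{P_{V^\infty|Z^\infty}}(1)=O_{P_{V^\infty|Z^\infty}}(1)\quad wpa1(P_{Z^\infty});$$ (2) $$\sup_{t\in\mathbb R}\left|P_{V^\infty|Z^\infty}\left(\frac{\widehat{QLR}{}_n^B(\widehat\phi_n)}{\sigma_\omega^2}\le t\,\Big|\,Z^n\right)-P_{Z^\infty}\left(\widehat{QLR}_n(\phi_0)\le t\mid H_0\right)\right|=o_{P_{V^\infty|Z^\infty}}(1)\quad wpa1(P_{Z^\infty}),$$ where $P_{Z^\infty}(\widehat{QLR}_n(\phi_0)\le\cdot\mid H_0)$ is the distribution function of $\widehat{QLR}_n(\phi_0)$ under the null $H_0:\phi(\alpha_0)=\phi_0$. (All objects and the bracketed conditions are defined in the context.)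
   Context: MODEL. $Z=(Y',X')'$; $Z_1,Z_2,\dots$ are i.i.d. copies, $Z_i=(Y_i',X_i')'$, $Z^n=(Z_1,\dots,Z_n)$; $P_{Z^\infty}$ is the law of the sequence ($o_P,O_P$ and wpa1 = ''with probability approaching one'' refer to it); $\mathcal X$ is the support of $X$; $\|\cdot\|_e$ is the Euclidean norm; $a_n\asymp b_n$ means $c_1a_n\le b_n\le c_2a_n$ for constants $0<c_1\le c_2<\infty$. $\mathcal A=\Theta\times\mathcal H$ with $\Theta\subset\mathbb R^{d_\theta}$ and $\mathcal H$ a space of functions with norm $\|\cdot\|_{\mathbf H}$; for $\alpha=(\theta',h)$, $\|\alpha\|_s=\|\theta\|_e+\|h\|_{\mathbf H}$. $\rho(Z;\alpha)\in\mathbb R^{d_\rho}$ is a known function, $m(X,\alpha)=E[\rho(Z;\alpha)|X]$, and $\alpha_0=(\theta_0',h_0)\in\mathrm{int}(\Theta)\times\mathcal H$ satisfies $m(X,\alpha_0)=0$ a.s. $\Sigma(X)$ is a positive definite weighting matrix, $\Sigma_0(X)=\mathrm{Var}(\rho(Z;\alpha_0)|X)$, $Q(\alpha)=E[m(X,\alpha)'\Sigma(X)^{-1}m(X,\alpha)]$. ESTIMATOR. $\widehat m(x,\alpha)=\sum_{i=1}^n\rho(Z_i,\alpha)A_n(X_i,x)$ is a consistent estimator of $m$ ($A_n(X_i,x)$ a known measurable function of $X_1,\dots,X_n$), $\widehat\Sigma$ is a consistent estimator of $\Sigma$, $\widehat Q_n(\alpha)=\frac1n\sum_{i=1}^n\widehat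 m(X_i,\alpha)'\widehat\Sigma(X_i)^{-1}\widehat m(X_i,\alpha)$. Sieve: $\mathcal A_{k(n)}=\Theta\times\mathcal H_{k(n)}$, $\mathcal H_{k(n)}=\{h\in\mathcal H:h=\sum_{k\le k(n)}\beta_kq_k\}$ for known basis functions $q_k$, $k(n)\to\infty$. $Pen\ge0$ is a penalty on $\mathcal H$, $\lambda_n=o(1)$. The PSMD (penalized sieve minimum distance) estimator $\widehat\alpha_n=(\widehat\theta_n',\widehat h_n)\in\mathcal A_{k(n)}$ satisfies $\widehat Q_n(\widehat\alpha_n)+\lambda_nPen(\widehat h_n)\le\inf_{\alpha\in\mathcal A_{k(n)}}\{\widehat Q_n(\alpha)+\lambda_nPen(h)\}+o_P(n^{-1})$. $\widehat\phi_n=\phi(\widehat\alpha_n)$. $\widehat{QLR}_n(\phi_0)=n(\inf_{\alpha\in\mathcal A_{k(n)}:\phi(\alpha)=\phi_0}\widehat Q_n(\alpha)-\widehat Q_n(\widehat\alpha_n))$. BOOTSTRAP. Weights $\omega_{i,n}\ge0$, $i\le n$, are independent of the data with $E[\omega_{i,n}]=1$ and $\lim_n\mathrm{Var}(\omega_{i,n})=\sigma_\omega^2\in(0,\infty)$ for all $i$; $V_i=(Z_i,\omega_{i,n})$, $V^n=(V_1,\dots,V_n)$; $P_{V^\infty|Z^\infty}(\cdot|Z^n)$ is conditional probability given the data. $\Delta_n=o_{P_{V^\infty|Z^\infty}}(1)$ $wpa1(P_{Z^\infty})$ means: for all $\epsilon>0$, $P_{Z^\infty}(P_{V^\infty|Z^\infty}(|\Delta_n|>\epsilon|Z^n)>\epsilon)\to0$;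 $\Delta_n=O_{P_{V^\infty|Z^\infty}}(1)$ $wpa1(P_{Z^\infty})$ means: for all $\epsilon>0$ there is $M<\infty$ with $P_{Z^\infty}(P_{V^\infty|Z^\infty}(|\Delta_n|>M|Z^n)>\epsilon)\to0$. $\widehat m^B(x,\alpha)=\sum_i\omega_{i,n}\rho(Z_i,\alpha)A_n(X_i,x)$, $\widehat Q_n^B(\alpha)=\frac1n\sum_i\widehat m^B(X_i,\alpha)'\widehat\Sigma(X_i)^{-1}\widehat m^B(X_i,\alpha)$; $\widehat\alpha_n^B\in\mathcal A_{k(n)}$ is an approximate minimizer of $\widehat Q_n^B(\alpha)+\lambda_nPen(h)$ over $\mathcal A_{k(n)}$, and the restricted $\widehat\alpha_n^{R,B}$ an approximate minimizer of the same function over $\{\alpha\in\mathcal A_{k(n)}:\phi(\alpha)=\widehat\phi_n\}$ (both up to $o_{P_{V^\infty|Z^\infty}}(n^{-1})$ $wpa1(P_{Z^\infty})$). $\widehat{QLR}{}_n^B(\widehat\phi_n)=n(\inf_{\alpha\in\mathcal A_{k(n)}:\phi(\alpha)=\widehat\phi_n}\widehat Q_n^B(\alpha)-\widehat Q_n^B(\widehat\alpha_n^B))$, equal to $n(\widehat Q_n^B(\widehat\alpha_n^{R,B})-\widehat Q_n^B(\widehat\alpha_n^B))$ up to $o_{P_{V^\infty|Z^\infty}}(1)$ $wpa1(P_{Z^\infty})$. LOCAL OBJECTS. $\dot m_\alpha(X)[v]=\partial_\tau m(X,\alpha+\tau v)|_{\tau=0}$, $\dot\phi_\alpha[v]=\partial_\tau\phi(\alpha+\tau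 v)|_{\tau=0}$, $\dot m=\dot m_{\alpha_0}$, $\dot\phi=\dot\phi_{\alpha_0}$. $\langle v_1,v_2\rangle=E[\dot m(X)[v_1]'\Sigma(X)^{-1}\dot m(X)[v_2]]$, $\|v\|^2=\langle v,v\rangle$. $\mathcal A_{os}$ is a convex $\|\cdot\|_s$-neighbourhood of $\alpha_0$ contained in $\{\alpha\in\mathcal A:\|\alpha-\alpha_0\|_s<M_0,\ \lambda_nPen(h)<\lambda_nM_0\}$; $\mathcal A_{osn}=\mathcal A_{os}\cap\mathcal A_{k(n)}$. With $\Pi_n h_0$ as in [ID](ii), $\Pi_n\alpha_0=(\theta_0',\Pi_nh_0)$. $\tau_n=\sup\{\|\alpha-\Pi_n\alpha_0\|_s/\|\alpha-\Pi_n\alpha_0\|:\alpha\in\mathcal A_{osn},\|\alpha-\Pi_n\alpha_0\|\ne0\}$. $\bar\delta_{m,n}\downarrow0$, $\delta_n=o(1)$, $\delta_n\le\bar\delta_{m,n}$, and $\bar\delta_{m,n}^*=o(1)$, $\bar\delta_{m,n}^*\ge\delta_n$, are positive sequences; $\delta_{s,n}=\|h_0-\Pi_nh_0\|_s+\tau_n\delta_n=o(1)$; $M_n=\min\{\log\log(n+1),\log(\delta_{s,n}^{-1}+1)\}$. $\mathcal N_{os}=\{\alpha\in\mathcal A:\|\alpha-\alpha_0\|\le M_n\delta_n,\|\alpha-\alpha_0\|_s\le M_n\delta_{s,n},\lambda_nPen(h)\le\lambda_nM_0\}$, $\mathcal N_{osn}=\mathcal N_{os}\cap\mathcal A_{k(n)}$,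 $\mathcal T_n=\{t\in\mathbb R:|t|\le4M_n^2\delta_n\}$. $\mathcal A_{k(n)}^{M_0}=\{\alpha\in\mathcal A_{k(n)}:\lambda_nPen(h)\le\lambda_nM_0\}$, with $M_0$ finite and so large that it contains $\Pi_n\alpha_0$, and contains $\widehat\alpha_n$ with probability arbitrarily close to one for all large $n$. The sieve space $\mathcal A_{k(n)}$ is convex with nonempty interior. RIESZ REPRESENTER. $\phi:\mathbb R^{d_\theta}\times\mathcal H\to\mathbb R$ is $\|\cdot\|_s$-continuous and $\dot\phi$ is a $\|\cdot\|_s$-bounded linear functional. $\mathbf V$ is the linear span of $\mathcal A_{os}-\{\alpha_0\}$, $\overline{\mathbf V}$ its closure under $\|\cdot\|$; $\alpha_{0,n}$ minimizes $\|\alpha-\alpha_0\|$ over $\mathbb R^{d_\theta}\times\mathcal H_{k(n)}$; $\overline{\mathbf V}_{k(n)}$ is the closed linear span under $\|\cdot\|$ of $\mathcal A_{osn}-\{\alpha_{0,n}\}$, with $\dim\overline{\mathbf V}_{k(n)}=\dim\mathcal A_{k(n)}\asymp k(n)$; $v_n^*\in\overline{\mathbf V}_{k(n)}$ is the unique element with $\dot\phi[v]=\langle v_n^*,v\rangle$ for all $v\in\overline{\mathbf V}_{k(n)}$. $\|v\|_{sd}^2=E[\dot m(X)[v]'\Sigma(X)^{-1}\Sigma_0(X)\Sigma(X)^{-1}\dot m(X)[v]]$, $u_n^*=v_n^*/\|v_n^*\|_{sd}$. For weights $b=(b_i)$, $\mathbb Z_n^b=\frac1n\sum_ib_i\dot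 m(X_i)[u_n^*]'\Sigma(X_i)^{-1}\rho(Z_i,\alpha_0)$; $\mathbb Z_n$ is the case $b_i\equiv1$; $\mathbb Z_n^\omega,\mathbb Z_n^{\omega-1}$ are $b_i=\omega_{i,n}$, $b_i=\omega_{i,n}-1$. CONDITIONS. [ID] (i) $E[\rho(Z;\alpha)|X]=0$ a.s. iff $\alpha\in\mathcal A$ with $\|\alpha-\alpha_0\|_s=0$; (ii) $\Theta$ is compact with nonempty interior, $\{\mathcal H_k\}_{k\ge1}$ is a non-decreasing sequence of nonempty closed linear subsets of the Banach space $(\mathcal H,\|\cdot\|_{\mathbf H})$ with $\mathcal H=cl(\cup_k\mathcal H_k)$, and there is $\Pi_nh_0\in\mathcal H_{k(n)}$ with $\|\Pi_nh_0-h_0\|_{\mathbf H}=o(1)$; (iii) $Q$ is lower semicontinuous on $(\mathcal A,\|\cdot\|_s)$; (iv) the eigenvalues of $\Sigma(x),\Sigma_0(x)$ are bounded and bounded away from zero uniformly in $x\in\mathcal X$. [PEN] (i) $\lambda_n>0$, $Q(\Pi_n\alpha_0)+o(n^{-1})=O(\lambda_n)=o(1)$; (ii) $|Pen(\Pi_nh_0)-Pen(h_0)|=O(1)$, $Pen(h_0)<\infty$; (iii) for every $M$, $\{h\in\mathcal H:Pen(h)\le M\}$ is compact in $(\mathcal H,\|\cdot\|_{\mathbf H})$. [CRIT] (i) $\widehat Q_n(\Pi_n\alpha_0)\le c_0Q(\Pi_n\alpha_0)+o_P(n^{-1})$ for a finite $c_0>0$; (ii) $\widehat Q_n(\alpha)\ge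 cQ(\alpha)-O_P(\bar\delta_{m,n}^2)$ uniformly over $\mathcal A_{k(n)}^{M_0}$ for a finite $c>0$. [LOC] (i) $m(\cdot,\alpha)$ is continuously pathwise differentiable in $\alpha\in\mathcal A_{os}$ and $\|\alpha-\alpha_0\|\le C\|\alpha-\alpha_0\|_s$ on $\mathcal A_{os}$ for a finite $C$; (ii) $Q(\alpha)\asymp\|\alpha-\alpha_0\|^2$ on $\mathcal A_{os}$; (iii) $\widehat Q_n(\alpha)\ge cQ(\alpha)-O_P(\delta_n^2)$ uniformly over $\mathcal A_{osn}$, and $\max\{\delta_n^2,Q(\Pi_n\alpha_0),\lambda_n,o(n^{-1})\}=\delta_n^2$; (iv) $\lambda_n\sup_{\alpha,\alpha'\in\mathcal A_{os}}|Pen(h)-Pen(h')|=o(n^{-1})$ or $\lambda_n=o(n^{-1})$. [BCRIT] for finite $c_0^*,c^*>0$, $wpa1(P_{Z^\infty})$: (i) $\widehat Q_n^B(\widehat\alpha_n)\le c_0^*\widehat Q_n(\widehat\alpha_n)+o_{P_{V^\infty|Z^\infty}}(n^{-1})$; (ii) $\widehat Q_n^B(\alpha)\ge c^*\widehat Q_n(\alpha)-O_{P_{V^\infty|Z^\infty}}((\bar\delta_{m,n}^* )^2)$ uniformly over $\mathcal A_{k(n)}^{M_0}$; (iii) $\widehat Q_n^B(\alpha)\ge c^*\widehat Q_n(\alpha)-O_{P_{V^\infty|Z^\infty}}(\delta_n^2)$ uniformly over $\mathcal A_{osn}$. [PHI] (i) $\dot\phi$ is a nonzero linear functional on $\mathbf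 V$; $\{\overline{\mathbf V}_k\}$ is an increasing sequence of finite dimensional Hilbert spaces dense in $(\overline{\mathbf V},\|\cdot\|)$; $\|v_n^*\|/\sqrt n=o(1)$; (ii) $\sup_{(\alpha,t)\in\mathcal N_{osn}\times\mathcal T_n}\sqrt n\,|\phi(\alpha+tu_n^* )-\phi(\alpha_0)-\dot\phi[\alpha+tu_n^*-\alpha_0]|/\|v_n^*\|=o(1)$; (iii) $\sqrt n\,|\dot\phi[\alpha_{0,n}-\alpha_0]|/\|v_n^*\|=o(1)$. [LQA] (i) with $\alpha(t)=\alpha+tu_n^*$, $\alpha(t)\in\mathcal A_{k(n)}$ for all $(\alpha,t)\in\mathcal N_{osn}\times\mathcal T_n$, and with $\widehat\Lambda_n(\alpha(t),\alpha)=\frac12\{\widehat Q_n(\alpha(t))-\widehat Q_n(\alpha)\}$ and $r_n(t)=(\max\{t^2,tn^{-1/2},o(n^{-1})\})^{-1}$, $\sup_{(\alpha,t)\in\mathcal N_{osn}\times\mathcal T_n}r_n(t)|\widehat\Lambda_n(\alpha(t),\alpha)-t\{\mathbb Z_n+\langle u_n^*,\alpha-\alpha_0\rangle\}-\frac{B_n}2t^2|=o_P(1)$, where $B_n$ is a positive $Z^n$-measurable random variable, $B_n=O_P(1)$; (ii) $\sqrt n\,\mathbb Z_n\Rightarrow N(0,1)$. [LQAB] (i) with $\widehat\Lambda_n^B(\alpha(t),\alpha)=\frac12\{\widehat Q_n^B(\alpha(t))-\widehat Q_n^B(\alpha)\}$, $\alpha(t)\in\mathcal A_{k(n)}$ on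 $\mathcal N_{osn}\times\mathcal T_n$ and $\sup_{(\alpha,t)\in\mathcal N_{osn}\times\mathcal T_n}r_n(t)|\widehat\Lambda_n^B(\alpha(t),\alpha)-t\{\mathbb Z_n^\omega+\langle u_n^*,\alpha-\alpha_0\rangle\}-\frac{B_n^\omega}2t^2|=o_{P_{V^\infty|Z^\infty}}(1)$ $wpa1(P_{Z^\infty})$, with $B_n^\omega$ positive, $V^n$-measurable, $O_{P_{V^\infty|Z^\infty}}(1)$ $wpa1(P_{Z^\infty})$; (ii) $\sup_{f\in BL_1}|E[f(\sqrt n\,\mathbb Z_n^{\omega-1}/\sigma_\omega)|Z^n]-E[f(\mathbb Z)]|=o_P(1)$, $\mathbb Z\sim N(0,1)$, $BL_1=\{f:\mathbb R\to\mathbb R:\|f\|_\infty\le1,|f(z)-f(z')|\le|z-z'|\}$.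
   Formalization: A_os is a neighbourhood relative to {Pen<M_0}, with n λ_n sup|Pen(h(t))-Pen(h)|->0 on N_osn x T_n assumed; M_0 is sufficiently large; for (2), under H_0, a restricted PSMD estimator with bounded penalty is assumed to attain the infimum in QLR_n(phi_0) up to o_P(1/n). *)

(* Defs.v *)
From HB Require Import structures.
From mathcomp Require Import all_boot all_order all_algebra.
From mathcomp Require Import all_classical all_reals all_analysis.
Import Order.TTheory GRing.Theory Num.Theory.
Import numFieldNormedType.Exports.

Set Implicit Arguments.
Unset Strict Implicit.
Unset Printing Implicit Defensive.

Local Open Scope classical_set_scope.
Local Open Scope ring_scope.

Section linear_notions.
Context {R : realType}.

Definition enorm n (x : 'rV[R]_n) : R := Num.sqrt (\sum_(j < n) x 0 j ^+ 2).

Definition posdef n (S : 'M[R]_n) : Prop :=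
  S^T = S /\ forall v : 'cV[R]_n, v != 0 -> 0 < (v^T *m S *m v) 0 0.

Definition qform n (S : 'M[R]_n) (u v : 'cV[R]_n) : R :=
  (u^T *m invmx S *m v) 0 0.

Definition linspan (V : lmodType R) (S : set V) : set V :=
  [set v | exists n (c : 'I_n -> R) (s : 'I_n -> V),
     (forall i, S (s i)) /\ v = \sum_i c i *: s i].

Definition has_dim (V : lmodType R) (S : set V) (r : nat) : Prop :=
  exists e : 'I_r -> V,
    (forall c : 'I_r -> R, \sum_i c i *: e i = 0 -> forall i, c i = 0) /\
    S = linspan (range e).

End linear_notions.

Definition borel_set (T : topologicalType) : set (set T) :=
  <<s [set U : set T | open U] >>.

Definition borel_fun {R : realType} (T : topologicalType) (g : T -> R) : Prop :=
  forall B : set R, measurable B -> borel_set (g @^-1` B).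

Section probability_notions.
Context {R : realType} {d : measure_display} {T : measurableType d}.
Variable P : probability T R.

(* The criteria below are infima and suprema over uncountable sets, which need
   not be measurable.  Stochastic orders are therefore stated with the outer
   probability, equal to [P] on measurable sets. *)
Definition outerP (E : set T) : \bar R := mu_ext P E.

Definition borel_rv (T' : topologicalType) (f : T -> T') : Prop :=
  forall B, borel_set B -> measurable (f @^-1` B).

Definition oP (D : nat -> T -> \bar R) : Prop :=
  forall e : R, 0 < e ->
    (outerP [set w | (e%:E < `|D n w|)%E] @[n --> \oo] --> 0%E).

Definition wpa1 (E : nat -> T -> Prop) : Prop :=
  outerP [set w | ~ E n w] @[n --> \oo] --> 0%E.

(* [E M n] is the event that some quantity exceeds the bound [M]. *)
Definition tightP (E : R -> nat -> T -> Prop) : Prop :=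
  forall e : R, 0 < e ->
    exists M : R, \forall n \near \oo, (outerP [set w | E M n w] <= e%:E)%E.

Definition OP (D : nat -> T -> \bar R) : Prop :=
  tightP (fun M n w => (M%:E < `|D n w|)%E).

(* [g] is a version of x |-> E[U | X = x]. *)
Definition is_condexp (TX : topologicalType) (X : T -> TX) (U : T -> R)
    (g : TX -> R) : Prop :=
  [/\ P.-integrable setT (EFin \o U),
      borel_fun g,
      P.-integrable setT (EFin \o g \o X) &
      forall B, borel_set B ->
        (\int[P]_(w in X @^-1` B) (g (X w))%:E =
         \int[P]_(w in X @^-1` B) (U w)%:E)%E].

Definition support (TX : topologicalType) (X : T -> TX) : set TX :=
  [set x | forall U : set TX, open U -> U x -> (0 < P (X @^-1` U))%E].

Definition same_law (T' : topologicalType) (f g : T -> T') : Prop :=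
  forall B, borel_set B -> P (f @^-1` B) = P (g @^-1` B).

(* As [B i] may be the whole space, the product rule over initial segments
   gives it over all finite subfamilies. *)
Definition mutually_independent (T' : topologicalType) (f : nat -> T -> T') :=
  forall (N : nat) (B : nat -> set T'), (forall i, borel_set (B i)) ->
    P (\bigcap_(i < N) (f i @^-1` B i)) = (\prod_(i < N) P (f i @^-1` B i))%E.

(* Independence of the sigma-algebras generated by two families, through the
   pi-systems of finite cylinders. *)
Definition independent_families (T1 : topologicalType) (f : nat -> T -> T1)
    (n : nat) (g : nat -> T -> R) : Prop :=
  forall (N : nat) (B : nat -> set T1) (C : nat -> set R),
    (forall i, borel_set (B i)) -> (forall i, measurable (C i)) ->
    P ((\bigcap_(i < N) (f i @^-1` B i)) `&` (\bigcap_(i < n) (g i @^-1` C i)))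
    = (P (\bigcap_(i < N) (f i @^-1` B i)) *
       P (\bigcap_(i < n) (g i @^-1` C i)))%E.

Definition cvg_std_normal (X : nat -> T -> R) : Prop :=
  forall x : R, P [set w | X n w <= x] @[n --> \oo]
                  --> (normal_prob (0 : R) 1 `]-oo, x]).

End probability_notions.

(* Conditional probability given the sample.  A bootstrap quantity is a
   function of the sample z = Z^n and of the weights b = (omega_{i,n})_i.  As
   the weights are independent of the data, the conditional law of
   f(Z^n, omega) given Z^n = z is the law of f(z, omega): [condP] is this
   regular version of the conditional probability. *)
Section conditional_notions.
Context {R : realType} {d : measure_display} {T : measurableType d}.
Variables (P : probability T R) (ZT : Type).
Variables (Zn : forall n, T -> 'I_n -> ZT) (Wn : forall n, T -> 'I_n -> R).

Definition condP n (E : ('I_n -> ZT) -> ('I_n -> R) -> Prop) (z : 'I_n -> ZT)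
    : \bar R :=
  outerP P [set w | E z (@Wn n w)].

Definition cond_oP (D : forall n, ('I_n -> ZT) -> ('I_n -> R) -> \bar R) :=
  forall e : R, 0 < e ->
    outerP P [set w | (e%:E < condP (fun z b => (e%:E < `|D n z b|)%E)
                                    (@Zn n w))%E] @[n --> \oo] --> 0%E.

Definition cond_wpa1 (E : forall n, ('I_n -> ZT) -> ('I_n -> R) -> Prop) :=
  forall e : R, 0 < e ->
    outerP P [set w | (e%:E < condP (fun z b => ~ E n z b) (@Zn n w))%E]
      @[n --> \oo] --> 0%E.

Definition cond_tightP
    (E : R -> forall n, ('I_n -> ZT) -> ('I_n -> R) -> Prop) :=
  forall e : R, 0 < e -> exists M : R,
    outerP P [set w | (e%:E < condP (E M n) (@Zn n w))%E]
      @[n --> \oo] --> 0%E.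

Definition cond_OP (D : forall n, ('I_n -> ZT) -> ('I_n -> R) -> \bar R) :=
  cond_tightP (fun M n z b => (M%:E < `|D n z b|)%E).

End conditional_notions.

Section model.
Context {R : realType} {d : measure_display} {T : measurableType d}.
Variables (P : probability T R) (dY dX dt dr : nat).
Variable H : completeNormedModType R.

(* [tol] is the deterministic sequence written o(n^{-1}): it bounds, with
   probability approaching one, the o_P(n^{-1}) slacks of the estimators and of
   the criteria, and it is the o(n^{-1}) term of the rates. *)
Record model := Model {
  Z : T -> 'rV[R]_dY * 'rV[R]_dX ;
  Zobs : nat -> T -> 'rV[R]_dY * 'rV[R]_dX ;
  weight : nat -> nat -> {RV P >-> R} ;
  sigma_w : R ;
  rho : 'rV[R]_dY * 'rV[R]_dX -> 'rV[R]_dt * H -> 'cV[R]_dr ;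
  m : 'rV[R]_dX -> 'rV[R]_dt * H -> 'cV[R]_dr ;
  Theta : set 'rV[R]_dt ;
  alpha0 : 'rV[R]_dt * H ;
  Sigma : 'rV[R]_dX -> 'M[R]_dr ;
  Sigma0 : 'rV[R]_dX -> 'M[R]_dr ;
  phi : 'rV[R]_dt * H -> R ;
  Aker : forall n, ('I_n -> 'rV[R]_dX) -> 'rV[R]_dX -> 'rV[R]_dX -> R ;
  Sigmahat : forall n, ('I_n -> 'rV[R]_dY * 'rV[R]_dX) -> 'rV[R]_dX ->
             'M[R]_dr ;
  basis_fun : nat -> H ;
  kdim : nat -> nat ;
  Pi_h0 : nat -> H ;
  Pen : H -> \bar R ;
  lambda : nat -> R ;
  tol : nat -> R ;
  alphahat : forall n, ('I_n -> 'rV[R]_dY * 'rV[R]_dX) -> 'rV[R]_dt * H ;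
  alphaB : forall n, ('I_n -> 'rV[R]_dY * 'rV[R]_dX) -> ('I_n -> R) ->
           'rV[R]_dt * H ;
  alphaRB : forall n, ('I_n -> 'rV[R]_dY * 'rV[R]_dX) -> ('I_n -> R) ->
            'rV[R]_dt * H }.

(* Objects attached to the constant [M0] and the local neighbourhood [Aos]:
   [aproj K] is the ||.||-projection of alpha0 on R^dt x H_K. *)
Record local_objects := LocalObjects {
  M0 : R ;
  Aos : set ('rV[R]_dt * H) ;
  dbar : nat -> R ;
  delta : nat -> R ;
  dbarstar : nat -> R ;
  aproj : nat -> 'rV[R]_dt * H ;
  vstar : nat -> 'rV[R]_dt * H ;
  Bn : forall n, ('I_n -> 'rV[R]_dY * 'rV[R]_dX) -> R ;
  Bomega : forall n, ('I_n -> 'rV[R]_dY * 'rV[R]_dX) -> ('I_n -> R) -> R }.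

End model.

Section conditions.
Context {R : realType} {d : measure_display} {T : measurableType d}.
Context {P : probability T R} {dY dX dt dr : nat}.
Context {H : completeNormedModType R}.
Variable Mo : model P dY dX dt dr H.

Local Notation ZT := ('rV[R]_dY * 'rV[R]_dX)%type.
Local Notation par := ('rV[R]_dt * H)%type.

Definition Xgen (w : T) : 'rV[R]_dX := (Z Mo w).2.
Definition Zn n (w : T) : 'I_n -> ZT := fun i => Zobs Mo i w.
Definition Wn n (w : T) : 'I_n -> R := fun i => weight Mo n i w.

Local Notation coP := (cond_oP P Zn Wn).
Local Notation cOP := (cond_OP P Zn Wn).
Local Notation ctightP := (cond_tightP P Zn Wn).
Local Notation cwpa1 := (cond_wpa1 P Zn Wn).

Definition norm_s (a : par) : R := enorm a.1 + `|a.2|.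

Definition params : set par := [set a | Theta Mo a.1].

Definition Hsieve (K : nat) : set H :=
  [set h | exists b : 'I_K -> R, h = \sum_(j < K) b j *: basis_fun Mo j].

Definition sieve_hull (K : nat) : set par := [set a | Hsieve K a.2].

Definition sieve (K : nat) : set par := [set a | Theta Mo a.1 /\ Hsieve K a.2].

Definition Pi_alpha0 (n : nat) : par := ((alpha0 Mo).1, Pi_h0 Mo n).

Definition crit_Q (a : par) : \bar R :=
  (\int[P]_w (qform (Sigma Mo (Xgen w)) (m Mo (Xgen w) a)
                    (m Mo (Xgen w) a))%:E)%E.

Definition mhatb n (z : 'I_n -> ZT) (b : 'I_n -> R) (x : 'rV[R]_dX) (a : par)
    : 'cV[R]_dr :=
  \sum_i (b i * Aker Mo (fun j => (z j).2) (z i).2 x) *: rho Mo (z i) a.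

Definition Qhatb n (z : 'I_n -> ZT) (b : 'I_n -> R) (a : par) : R :=
  n%:R^-1 * \sum_i qform (Sigmahat Mo z (z i).2)
                         (mhatb z b (z i).2 a) (mhatb z b (z i).2 a).

Definition unit_weights n : 'I_n -> R := fun=> 1.

Definition Qhat n (z : 'I_n -> ZT) (a : par) : R :=
  Qhatb z (@unit_weights n) a.

Definition pen_crit n (z : 'I_n -> ZT) (b : 'I_n -> R) (a : par) : \bar R :=
  ((Qhatb z b a)%:E + (lambda Mo n)%:E * Pen Mo a.2)%E.

Definition approx_min n (z : 'I_n -> ZT) (b : 'I_n -> R) (S : set par)
    (a : par) : Prop :=
  (pen_crit z b a <= ereal_inf (pen_crit z b @` S) + (tol Mo n)%:E)%E.

Definition constrained_sieve n (c : R) : set par :=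
  sieve (kdim Mo n) `&` [set a | phi Mo a = c].

Definition QLR n (z : 'I_n -> ZT) (c : R) : \bar R :=
  (n%:R%:E * (ereal_inf [set (Qhat z a)%:E | a in constrained_sieve n c]
              - (Qhat z (alphahat Mo z))%:E))%E.

Definition QLRB n (z : 'I_n -> ZT) (b : 'I_n -> R) : \bar R :=
  (n%:R%:E * (ereal_inf [set (Qhatb z b a)%:E |
                a in constrained_sieve n (phi Mo (alphahat Mo z))]
              - (Qhatb z b (alphaB Mo z b))%:E))%E.

Definition dm (x : 'rV[R]_dX) (v : par) : 'cV[R]_dr := 'D_v (m Mo x) (alpha0 Mo).

Definition dphi (v : par) : R := 'D_v (phi Mo) (alpha0 Mo).

Definition ip (v1 v2 : par) : R :=
  \int[P]_w qform (Sigma Mo (Xgen w)) (dm (Xgen w) v1) (dm (Xgen w) v2).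

Definition wnorm (v : par) : R := Num.sqrt (ip v v).

Definition sdnorm (v : par) : R :=
  Num.sqrt (\int[P]_w ((dm (Xgen w) v)^T *m invmx (Sigma Mo (Xgen w))
                        *m Sigma0 Mo (Xgen w) *m invmx (Sigma Mo (Xgen w))
                        *m dm (Xgen w) v) 0 0).

Definition data_ok : Prop :=
  [/\ borel_rv (Z Mo),
      forall i, borel_rv (Zobs Mo i),
      forall i, same_law P (Zobs Mo i) (Z Mo) &
      mutually_independent P (Zobs Mo)].

Definition weights_ok : Prop :=
  [/\ forall n (i : 'I_n) w, 0 <= weight Mo n i w,
      forall n (i : 'I_n), ('E_P[weight Mo n i] = 1)%E,
      0 < sigma_w Mo,
      forall i, 'V_P[weight Mo n i] @[n --> \oo] --> ((sigma_w Mo ^+ 2)%:E) &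
      forall n, independent_families P (Zobs Mo) n (weight Mo n)].

Definition moment_ok : Prop :=
  [/\ forall a i, params a -> borel_fun (fun z => rho Mo z a i 0),
      forall a i, params a ->
        is_condexp P Xgen (fun w => rho Mo (Z Mo w) a i 0)
                          (fun x => m Mo x a i 0),
      (Theta Mo)° (alpha0 Mo).1 &
      {ae P, forall w, m Mo (Xgen w) (alpha0 Mo) = 0}].

Definition weighting_ok : Prop :=
  [/\ forall x, posdef (Sigma Mo x),
      forall i j, borel_fun (fun x => Sigma Mo x i j) &
      forall i j, is_condexp P Xgen
        (fun w =>
          let e := rho Mo (Z Mo w) (alpha0 Mo) - m Mo (Xgen w) (alpha0 Mo) in
          e i 0 * e j 0)
        (fun x => Sigma0 Mo x i j)].

(* Consistency is pointwise, in probability, at P_X-almost every x. *)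
Definition first_step_ok : Prop :=
  [/\ forall n (i : 'I_n) x, measurable_fun setT
        (fun w => Aker Mo (fun j => (@Zn n w j).2) (@Zn n w i).2 x),
      forall a, params a -> {ae P, forall w, oP P (fun n w' =>
        (`|mhatb (@Zn n w') (@unit_weights n) (Xgen w) a
           - m Mo (Xgen w) a|)%:E)},
      forall n (z : 'I_n -> ZT) x, posdef (Sigmahat Mo z x) &
      {ae P, forall w, oP P (fun n w' =>
        (`|Sigmahat Mo (@Zn n w') (Xgen w) - Sigma Mo (Xgen w)|)%:E)}].

(* The interior of the sieve space is relative to R^dt x H_k(n). *)
Definition sieve_ok : Prop :=
  [/\ kdim Mo n @[n --> \oo] --> \oo,
      forall n, convex_set (sieve (kdim Mo n)),
      forall n, exists a (r : R), [/\ sieve (kdim Mo n) a, 0 < r &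
        forall b, sieve_hull (kdim Mo n) b -> norm_s (b - a) < r ->
          sieve (kdim Mo n) b],
      forall h, (0 <= Pen Mo h)%E &
      lambda Mo n @[n --> \oo] --> (0 : R)].

Definition tol_ok : Prop :=
  (forall n, 0 < tol Mo n) /\ (n%:R * tol Mo n @[n --> \oo] --> (0 : R)).

Definition functional_ok : Prop :=
  [/\ continuous (phi Mo),
      forall v, derivable (phi Mo) (alpha0 Mo) v,
      forall (c : R) v1 v2, dphi (c *: v1 + v2) = c * dphi v1 + dphi v2 &
      exists C : R, forall v, `|dphi v| <= C * norm_s v].

Definition estimator_ok : Prop :=
  (forall n (z : 'I_n -> ZT), sieve (kdim Mo n) (alphahat Mo z)) /\
  wpa1 P (fun n w => approx_min (@Zn n w) (@unit_weights n)
                       (sieve (kdim Mo n)) (alphahat Mo (@Zn n w))).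

Definition bootstrap_ok : Prop :=
  [/\ forall n (z : 'I_n -> ZT) b, sieve (kdim Mo n) (alphaB Mo z b),
      cwpa1 (fun n z b => approx_min z b (sieve (kdim Mo n)) (alphaB Mo z b)),
      forall n (z : 'I_n -> ZT) b,
        constrained_sieve n (phi Mo (alphahat Mo z)) (alphaRB Mo z b),
      cwpa1 (fun n z b => approx_min z b
        (constrained_sieve n (phi Mo (alphahat Mo z))) (alphaRB Mo z b)) &
      coP (fun n z b => (QLRB z b -
        (n%:R * (Qhatb z b (alphaRB Mo z b) - Qhatb z b (alphaB Mo z b)))%:E)%E)].

Definition model_ok : Prop :=
  [/\ data_ok, weights_ok, moment_ok, weighting_ok & first_step_ok] /\
  [/\ sieve_ok, tol_ok, functional_ok, estimator_ok & bootstrap_ok].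

(* The sample analogue of [alphaRB]: the restricted estimator [alphaR] under
   the constraint phi = c attains the unpenalized infimum in [QLR], and its
   penalty is bounded with probability approaching one. *)
Definition restricted_ok (c : R)
    (alphaR : forall n, ('I_n -> ZT) -> par) : Prop :=
  [/\ \forall n \near \oo, forall z : 'I_n -> ZT,
        constrained_sieve n c (alphaR n z),
      wpa1 P (fun n w => approx_min (@Zn n w) (@unit_weights n)
                           (constrained_sieve n c) (alphaR n (@Zn n w))),
      exists C : R,
        wpa1 P (fun n w => (Pen Mo (alphaR n (@Zn n w)).2 <= C%:E)%E) &
      oP P (fun n w => (QLR (@Zn n w) c -
        (n%:R * (Qhat (@Zn n w) (alphaR n (@Zn n w)) -
                 Qhat (@Zn n w) (alphahat Mo (@Zn n w))))%:E)%E)].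

(* Linearity, closedness and monotonicity of the H_K hold by construction. *)
Definition cond_ID : Prop :=
  [/\ forall a, params a ->
        ({ae P, forall w, m Mo (Xgen w) a = 0} <->
         norm_s (a - alpha0 Mo) = 0),
      [/\ compact (Theta Mo), (Theta Mo)° !=set0,
          closure (\bigcup_K Hsieve K) = [set: H],
          forall n, Hsieve (kdim Mo n) (Pi_h0 Mo n) &
          `|Pi_h0 Mo n - (alpha0 Mo).2| @[n --> \oo] --> (0 : R)],
      forall a (y : \bar R), params a -> (y < crit_Q a)%E ->
        exists2 r : R, 0 < r & forall b, params b -> norm_s (b - a) < r ->
          (y < crit_Q b)%E &
      exists c C : R, 0 < c /\ forall x, support P Xgen x -> forall y,
        eigenvalue (Sigma Mo x) y \/ eigenvalue (Sigma0 Mo x) y -> c <= y <= C].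

Definition cond_PEN : Prop :=
  [/\ forall n, 0 < lambda Mo n,
      exists C : R, \forall n \near \oo,
        (crit_Q (Pi_alpha0 n) + (tol Mo n)%:E <= (C * lambda Mo n)%:E)%E,
      (exists C : R, \forall n \near \oo,
        (`|Pen Mo (Pi_h0 Mo n) - Pen Mo (alpha0 Mo).2| <= C%:E)%E) /\
      (Pen Mo (alpha0 Mo).2 < +oo)%E &
      forall C : R, compact [set h : H | (Pen Mo h <= C%:E)%E]].

Definition cond_CRIT_i : Prop :=
  exists c0 : R, 0 < c0 /\
    wpa1 P (fun n w => ((Qhat (@Zn n w) (Pi_alpha0 n))%:E <=
                        c0%:E * crit_Q (Pi_alpha0 n) + (tol Mo n)%:E)%E).

Definition cond_BCRIT_i : Prop :=
  exists c0 : R, 0 < c0 /\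
    cwpa1 (fun n z b => Qhatb z b (alphahat Mo z) <=
                        c0 * Qhat z (alphahat Mo z) + tol Mo n).

Section local_conditions.
Variable L : local_objects dY dX dt H.

Definition sieve_M0 n : set par :=
  [set a | sieve (kdim Mo n) a /\
    ((lambda Mo n)%:E * Pen Mo a.2 <= (lambda Mo n * M0 L)%:E)%E].

Definition Aos_sieve K : set par := Aos L `&` sieve K.

Definition Vlin : set par :=
  linspan [set a - alpha0 Mo | a in Aos L].

(* A finite dimensional span is closed, so no closure is taken. *)
Definition Vsieve (K : nat) : set par :=
  linspan [set a - aproj L K | a in Aos_sieve K].

(* The directions on which the pathwise derivative, hence ||.||, is used:
   those of [Vlin] and the a - alpha0 over which [aproj] minimizes ||.||. *)
Definition directions : set par :=
  linspan ([set a - alpha0 Mo | a in Aos L] `|`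
           \bigcup_K [set a - alpha0 Mo | a in sieve_hull K]).

Definition tau (n : nat) : \bar R :=
  ereal_sup [set (norm_s (a - Pi_alpha0 n) / wnorm (a - Pi_alpha0 n))%:E |
    a in Aos_sieve (kdim Mo n) `&` [set a | wnorm (a - Pi_alpha0 n) != 0]].

Definition delta_s (n : nat) : R :=
  `|(alpha0 Mo).2 - Pi_h0 Mo n| + fine (tau n) * delta L n.

Definition Mseq (n : nat) : R :=
  Num.min (ln (ln (n%:R + 1))) (ln ((delta_s n)^-1 + 1)).

Definition Nos (n : nat) : set par :=
  [set a | [/\ params a,
    wnorm (a - alpha0 Mo) <= Mseq n * delta L n,
    norm_s (a - alpha0 Mo) <= Mseq n * delta_s n &
    ((lambda Mo n)%:E * Pen Mo a.2 <= (lambda Mo n * M0 L)%:E)%E]].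

Definition Nosn (n : nat) : set par := Nos n `&` sieve (kdim Mo n).

Definition Tn (n : nat) : set R :=
  [set t | `|t| <= 4 * Mseq n ^+ 2 * delta L n].

Definition ustar (n : nat) : par := (sdnorm (vstar L n))^-1 *: vstar L n.

Definition shift (n : nat) (a : par) (t : R) : par := a + t *: ustar n.

Definition Zscore n (z : 'I_n -> ZT) (b : 'I_n -> R) : R :=
  n%:R^-1 * \sum_i b i * qform (Sigma Mo (z i).2) (dm (z i).2 (ustar n))
                               (rho Mo (z i) (alpha0 Mo)).

Definition rate_r (n : nat) (t : R) : R :=
  (Num.max (t ^+ 2) (Num.max (t / Num.sqrt n%:R) (tol Mo n)))^-1.

Definition lqa_remainder n (z : 'I_n -> ZT) (b : 'I_n -> R) (B : R)
    : \bar R :=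
  ereal_sup [set (rate_r n p.2 *
    `|2^-1 * (Qhatb z b (shift n p.1 p.2) - Qhatb z b p.1)
      - p.2 * (Zscore z b + ip (ustar n) (p.1 - alpha0 Mo))
      - B / 2 * p.2 ^+ 2|)%:E | p in Nosn n `*` Tn n].

(* [Aos] is a ||.||_s-neighbourhood of alpha0 relative to {Pen < M0}: this set
   lies in a ||.||_H-compact set, so in infinite dimension it contains no
   ||.||_s-ball of the whole parameter space. *)
Definition neighborhood_ok : Prop :=
  [/\ convex_set (Aos L), Aos L (alpha0 Mo),
      forall a, Aos L a -> [/\ params a, norm_s (a - alpha0 Mo) < M0 L &
        forall n, ((lambda Mo n)%:E * Pen Mo a.2 <
                   (lambda Mo n * M0 L)%:E)%E] &
      exists2 r : R, 0 < r & forall a, params a ->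
        norm_s (a - alpha0 Mo) < r -> (Pen Mo a.2 < (M0 L)%:E)%E -> Aos L a].

Definition rates_ok : Prop :=
  [/\ (forall n, 0 < dbar L n /\ dbar L n.+1 <= dbar L n) /\
        (dbar L n @[n --> \oo] --> (0 : R)),
      (forall n, 0 < delta L n <= dbar L n) /\
        (delta L n @[n --> \oo] --> (0 : R)),
      (forall n, 0 < dbarstar L n /\ delta L n <= dbarstar L n) /\
        (dbarstar L n @[n --> \oo] --> (0 : R)),
      \forall n \near \oo, tau n \is a fin_num &
      delta_s n @[n --> \oo] --> (0 : R)].

Definition M0_ok : Prop :=
  (\forall n \near \oo, sieve_M0 n (Pi_alpha0 n)) /\
  wpa1 P (fun n w => sieve_M0 n (alphahat Mo (@Zn n w))).

Definition riesz_ok : Prop :=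
  [/\ forall K, sieve_hull K (aproj L K) /\ forall a, sieve_hull K a ->
        wnorm (aproj L K - alpha0 Mo) <= wnorm (a - alpha0 Mo),
      exists dims : nat -> nat,
        (\forall n \near \oo, has_dim (Vsieve (kdim Mo n)) (dims n) /\
                              has_dim (sieve_hull (kdim Mo n)) (dims n)) /\
        (exists c1 c2 : R, 0 < c1 /\ \forall n \near \oo,
          c1 * (kdim Mo n)%:R <= (dims n)%:R <= c2 * (kdim Mo n)%:R) &
      forall n, Vsieve (kdim Mo n) (vstar L n) /\
        forall v, Vsieve (kdim Mo n) v -> dphi v = ip (vstar L n) v].

Definition local_ok : Prop :=
  [/\ neighborhood_ok, rates_ok, M0_ok & riesz_ok].

Definition cond_CRIT_ii : Prop :=
  exists c : R, 0 < c /\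
    tightP P (fun C n w => exists a, sieve_M0 n a /\
      ((Qhat (@Zn n w) a)%:E < c%:E * crit_Q a - (C * dbar L n ^+ 2)%:E)%E).

(* Two-sided derivatives are taken at the points whose theta is interior to
   Theta, where m is defined on both sides. *)
Definition pathwise_diff : Prop :=
  let A := Aos L `&` [set a | (Theta Mo)° a.1] in
  [/\ {ae P, forall w, forall a, A a -> forall v, directions v ->
        derivable (m Mo (Xgen w)) a v},
      {ae P, forall w, forall a, A a -> forall (c : R) v1 v2,
        directions v1 -> directions v2 ->
        'D_(c *: v1 + v2) (m Mo (Xgen w)) a =
          c *: 'D_v1 (m Mo (Xgen w)) a + 'D_v2 (m Mo (Xgen w)) a},
      {ae P, forall w, forall v, directions v ->
        {within A, continuous (fun a => 'D_v (m Mo (Xgen w)) a)}},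
      forall v i, directions v -> borel_fun (fun x => dm x v i 0) &
      forall v, directions v -> P.-integrable setT (fun w =>
        (qform (Sigma Mo (Xgen w)) (dm (Xgen w) v) (dm (Xgen w) v))%:E)].

(* The last conjunct, smallness of the penalty along the perturbations [shift],
   follows from the one before it when [Aos] contains a ||.||_s-ball, since the
   perturbations then stay in [Aos].  It is stated because [Aos] is only a
   relative neighbourhood. *)
Definition cond_LOC : Prop :=
  [/\ pathwise_diff /\ (exists C : R, forall a, Aos L a ->
        wnorm (a - alpha0 Mo) <= C * norm_s (a - alpha0 Mo)),
      exists c1 c2 : R, 0 < c1 /\ forall a, Aos L a ->
        ((c1 * wnorm (a - alpha0 Mo) ^+ 2)%:E <= crit_Q a <=
         (c2 * wnorm (a - alpha0 Mo) ^+ 2)%:E)%E,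
      (exists c : R, 0 < c /\
        tightP P (fun C n w => exists a, Aos_sieve (kdim Mo n) a /\
          ((Qhat (@Zn n w) a)%:E <
           c%:E * crit_Q a - (C * delta L n ^+ 2)%:E)%E)) /\
      (\forall n \near \oo,
        (maxe (maxe (delta L n ^+ 2)%:E (crit_Q (Pi_alpha0 n)))
              (maxe (lambda Mo n)%:E (tol Mo n)%:E) = (delta L n ^+ 2)%:E)%E) &
      (((n%:R * lambda Mo n)%:E * ereal_sup [set `|Pen Mo p.1.2 - Pen Mo p.2.2| |
            p in Aos L `*` Aos L])%E @[n --> \oo] --> 0%E \/
       n%:R * lambda Mo n @[n --> \oo] --> (0 : R)) /\
      ((n%:R * lambda Mo n)%:E *
         ereal_sup [set `|Pen Mo (shift n p.1 p.2).2 - Pen Mo p.1.2| |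
            p in Nosn n `*` Tn n])%E @[n --> \oo] --> 0%E].

Definition cond_BCRIT_ii_iii : Prop :=
  exists c : R, [/\ 0 < c,
    ctightP (fun C n z b => exists a, sieve_M0 n a /\
      Qhatb z b a < c * Qhat z a - C * dbarstar L n ^+ 2) &
    ctightP (fun C n z b => exists a, Aos_sieve (kdim Mo n) a /\
      Qhatb z b a < c * Qhat z a - C * delta L n ^+ 2)].

Definition cond_PHI : Prop :=
  [/\ [/\ exists2 v, Vlin v & dphi v != 0,
          forall K K', (K <= K')%N -> Vsieve K `<=` Vsieve K',
          forall K, (exists r, has_dim (Vsieve K) r) /\
            (forall v, Vsieve K v -> wnorm v = 0 -> v = 0),
          forall v (e : R), Vlin v -> 0 < e ->
            exists K v', Vsieve K v' /\ wnorm (v - v') < e &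
          wnorm (vstar L n) / Num.sqrt n%:R @[n --> \oo] --> (0 : R)],
      ereal_sup [set (Num.sqrt n%:R *
          `|phi Mo (shift n p.1 p.2) - phi Mo (alpha0 Mo)
            - dphi (shift n p.1 p.2 - alpha0 Mo)| / wnorm (vstar L n))%:E |
          p in Nosn n `*` Tn n] @[n --> \oo] --> 0%E &
      Num.sqrt n%:R * `|dphi (aproj L (kdim Mo n) - alpha0 Mo)| /
        wnorm (vstar L n) @[n --> \oo] --> (0 : R)].

Definition shift_in_sieve : Prop :=
  \forall n \near \oo, forall a t, Nosn n a -> Tn n t ->
    sieve (kdim Mo n) (shift n a t).

Definition cond_LQA : Prop :=
  [/\ shift_in_sieve,
      forall n (z : 'I_n -> ZT), 0 < Bn L z,
      forall n, measurable_fun setT (fun w => Bn L (@Zn n w)),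
      OP P (fun n w => (Bn L (@Zn n w))%:E) &
      oP P (fun n w => lqa_remainder (@Zn n w) (@unit_weights n)
                                     (Bn L (@Zn n w)))] /\
  cvg_std_normal P
    (fun n w => Num.sqrt n%:R * Zscore (@Zn n w) (@unit_weights n)).

Definition centered n (b : 'I_n -> R) : 'I_n -> R := fun i => b i - 1.

Definition BL1 : set (R -> R) :=
  [set f | (forall x, `|f x| <= 1) /\ (forall x y, `|f x - f y| <= `|x - y|)].

(* E[f(sqrt n Z_n^{omega-1} / sigma_omega) | Z^n = z]. *)
Definition boot_mean n (f : R -> R) (z : 'I_n -> ZT) : R :=
  \int[P]_w f (Num.sqrt n%:R * Zscore z (centered (@Wn n w)) / sigma_w Mo).

Definition cond_LQAB : Prop :=
  [/\ shift_in_sieve,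
      forall n (z : 'I_n -> ZT) b, 0 < Bomega L z b,
      forall n, measurable_fun setT (fun w => Bomega L (@Zn n w) (@Wn n w)),
      cOP (fun n z b => (Bomega L z b)%:E) &
      coP (fun n z b => lqa_remainder z b (Bomega L z b))] /\
  oP P (fun n w => ereal_sup
    [set (`|boot_mean f (@Zn n w) -
            \int[normal_prob (0 : R) 1]_x f x|)%:E | f in BL1]).

Definition cond_Bomega : Prop :=
  coP (fun n z b => (`|Bomega L z b - wnorm (ustar n) ^+ 2|)%:E).

Definition scaled_QLRB n (z : 'I_n -> ZT) (b : 'I_n -> R) : \bar R :=
  (QLRB z b * ((sigma_w Mo ^+ 2)^-1)%:E)%E.

Definition conclusion_expansion : Prop :=
  coP (fun n z b => (scaled_QLRB z b -
    ((Num.sqrt n%:R * (Zscore z (centered b) /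
       (sigma_w Mo * wnorm (ustar n)))) ^+ 2)%:E)%E) /\
  cOP (fun n z b => scaled_QLRB z b).

(* The sup does not depend on the weights: it is a function of Z^n only. *)
Definition conclusion_distribution (c : R) : Prop :=
  coP (fun n z _ => ereal_sup (range (fun t : R =>
    (`|condP P Wn (fun z' b => (scaled_QLRB z' b <= t%:E)%E) z -
       outerP P [set w | (QLR (@Zn n w) c <= t%:E)%E]|)%E))).

End local_conditions.
End conditions.

(* Main.v *)
Require Import Defs.
From HB Require Import structures.
From mathcomp Require Import all_boot all_order all_algebra.
From mathcomp Require Import all_classical all_reals all_analysis.
From mathcomp Require Import measurable_realfun.
From mathcomp Require Import ring lra.
Import Order.TTheory GRing.Theory Num.Theory.
Import numFieldNormedType.Exports.

Set Implicit Arguments.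
Unset Strict Implicit.
Unset Printing Implicit Defensive.

Local Open Scope classical_set_scope.
Local Open Scope ring_scope.

(** The sample ratio and the bootstrap ratio obey one deterministic expansion,
    in which each is a squared score divided by the same number; two scores with
    the same normal limit then give two distribution functions that merge.

    Localization.  Comparison with a feasible point bounds the penalty and the
    criterion of every estimator [approx_min_bound].  Bounded penalties form a
    compact set on which the criterion separates alpha0 [crit_Q_separated], so
    the estimators are consistent; the quadratic behaviour of the criterion near
    alpha0 then turns the bound on the criterion into the rate delta
    [rate_Nosn].  The restricted sample estimator is compared with a shift of
    the unrestricted one onto the constraint [restricted_rate].

    Scale.  The expansions take steps s / sqrt n along ustar, and these must be
    admissible: within the range where the quadratic approximation holds, and
    too short for the penalty to matter.  Both follow from a lower bound on
    n lambda_n [n_lambda_lower]: if n lambda_n were small, the criterion at the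
    sieve approximation of alpha0, being of order lambda_n there and nonnegative
    around, would force the standardized score to vanish, against its normal
    limit.

    Expansion.  Let a_n = ||ustar||^2, let S be the standardized score and
    lin (a) = sqrt n <ustar, a - alpha0>.  Along a step s the criterion times
    n / 2 moves by s (S + lin a) + a_n s^2 / 2 [lqa_scaled, Bn_consistent], and
    the standardized functional moves from lin (a) to lin (a) + s a_n
    [phi_linear].  Hence an approximate minimizer satisfies S + lin a ~ 0
    [approx_min_foc], a point where the standardized functional equals x
    satisfies lin a ~ x, and n times the increase of the criterion from the
    first to the second is (S + x)^2 / a_n [QLR_expansion].  For the sample
    ratio under the null x = 0.  For the bootstrap ratio x = lin (alphahat) is
    nearly the opposite of the sample score, and S + x is nearly the score with
    centred weights [QLRB_close].

    Distribution.  A statistic within e of X^2 / a, for |X| close in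
    distribution to |N(0,1)|, has a distribution function uniformly close to
    that of N(0,1)^2 / a [square_cdf_close].  The normal limit of the sample
    score gives this closeness by Polya's argument [polya_abs_cdf], and the
    bounded Lipschitz limit of the bootstrap score by testing it on bumps
    [BL_abs_close]; a_n is the same number for both statistics.

    Probabilities are outer probabilities throughout.  Events that hold with
    probability approaching one are stable under intersection and under
    implications that hold for large n, which reduces every step to inequalities
    between real numbers. *)

(** * Outer probability and statements that hold with probability approaching one *)

Section outer_probability.
Context {R : realType} {d : measure_display} {T : measurableType d}.
Variable P : probability T R.

Lemma outerP_ge0 (A : set T) : (0 <= outerP P A)%E.
Proof. exact: mu_ext_ge0. Qed.

Lemma le_outerP (A B : set T) : A `<=` B -> (outerP P A <= outerP P B)%E.
Proof. exact: le_mu_ext. Qed.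

Lemma outerP0 : outerP P set0 = 0%E.
Proof. by rewrite /outerP mu_ext0. Qed.

Lemma outerP_measurable (A : set T) : measurable A -> outerP P A = P A.
Proof. by move=> mA; rewrite /outerP measurable_mu_extE. Qed.

Lemma outerP_le1 (A : set T) : (outerP P A <= 1)%E.
Proof.
apply: (@le_trans _ _ (outerP P setT)); first exact: le_outerP.
by rewrite outerP_measurable// probability_setT.
Qed.

Lemma outerP_fin (A : set T) : outerP P A \is a fin_num.
Proof.
rewrite ge0_fin_numE ?outerP_ge0//.
by apply: le_lt_trans (outerP_le1 A) _; rewrite ltry.
Qed.

Lemma outerPU (A B : set T) :
  (outerP P (A `|` B) <= outerP P A + outerP P B)%E.
Proof. exact: (@outer_measureU2 _ _ (@mu_ext _ _ _ P)). Qed.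

Lemma le_outerPU (A B C : set T) (x y : \bar R) : A `<=` B `|` C ->
  (outerP P B <= x)%E -> (outerP P C <= y)%E -> (outerP P A <= x + y)%E.
Proof.
move=> /le_outerP AB Bx Cy; apply: (le_trans AB).
by apply: (le_trans (outerPU _ _)); apply: leeD.
Qed.

Lemma outerP_gt_split (f g h : T -> \bar R) (e e' : R) :
  (forall w, f w <= g w + h w)%E ->
  (outerP P [set w | ((e / 2)%:E < g w)%E] <= (e' / 2)%:E)%E ->
  (outerP P [set w | ((e / 2)%:E < h w)%E] <= (e' / 2)%:E)%E ->
  (outerP P [set w | (e%:E < f w)%E] <= e'%:E)%E.
Proof.
move=> fgh Pg Ph; rewrite [e'](splitr e') EFinD; apply: le_outerPU Pg Ph.
move=> w /= ew; have [?|gw] := ltP (e / 2)%:E (g w); [by left|right].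
have [//|hw] := ltP (e / 2)%:E (h w).
have := lt_le_trans ew (le_trans (fgh w) (leeD gw hw)).
by rewrite -EFinD -splitr ltxx.
Qed.

End outer_probability.

Section cvg_to_zero.
Context {R : realType}.

Lemma ecvg0P (f : nat -> \bar R) : (forall n, 0 <= f n)%E ->
  (f n @[n --> \oo] --> 0%E) <->
  (forall e : R, 0 < e -> \forall n \near \oo, (f n <= e%:E)%E).
Proof.
move=> f0; split=> [/fine_cvgP[ff cf] e e0|H].
  move/cvgrPdist_le: cf => /(_ e e0) cf.
  near=> n.
  have fn : f n \is a fin_num by near: n.
  have : `|0 - fine (f n)| <= e by near: n; exact: cf.
  by rewrite sub0r normrN ger0_norm ?fine_ge0// -lee_fin fineK.
apply/fine_cvgP; split.
  near=> n; rewrite ge0_fin_numE//.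
  apply: (@le_lt_trans _ _ 1%:E); last by rewrite ltry.
  by near: n; apply: H.
apply/cvgrPdist_le => e e0; near=> n.
rewrite sub0r normrN.
have fe : (f n <= e%:E)%E by near: n; exact: H.
have fn : f n \is a fin_num.
  by rewrite ge0_fin_numE//; apply: le_lt_trans fe _; rewrite ltry.
by rewrite ger0_norm ?fine_ge0// -lee_fin fineK.
Unshelve. all: by end_near. Qed.

Lemma ecvg0_near (f : nat -> \bar R) : (f n @[n --> \oo] --> 0%E) ->
  forall e : R, 0 < e -> \forall n \near \oo, (`|f n| <= e%:E)%E.
Proof.
move=> cf; apply/(@ecvg0P (fun n => `|f n|%E)); first by move=> n.
by rewrite -[X in _ --> X]abse0; exact: cvg_abse.
Qed.

Lemma rcvg0_near (f : nat -> R) : (f n @[n --> \oo] --> (0 : R)) ->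
  forall e : R, 0 < e -> \forall n \near \oo, `|f n| <= e.
Proof.
move=> /cvgrPdist_le cf e e0; near=> n.
have : `|0 - f n| <= e by near: n; exact: cf.
by rewrite sub0r normrN.
Unshelve. all: by end_near. Qed.

End cvg_to_zero.

Section wpa1_calculus.
Context {R : realType} {d : measure_display} {T : measurableType d}.
Variables (P : probability T R) (ZT : Type).
Variables (Zn : forall n, T -> 'I_n -> ZT) (Wn : forall n, T -> 'I_n -> R).

Local Notation cP := (condP P Wn).
Local Notation W := (cond_wpa1 P Zn Wn).
Local Notation event := (forall n, ('I_n -> ZT) -> ('I_n -> R) -> Prop).

Lemma le_condP n (E F : ('I_n -> ZT) -> ('I_n -> R) -> Prop) z :
  (forall b, E z b -> F z b) -> (cP E z <= cP F z)%E.
Proof. by move=> EF; apply: le_outerP => w; exact: EF. Qed.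

Lemma condP_cst n (E : ('I_n -> ZT) -> Prop) z : E z -> cP (fun z _ => E z) z = 1%E.
Proof.
move=> Ez; rewrite /condP (_ : [set _ | _] = setT); last by apply/seteqP; split.
by rewrite outerP_measurable// probability_setT.
Qed.

Lemma condP_false n (E : ('I_n -> ZT) -> ('I_n -> R) -> Prop) z :
  (forall b, ~ E z b) -> cP E z = 0%E.
Proof.
move=> nE; rewrite /condP (_ : [set _ | _] = set0) ?outerP0//.
by apply/seteqP; split => // w /nE.
Qed.

Lemma cond_wpa1P (E : event) : W E <-> forall e e' : R, 0 < e -> 0 < e' ->
  \forall n \near \oo,
    (outerP P [set w | (e%:E < cP (fun z b => ~ E n z b) (@Zn n w))%E]
      <= e'%:E)%E.
Proof.
split=> [WE e e' e0|H e e0].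
  by move: e'; apply/ecvg0P; [move=> n; exact: outerP_ge0|exact: WE].
by apply/ecvg0P => [n|e' e'0]; [exact: outerP_ge0|exact: H].
Qed.

Lemma wpa1_mono (E F : event) :
  (\forall n \near \oo, forall z b, E n z b -> F n z b) -> W E -> W F.
Proof.
move=> EF /cond_wpa1P WE; apply/cond_wpa1P => e e' e0 e'0.
near=> n; have EFn : forall z b, E n z b -> F n z b by near: n.
apply: (@le_trans _ _ (outerP P
  [set w | (e%:E < cP (fun z b => ~ E n z b) (@Zn n w))%E])).
  apply: le_outerP => w /= /lt_le_trans; apply.
  by apply: le_condP => b nF /EFn.
by near: n; exact: WE.
Unshelve. all: by end_near. Qed.

Lemma wpa1_and (E F : event) : W E -> W F -> W (fun n z b => E n z b /\ F n z b).
Proof.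
move=> /cond_wpa1P WE /cond_wpa1P WF; apply/cond_wpa1P => e e' e0 e'0.
have e2 : 0 < e / 2 by rewrite divr_gt0.
have e'2 : 0 < e' / 2 by rewrite divr_gt0.
near=> n; apply: (@outerP_gt_split _ _ _ _ _
  (fun w => cP (fun z b => ~ E n z b) (@Zn n w))
  (fun w => cP (fun z b => ~ F n z b) (@Zn n w))).
- move=> w; apply: le_trans (outerPU _ _ _); apply: le_outerP => w' /=.
  by move/not_andP.
- by near: n; exact: WE.
- by near: n; exact: WF.
Unshelve. all: by end_near. Qed.

Lemma wpa1_and_mono (E F G : event) : W E -> W F ->
  (\forall n \near \oo, forall z b, E n z b -> F n z b -> G n z b) -> W G.
Proof.
move=> WE WF EFG; apply: wpa1_mono (wpa1_and WE WF).
by apply: filterS EFG => n EFG z b [Ez Fz]; exact: EFG.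
Qed.

Lemma wpa1_near (E : event) :
  (\forall n \near \oo, forall z b, E n z b) -> W E.
Proof.
move=> HE; apply/cond_wpa1P => e e' e0 e'0; near=> n.
rewrite (_ : [set _ | _] = set0) ?outerP0 ?lee_fin; last first.
  apply/seteqP; split => // w /=; rewrite condP_false ?lte_fin; first lra.
  by move=> b; apply; move: (Zn w) b; near: n.
exact: ltW.
Unshelve. all: by end_near. Qed.

(** In the definition one number bounds both the quantity and its conditional
    probability; monotonicity in each of them separates the two roles. *)
Lemma cond_oPP (D : forall n, ('I_n -> ZT) -> ('I_n -> R) -> \bar R) :
  cond_oP P Zn Wn D <->
  (forall e, 0 < e -> W (fun n z b => (`|D n z b| <= e%:E)%E)).
Proof.
split=> [HD e e0|HD e e0].
  apply/cond_wpa1P => e1 e2 e10 e20.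
  pose m := Num.min e e1.
  have m0 : 0 < m by rewrite lt_min e0.
  have /ecvg0P/(_ e2 e20) := HD m m0.
  move=> H; have {}H := H (fun n => outerP_ge0 _ _).
  apply: filterS H => n; apply: le_trans; apply: le_outerP => w /=.
  move=> h; apply: (@le_lt_trans _ _ e1%:E); first by rewrite lee_fin ge_min lexx orbT.
  apply: (lt_le_trans h); apply: le_condP => b /negP; rewrite -ltNge.
  by apply: le_lt_trans; rewrite lee_fin ge_min lexx.
apply/ecvg0P => [n|e' e'0]; first exact: outerP_ge0.
have /cond_wpa1P/(_ e e' e0 e'0) := HD e e0.
apply: filterS => n; apply: le_trans; apply: le_outerP => w /=.
move=> /lt_le_trans; apply; apply: le_condP => b /= h.
by apply/negP; rewrite -ltNge.
Qed.

(** Tightness lets a quantity be treated as bounded: its bound depends on the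
    probability that is given up, and that probability is arbitrary. *)
Lemma wpa1_ctight_elim
    (E0 : R -> forall n, ('I_n -> ZT) -> ('I_n -> R) -> Prop) (E : event) :
  cond_tightP P Zn Wn E0 ->
  (forall M, W (fun n z b => ~ E0 M n z b -> E n z b)) -> W E.
Proof.
move=> tE0 WE; apply/cond_wpa1P => e e' e0 e'0.
have e2 : 0 < e / 2 by rewrite divr_gt0.
have e'2 : 0 < e' / 2 by rewrite divr_gt0.
have [M cM] := tE0 _ e2.
have /ecvg0P/(_ _ e'2) HM := cM.
have {}HM := HM (fun n => outerP_ge0 _ _).
have /cond_wpa1P/(_ _ _ e2 e'2) {}WE := WE M.
near=> n; apply: (@outerP_gt_split _ _ _ _ _
  (fun w => cP (@E0 M n) (@Zn n w))
  (fun w => cP (fun z b => ~ (~ @E0 M n z b -> E n z b)) (@Zn n w))).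
- move=> w; apply: le_trans (outerPU _ _ _); apply: le_outerP => w' /= nE.
  have [?|nE0] := pselect (E0 M n (Zn w) (Wn w')); [by left|right].
  by move=> /(_ nE0).
- by near: n.
- by near: n.
Unshelve. all: by end_near. Qed.

Lemma wpa1_tight_elim (E0 : R -> forall n, ('I_n -> ZT) -> Prop) (E : event) :
  tightP P (fun M n w => E0 M n (@Zn n w)) ->
  (forall M, W (fun n z b => ~ E0 M n z -> E n z b)) -> W E.
Proof.
move=> tE0 WE; apply/cond_wpa1P => e e' e0 e'0.
have e'2 : 0 < e' / 2 by rewrite divr_gt0.
have [M cM] := tE0 _ e'2.
have /cond_wpa1P/(_ _ _ e0 e'2) {}WE := WE M.
near=> n; rewrite [e'](splitr e') EFinD.
apply: (@le_outerPU _ _ _ _ _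
  [set w | E0 M n (@Zn n w)]
  [set w | (e%:E < cP (fun z b => ~ (~ E0 M n z -> E n z b)) (@Zn n w))%E]).
- move=> w /= ew; have [?|nE0] := pselect (E0 M n (Zn w)); [by left|right].
  apply: (lt_le_trans ew); apply: le_condP => b nE /(_ nE0) //.
- by near: n.
- by near: n.
Unshelve. all: by end_near. Qed.

(** The conditional probability of an event that depends on the sample only is
    0 or 1. *)
Lemma wpa1_sample (E : forall n, ('I_n -> ZT) -> Prop) :
  wpa1 P (fun n w => E n (@Zn n w)) <-> W (fun n z _ => E n z).
Proof.
split=> [HE|/cond_wpa1P HE].
  apply/cond_wpa1P => e e' e0 e'0.
  have /ecvg0P/(_ _ e'0) {}HE := HE.
  have {}HE := HE (fun n => outerP_ge0 _ _).
  apply: filterS HE => n; apply: le_trans; apply: le_outerP => w /=.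
  move=> h Ez; move: h; rewrite condP_false ?lte_fin; first lra.
  by move=> b; exact.
apply/ecvg0P => [n|e e0]; first exact: outerP_ge0.
have h : (0 : R) < 2^-1 by [].
apply: filterS (HE _ _ h e0) => n; apply: le_trans; apply: le_outerP => w /= nE.
by rewrite (@condP_cst _ (fun z => ~ E n z))// lte_fin; lra.
Qed.

Lemma oPP (D : forall n, ('I_n -> ZT) -> \bar R) :
  oP P (fun n w => D n (@Zn n w)) <->
  (forall e, 0 < e -> W (fun n z _ => (`|D n z| <= e%:E)%E)).
Proof.
have h e : wpa1 P (fun n w => (`|D n (@Zn n w)| <= e%:E)%E) <->
   (outerP P [set w | (e%:E < `|D n (@Zn n w)|)%E] @[n --> \oo] --> 0%E).
  rewrite /wpa1 (_ : (fun n => outerP P [set w | ~ _]) =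
    (fun n => outerP P [set w | (e%:E < `|D n (@Zn n w)|)%E]))//.
  by apply/funext => n; congr outerP; apply/seteqP; split => w /=;
    rewrite ltNge => /negP.
split=> HD e e0.
  by apply/(wpa1_sample (fun n z => (`|D n z| <= e%:E)%E))/h/HD.
by apply/h/(wpa1_sample (fun n z => (`|D n z| <= e%:E)%E))/HD.
Qed.

End wpa1_calculus.

Section tight_transfer.
Context {R : realType} {d : measure_display} {T : measurableType d}.
Variables (P : probability T R) (ZT : Type).
Variables (Zn : forall n, T -> 'I_n -> ZT) (Wn : forall n, T -> 'I_n -> R).

Local Notation cP := (condP P Wn).
Local Notation W := (cond_wpa1 P Zn Wn).
Local Notation event := (forall n, ('I_n -> ZT) -> ('I_n -> R) -> Prop).

(** How tightness of bootstrap quantities is proved: the bound on the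
    conditional probability is itself a sample event. *)
Lemma ctightP_of_wpa1 (E : R -> event) :
  (forall e : R, 0 < e -> exists M : R, W (fun n z _ => (cP (E M n) z <= e%:E)%E)) ->
  cond_tightP P Zn Wn E.
Proof.
move=> H e e0; have [M HM] := H e e0; exists M.
have := proj2 (@wpa1_sample _ _ _ P _ Zn Wn (fun n z => (cP (E M n) z <= e%:E)%E)) HM.
rewrite /wpa1; set f := (f in f @ _ --> _); set g := (g in _ -> g @ _ --> _).
rewrite (_ : g = f)//; apply/funext => n; congr outerP.
by apply/seteqP; split => w /=; rewrite ltNge => /negP.
Qed.

Lemma ctightP_transfer (E0 E1 : R -> event) : cond_tightP P Zn Wn E0 ->
  (forall M, exists M', W (fun n z b => ~ E0 M n z b -> ~ E1 M' n z b)) ->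
  cond_tightP P Zn Wn E1.
Proof.
move=> H0 H e e0; have e2 : 0 < e / 2 by rewrite divr_gt0.
have [M cM] := H0 _ e2; have [M' /cond_wpa1P WM] := H M; exists M'.
apply/ecvg0P => [n|e' e'0]; first exact: outerP_ge0.
have e'2 : 0 < e' / 2 by rewrite divr_gt0.
have {}cM := proj1 (ecvg0P (fun n => outerP_ge0 _ _)) cM _ e'2.
apply: filterS2 cM (WM _ _ e2 e'2) => n h1 h2.
apply: outerP_gt_split h1 h2 => w.
apply: le_trans (outerPU _ _ _); apply: le_outerP => w' /= E1w.
have [|nE0] := pselect (E0 M n (Zn w) (Wn w')); [by left|right].
by move=> /(_ nE0).
Qed.

Lemma cond_oP_condP (D : forall n, ('I_n -> ZT) -> ('I_n -> R) -> \bar R) (e : R) :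
  cond_oP P Zn Wn D -> 0 < e ->
  W (fun n z _ => (cP (fun z b => (e%:E < `|D n z b|)%E) z <= e%:E)%E).
Proof.
move=> HD /HD; rewrite -(@wpa1_sample _ _ _ P _ Zn Wn
  (fun n z => (cP (fun z b => (e%:E < `|D n z b|)%E) z <= e%:E)%E)) /wpa1.
set f := (f in f @ _ --> _); set g := (g in _ -> g @ _ --> _).
rewrite (_ : g = f)//; apply/funext => n; congr outerP.
by apply/seteqP; split => w /=; rewrite ltNge => /negP.
Qed.

End tight_transfer.

(** * The absolute value of a nearly normal variable *)

Section abs_distribution.
Context {R : realType}.

Local Notation N01 := (normal_prob (0 : R) 1).

Definition abs_cdf (d : measure_display) (T : measurableType d)
    (P : probability T R) (X : T -> R) (r : R) : R :=
  fine (P [set w | `|X w| <= r]).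

Definition normal_abs_cdf (r : R) : R := abs_cdf N01 id r.

(** Both ratios are asymptotically squares, so only absolute values are
    compared with the normal law. *)
Definition abs_close (d : measure_display) (T : measurableType d)
    (P : probability T R) (X : T -> R) (e : R) : Prop :=
  forall r, `|abs_cdf P X r - normal_abs_cdf r| <= e.

Section generic.
Context {d : measure_display} {T : measurableType d} (P : probability T R).

Lemma measurable_le_set (f : T -> R) (r : R) :
  measurable_fun setT f -> measurable [set w | f w <= r].
Proof.
move=> mf; have := mf measurableT `]-oo, r]%classic (measurable_itv _).
by rewrite setTI (_ : _ @^-1` _ = [set w | f w <= r])//; apply/seteqP; split => w /=;
  rewrite in_itv.
Qed.

Lemma measurable_abs_le (f : T -> R) (r : R) :
  measurable_fun setT f -> measurable [set w | `|f w| <= r].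
Proof. by move=> mf; apply: measurable_le_set; exact: measurableT_comp. Qed.

Lemma probability_fin_num (A : set T) : measurable A -> P A \is a fin_num.
Proof. by move=> mA; exact: fin_num_measure. Qed.

Lemma abs_cdfE (X : T -> R) r : measurable_fun setT X ->
  (abs_cdf P X r)%:E = P [set w | `|X w| <= r].
Proof.
by move=> mX; rewrite fineK// probability_fin_num//; exact: measurable_abs_le.
Qed.

Lemma abs_cdf_ge0 (X : T -> R) r : 0 <= abs_cdf P X r.
Proof. by rewrite fine_ge0. Qed.

Lemma abs_cdf_le1 (X : T -> R) r : measurable_fun setT X -> abs_cdf P X r <= 1.
Proof.
move=> mX; rewrite -lee_fin abs_cdfE//.
by apply: probability_le1; exact: measurable_abs_le.
Qed.

Lemma abs_cdf_mono (X : T -> R) r s : measurable_fun setT X -> r <= s ->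
  abs_cdf P X r <= abs_cdf P X s.
Proof.
move=> mX rs; rewrite -lee_fin !abs_cdfE//; apply: le_measure;
  rewrite ?inE; [exact: measurable_abs_le..|].
by move=> w /= h; exact: le_trans rs.
Qed.

Lemma abs_cdf_lt0 (X : T -> R) r : r < 0 -> abs_cdf P X r = 0.
Proof.
move=> r0; rewrite /abs_cdf (_ : [set _ | _] = set0) ?measure0//.
by apply/seteqP; split => // w /= h; move: (le_lt_trans h r0); rewrite normr_lt0.
Qed.

End generic.

(** The standard normal density is at most 1. *)
Lemma normal_itv_le (a b : R) : a <= b -> (N01 `[a, b] <= (b - a)%:E)%E.
Proof.
move=> ab; apply: (@le_trans _ _ (\int[lebesgue_measure]_(x in `[a, b]) (cst 1%E x))%E).
  apply: ge0_le_integral => //=.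
  - by move=> x _; rewrite lee_fin normal_pdf_ge0.
  - apply/measurable_EFinP/(@measurable_funS _ _ _ _ setT) => //.
    exact: measurable_normal_pdf.
  - move=> x _; rewrite lee_fin.
    apply: (le_trans (@normal_pdf_ub R 0 1 x _)); first exact: oner_neq0.
    rewrite /normal_peak invf_le1 ?sqrtr_gt0; last first.
      by rewrite expr1n mul1r mulrn_wgt0// pi_gt0.
    rewrite -[leLHS]sqrtr1 ler_sqrt ?ltr01//; last first.
      by rewrite expr1n mul1r mulrn_wge0// pi_ge0.
    by have := @pi_ge2 R; rewrite expr1n mul1r; lra.
rewrite integral_cst// mul1e.
suff : (lebesgue_measure `[a, b]%classic <= (b - a)%:E)%E by [].
rewrite lebesgue_measure_itv/= lte_fin.
by case: ifP => // _; rewrite ?lee_fin ?subr_ge0//.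
Qed.

Lemma normal_abs_cdf_lip r s : r <= s ->
  normal_abs_cdf s <= normal_abs_cdf r + 2 * (s - r).
Proof.
move=> rs; have mid : measurable_fun setT (@id R) by [].
have s0 : 0 <= s - r by rewrite subr_ge0.
rewrite -lee_fin EFinD !abs_cdfE//.
apply: (@le_trans _ _ (N01 ([set x : R | `|x| <= r] `|` (`[- s, - r]%classic `|` `[r, s]%classic)))).

  apply: le_measure; rewrite ?inE.
  - exact: (@measurable_abs_le _ _ id).
  - by apply: measurableU; [exact: (@measurable_abs_le _ _ id)|exact: measurableU].
  - move=> x /= xs; have [xr|rx] := leP `|x| r; [by left|right].
    move: xs rx; have [x0|x0] := leP 0 x; rewrite !in_itv/=.
      by rewrite ger0_norm// => -> /ltW ->; right.
    by rewrite ltr0_norm// => h1 h2; left; apply/andP; split; lra.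
apply: le_trans (measureU2 _ _ _) _ => //.
- exact: (@measurable_abs_le _ _ id).
- exact: measurableU.
apply: leeD => //; apply: le_trans (measureU2 _ _ _) _ => //.
rewrite mulr_natl mulr2n EFinD; apply: leeD; last exact: normal_itv_le.
by apply: le_trans (normal_itv_le _) _; rewrite ?lerN2// lee_fin; lra.
Qed.

Lemma normal_abs_cdf_le r : 0 <= r -> normal_abs_cdf r <= 2 * r.
Proof.
move=> r0; have mid : measurable_fun setT (@id R) by [].
rewrite -lee_fin abs_cdfE//.
have -> : [set w : R | `|id w| <= r] = `[- r, r]%classic.
  by apply/seteqP; split => x /=; rewrite in_itv/= ler_norml.
by apply: le_trans (normal_itv_le _) _; [lra|rewrite lee_fin; lra].
Qed.

Lemma normal_abs_cdf_tail (e : R) : 0 < e ->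
  exists M : R, 0 < M /\ 1 - e <= normal_abs_cdf M.
Proof.
move=> e0; have mid : measurable_fun setT (@id R) by [].
pose F (n : nat) := [set x : R | `|x| <= n%:R].
have FT : \bigcup_n F n = setT.
  apply/seteqP; split => // x _; exists (Num.truncn `|x|).+1 => //=.
  by rewrite /F /= ltW// truncnS_gt.
have N1 : N01 setT = 1%E by exact: (@probability_setT _ _ _ N01).
have H : (N01 \o F) n @[n --> \oo] --> 1%:E.
  rewrite -N1 -FT; apply: nondecreasing_cvg_mu => //.
  - by move=> n; exact: (@measurable_abs_le _ _ id).
  - by rewrite FT.
  - move=> n m nm; apply/subsetPset => x /= h; apply: le_trans h _.
    by rewrite ler_nat.
move/fine_cvgP : H => [_ /cvgrPdist_le /(_ e e0) [n _ Hn]].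
exists (n.+1)%:R; split; first by rewrite ltr0n.
have : `|1 - normal_abs_cdf (n.+1)%:R| <= e by exact: (Hn n.+1 (leqnSn _)).
by rewrite ler_norml => /andP[_]; lra.
Qed.

(** Polya's argument: a monotone sequence converging pointwise to a Lipschitz
    function with a finite total increment converges uniformly, since finitely
    many grid points control it everywhere. *)
Lemma polya_abs_cdf (g : nat -> R -> R) :
  (forall n r s, r <= s -> g n r <= g n s) ->
  (forall n r, 0 <= g n r <= 1) -> (forall n r, r < 0 -> g n r = 0) ->
  (forall r e, 0 <= r -> 0 < e ->
    \forall n \near \oo, `|g n r - normal_abs_cdf r| <= e) ->
  forall e, 0 < e ->
    \forall n \near \oo, forall r, `|g n r - normal_abs_cdf r| <= e.
Proof.
move=> gm g01 g0 gc e e0; have mid : measurable_fun setT (@id R) by [].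
have [M [M0 GM]] := @normal_abs_cdf_tail (e / 4) (divr_gt0 e0 (ltr0Sn _ _)).
pose h := e / 4; have h0 : 0 < h by rewrite divr_gt0.
pose K := (Num.truncn (M / h)).+1.
have MK : M <= K%:R * h.
  by rewrite -ler_pdivrMr// ltW// truncnS_gt.
have grid : \forall n \near \oo, forall i : 'I_K.+1,
    `|g n (i%:R * h) - normal_abs_cdf (i%:R * h)| <= e / 4.
  apply: filter_forall => i; apply: gc; last by rewrite divr_gt0.
  by rewrite mulr_ge0// ltW.
apply: filterS grid => n grid r.
have [r0|r0] := ltP r 0.
  by rewrite g0// /normal_abs_cdf abs_cdf_lt0// subrr normr0 ltW.
have [rK|Kr] := ltP r (K%:R * h).
  pose i := Num.truncn (r / h).
  have ri : i%:R * h <= r by rewrite -ler_pdivlMr// truncn_le// divr_ge0// ltW.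
  have ir : r <= i.+1%:R * h by rewrite -ler_pdivrMr// ltW// truncnS_gt.
  have iK : (i < K)%N.
    by rewrite -(ltr_nat R) -(ltr_pM2r h0); exact: le_lt_trans ri rK.
  have i1 : (i < K.+1)%N by rewrite ltnW.
  have i2 : (i.+1 < K.+1)%N by [].
  have /= := grid (Ordinal i1); have /= := grid (Ordinal i2).
  rewrite !ler_norml => /andP[a1 a2] /andP[b1 b2].
  have := gm n _ _ ri; have := gm n _ _ ir.
  have := normal_abs_cdf_lip ri; have := normal_abs_cdf_lip ir.
  have ii : i.+1%:R * h - i%:R * h = h by rewrite -natr1; ring.
  move: a1 a2 b1 b2 => + + + + c1 c2 c3 c4.
  rewrite -/h => a1 a2 b1 b2; have eh : e = 4 * h by rewrite /h; field.
  by apply/andP; split; lra.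
have /= := grid (@ord_max K); rewrite ler_norml => /andP[a1 a2].
have := gm n _ _ Kr; have /andP[_ ] := g01 n r.
have := abs_cdf_mono N01 mid Kr; have := abs_cdf_mono N01 mid MK.
have := @abs_cdf_le1 _ _ N01 _ r mid.
rewrite -!/(normal_abs_cdf _) => c1 c2 c3 c4 c5.
by rewrite ler_norml; apply/andP; split; lra.
Qed.

End abs_distribution.

Section closeness_criteria.
Context {R : realType} {d : measure_display} {T : measurableType d}.
Variable P : probability T R.

Local Notation N01 := (normal_prob (0 : R) 1).

Local Notation Ncdf x := (N01 [set` `]-oo, x%R]]).

Let normal_cdf_abs (r : R) : 0 <= r ->
  (Ncdf r = (normal_abs_cdf r)%:E + Ncdf (- r)%R)%E.
Proof.
move=> r0; have mid : measurable_fun setT (@id R) by [].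
have mabs := measurable_abs_le r mid.
have NU : (N01 ([set x : R | (`|x| <= r)%R] `|` [set` `]-oo, (- r)%R[]) =
           N01 [set x | (`|x| <= r)%R] + N01 [set` `]-oo, (- r)%R[])%E.
  apply: measureU => //; apply/seteqP; split => // x /= [].
  by rewrite in_itv/= ler_norml => /andP[/le_lt_trans h _] /h; rewrite ltxx.
have -> : (`]-oo, r]%classic = [set x | `|x| <= r] `|` `]-oo, (- r)[%classic).
  apply/seteqP; split => x /=; rewrite !in_itv/= ler_norml.
    by move=> ->; rewrite andbT; apply/orP; case: leP.
  by move=> [/andP[]//|xr]; lra.
rewrite NU abs_cdfE//; congr (_ + _)%E; apply/eqP; rewrite eq_le; apply/andP; split.
  apply: le_measure; rewrite ?inE//.
  by move=> x /=; rewrite !in_itv/= => /ltW.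
have -> : `]-oo, (- r)]%classic = `]-oo, (- r)[%classic `|` `[- r, - r]%classic.
  apply/seteqP; split => x /=; rewrite !in_itv/=.
    by move=> h; apply/orP; case: ltgtP h => //= -> _; rewrite lexx.
  by move=> [/ltW//|/andP[]].
apply: le_trans (measureU2 _ _ _) _ => //.
rewrite -[leRHS]adde0; apply: leeD => //.
by apply: le_trans (normal_itv_le _) _ => //; rewrite subrr.
Qed.

Let normal_cdf_step (a b : R) : a <= b ->
  (Ncdf b <= Ncdf a + (b - a)%:E)%E.
Proof.
move=> ab.
apply: (@le_trans _ _ (N01 (`]-oo, a]%classic `|` `[a, b]%classic))).
  apply: le_measure; rewrite ?inE//; first exact: measurableU.
  by move=> x /=; rewrite !in_itv/= => xb; have [?|/ltW ->] := leP x a; [left|right].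
apply: le_trans (measureU2 _ _ _) _ => //; apply: leeD => //.
exact: normal_itv_le.
Qed.

(** The event |X| <= r lies between differences of distribution functions at r
    and near - r, and the normal law has no atom at - r. *)
Lemma cvg_std_normal_abs_close (X : nat -> T -> R) :
  (forall n, measurable_fun setT (X n)) -> cvg_std_normal P X ->
  forall e, 0 < e -> \forall n \near \oo, abs_close P (X n) e.
Proof.
move=> mX cX; apply: polya_abs_cdf.
- by move=> n r s; exact: abs_cdf_mono.
- by move=> n r; rewrite abs_cdf_ge0 abs_cdf_le1.
- by move=> n r; exact: abs_cdf_lt0.
move=> r e r0 e0.
have cdf x n : P [set w | X n w <= x] \is a fin_num.
  by apply: probability_fin_num; exact: measurable_le_set.
have ncdf x : N01 `]-oo, x]%classic \is a fin_num.
  by apply: probability_fin_num.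
pose F n x := fine (P [set w | X n w <= x]).
pose Phi x := fine (N01 `]-oo, x]%classic).
have FE n x : (F n x)%:E = P [set w | X n w <= x] by rewrite fineK.
have PhiE x : (Phi x)%:E = N01 `]-oo, x]%classic by rewrite fineK.
have cF x e' : 0 < e' -> \forall n \near \oo, `|Phi x - F n x| <= e'.
  move=> e'0; have := cX x; rewrite -PhiE => /fine_cvgP[_ /cvgrPdist_le].
  exact.
have PhiA : Phi r = normal_abs_cdf r + Phi (- r).
  by apply: EFin_inj; rewrite EFinD !PhiE normal_cdf_abs.
pose h := e / 3; have h0 : 0 < h by rewrite divr_gt0.
have PhiS : Phi (- r) <= Phi (- r - h) + h.
  rewrite -lee_fin EFinD !PhiE.
  apply: le_trans (@normal_cdf_step (- r - h) (- r) _) _.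
    by rewrite gerBl ltW.
  by rewrite leeD// lee_fin opprB addrCA subrr addr0.
near=> n.
have c1 : `|Phi r - F n r| <= h by near: n; exact: cF.
have c2 : `|Phi (- r) - F n (- r)| <= h by near: n; exact: cF.
have c3 : `|Phi (- r - h) - F n (- r - h)| <= h by near: n; exact: cF.
have u1 : F n r <= abs_cdf P (X n) r + F n (- r).
  rewrite -lee_fin EFinD abs_cdfE// !FE.
  apply: le_trans (measureU2 _ _ _); last 2 first.
  - exact: measurable_abs_le.
  - exact: measurable_le_set.
  apply: le_measure; rewrite ?inE; first exact: measurable_le_set.
    by apply: measurableU; [exact: measurable_abs_le|exact: measurable_le_set].
  move=> w /= Xr; rewrite ler_norml Xr andbT.
  by have [/ltW ?|?] := ltP (X n w) (- r); [right|left].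
have u2 : abs_cdf P (X n) r + F n (- r - h) <= F n r.
  rewrite -lee_fin EFinD abs_cdfE// !FE -measureU; last first.
  - apply/seteqP; split => // w /= []; rewrite ler_norml => /andP[h1 _] h2.
    by have := le_trans h1 h2; rewrite lerBrDr gerDl leNgt h0.
  - exact: measurable_le_set.
  - exact: measurable_abs_le.
  apply: le_measure; rewrite ?inE; last 1 first.
  - move=> w /= []; first by rewrite ler_norml => /andP[].
    by move=> h1; lra.
  - by apply: measurableU; [exact: measurable_abs_le|exact: measurable_le_set].
  exact: measurable_le_set.
move: c1 c2 c3; rewrite !ler_norml => /andP[? ?] /andP[? ?] /andP[? ?].
have eh : e = 3 * h by rewrite /h; field.
by apply/andP; split; lra.
Unshelve. all: by end_near. Qed.

End closeness_criteria.

Section bounded_Lipschitz.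
Context {R : realType}.

Local Notation N01 := (normal_prob (0 : R) 1).

(** A trapezoid of height [h] with sides of slope 1, so that it is Lipschitz
    with constant 1; divided by [h] it approximates the indicator of [- r, r]. *)
Definition bump (h r x : R) : R := Num.min h (Num.max 0 (r + h - `|x|)).

Lemma bump_BL1 h r : 0 <= h <= 1 -> BL1 (bump h r).
Proof.
move=> /andP[h0 h1]; split=> [x|x y]; rewrite /bump.
  rewrite ger0_norm ?ge_min ?h1// le_min h0 le_max lexx//.
have : `| `|x| - `|y| | <= `|x - y| by exact: ler_dist_dist.
move: `|x| `|y| `|x - y| => a b c; rewrite !ler_norml => /andP[? ?].
by rewrite /Num.min /Num.max; do 4! case: ifPn; rewrite -?leNgt; intros; lra.
Qed.

Lemma measurable_bump h r : measurable_fun setT (bump h r).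
Proof.
apply: measurable_minr => //; apply: measurable_maxr => //.
by apply: measurable_funB => //; exact: measurable_normr.
Qed.

Lemma bump_ge0 h r x : 0 <= h -> 0 <= bump h r x.
Proof. by move=> h0; rewrite le_min h0 le_max lexx. Qed.

Lemma bump_in h r x : `|x| <= r -> bump h r x = h.
Proof.
by move=> xr; rewrite /bump /Num.min /Num.max; do 2! case: ifPn; rewrite -?leNgt;
  move: xr; move: `|x| => y; intros; lra.
Qed.

Lemma bump_out h r x : 0 <= h -> r + h < `|x| -> bump h r x = 0.
Proof.
by move=> h0 xr; rewrite /bump /Num.min /Num.max; do 2! case: ifPn; rewrite -?leNgt;
  move: xr; move: `|x| => y; intros; lra.
Qed.

Context {d : measure_display} {T : measurableType d} (P : probability T R).

Lemma expect_bump (X : T -> R) h r : 0 <= h -> measurable_fun setT X ->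
  h * abs_cdf P X r <= \int[P]_w bump h r (X w) <= h * abs_cdf P X (r + h).
Proof.
move=> h0 mX.
have mb : measurable_fun setT (EFin \o (bump h r \o X)).
  by apply/measurable_EFinP; apply: measurableT_comp => //; exact: measurable_bump.
have key s : (\int[P]_w (h * \1_[set w | (`|X w| <= s)%R] w)%:E)%E =
             (h * abs_cdf P X s)%:E.
  under eq_integral do rewrite EFinM.
  rewrite ge0_integralZl//; last first.
  - by apply/measurable_EFinP; exact: measurable_indic (measurable_abs_le _ _).
  rewrite integral_indic//; last exact: measurable_abs_le.
  by rewrite setIT EFinM abs_cdfE.
have mi s : measurable_fun setT
    (fun w => (h * \1_[set w | (`|X w| <= s)%R] w)%:E : \bar R).
  apply/measurable_EFinP; apply: measurable_funM => //.
  by apply: measurable_indic; exact: measurable_abs_le.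
have lo : ((h * abs_cdf P X r)%:E <= \int[P]_w (bump h r (X w))%:E)%E.
  rewrite -key; apply: ge0_le_integral => //.
  - by move=> w _; rewrite lee_fin mulr_ge0.
  - move=> w _; rewrite lee_fin indicE; case: (boolP (w \in _)) => [|_].
      by rewrite inE/= => /(bump_in h) ->; rewrite mulr1.
    by rewrite mulr0 bump_ge0.
have hi : (\int[P]_w (bump h r (X w))%:E <= (h * abs_cdf P X (r + h))%:E)%E.
  rewrite -key; apply: ge0_le_integral => //.
  - by move=> w _; rewrite lee_fin bump_ge0.
  - move=> w _; rewrite lee_fin indicE; case: (boolP (w \in _)) => [_|].
      by rewrite mulr1 ge_min lexx.
    rewrite notin_setE/= => /negP; rewrite -ltNge => /bump_out -> //.
    by rewrite mulr0.
have fi : (\int[P]_w (bump h r (X w))%:E)%E \is a fin_num.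
  rewrite ge0_fin_numE; first by apply: le_lt_trans hi _; rewrite ltry.
  by apply: integral_ge0 => w _; rewrite lee_fin bump_ge0.
by rewrite /Rintegral -!lee_fin fineK// lo hi.
Qed.

End bounded_Lipschitz.

Section BL_closeness.
Context {R : realType} {d : measure_display} {T : measurableType d}.
Variable P : probability T R.

(** A bump of height [h] tests the distribution function up to a shift of [h]
    in its argument, and dividing by the height costs one factor [h]: hence
    the tolerance [h ^+ 2] on the integrals. *)
Lemma BL_abs_close (X : T -> R) (h : R) : measurable_fun setT X -> 0 < h <= 1 ->
  (forall f, BL1 f -> `|\int[P]_w f (X w) -
     \int[normal_prob (0 : R) 1]_x f x| <= h ^+ 2) ->
  abs_close P X (3 * h).
Proof.
move=> mX /andP[h0 h1] H r; have mid : measurable_fun setT (@id R) by [].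
have hh : 0 <= h <= 1 by rewrite ltW.
have := H _ (bump_BL1 r hh); have := H _ (bump_BL1 (r - h) hh).
have /andP[a1 _] := expect_bump P r (ltW h0) mX.
have /andP[_ a2] := expect_bump P (r - h) (ltW h0) mX.
have /andP[_ a3] := expect_bump (normal_prob (0 : R) 1) r (ltW h0) mid.
have /andP[a4 _] := expect_bump (normal_prob (0 : R) 1) (r - h) (ltW h0) mid.
move: a1 a2 a3 a4; rewrite subrK -!/(normal_abs_cdf _) /=.
have b1 : normal_abs_cdf (r + h) <= normal_abs_cdf r + 2 * h.
  have := @normal_abs_cdf_lip R r (r + h); rewrite lerDl addrAC subrr add0r.
  by apply; exact: ltW.
have b2 : normal_abs_cdf r <= normal_abs_cdf (r - h) + 2 * h.
  have := @normal_abs_cdf_lip R (r - h) r; rewrite gerBl opprB addrCA subrr addr0.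
  by apply; exact: ltW.
move: b1 b2; rewrite !ler_norml.
move: (normal_abs_cdf r) (normal_abs_cdf (r + h)) (normal_abs_cdf (r - h))
  (abs_cdf P X r) => g gp gm p.
set i1 := \int[P]_w _; set i2 := \int[P]_w _.
set j1 := \int[_]_w _; set j2 := \int[_]_w _.
move=> b1 b2 a1 a2 a3 a4 /andP[c1 c2] /andP[c3 c4].
have b1' : h * gp <= h * (g + 2 * h) by rewrite ler_pM2l.
have b2' : h * g <= h * (gm + 2 * h) by rewrite ler_pM2l.
by apply/andP; split; rewrite -(ler_pM2l h0); nra.
Qed.

End BL_closeness.

Section square_distribution.
Context {R : realType} {d : measure_display} {T : measurableType d}.
Variable P : probability T R.

Lemma sqrtr_sub (x y : R) : 0 <= y -> Num.sqrt (x + y) <= Num.sqrt x + Num.sqrt y.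
Proof.
move=> y0; have [x0|x0] := leP 0 x.
  rewrite -(@ler_pXn2r _ 2)// ?nnegrE ?addr_ge0 ?sqrtr_ge0//.
  rewrite sqrrD !sqr_sqrtr ?addr_ge0//.
  have : 0 <= Num.sqrt x * Num.sqrt y by rewrite mulr_ge0 ?sqrtr_ge0.
  by rewrite -mulr_natl; lra.
rewrite ler_wpDl ?sqrtr_ge0// ler_wsqrtr// gerDr ltW//.
Qed.

(** An extended real quantity within [e] of X^2 / a, for X nearly normal in
    absolute value, has nearly the distribution of N(0,1)^2 / a; the square
    root of [a e] is the modulus of continuity of the latter. *)
Lemma square_cdf_close (X : T -> R) (D : T -> \bar R) (a e eta t : R) :
  measurable_fun setT X -> 0 < a -> 0 <= e -> abs_close P X eta ->
  (outerP P [set w | e%:E < `|D w - (X w ^+ 2 / a)%:E|] <= e%:E)%E ->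
  `|fine (outerP P [set w | (D w <= t%:E)%E]) - normal_abs_cdf (Num.sqrt (a * t))|
    <= eta + e + 2 * Num.sqrt (a * e).
Proof.
move=> mX a0 e0 HX HD; have mid : measurable_fun setT (@id R) by [].
have ae0 : 0 <= a * e by rewrite mulr_ge0// ltW.
set o := outerP P [set w | (D w <= t%:E)%E].
have oE : (fine o)%:E = o by rewrite fineK// outerP_fin.
have near_D w : ~ (e%:E < `|D w - (X w ^+ 2 / a)%:E|)%E ->
    exists r, D w = r%:E /\ `|r - X w ^+ 2 / a| <= e.
  move=> /negP; rewrite -leNgt; case: (D w) => [r| |] //=.
  by rewrite lee_fin => h; exists r.
have sq w s : `|X w| <= Num.sqrt s -> 0 <= s -> X w ^+ 2 <= s.
  move=> h s0; rewrite -(sqr_sqrtr s0) -real_normK ?num_real//.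
  by rewrite ler_pXn2r// ?nnegrE ?sqrtr_ge0.
have up : fine o <= abs_cdf P X (Num.sqrt (a * (t + e))) + e.
  rewrite -lee_fin EFinD oE abs_cdfE// -outerP_measurable; last exact: measurable_abs_le.
  apply: (le_outerPU _ (lexx _) HD) => w /= Dt.
  have [?|/near_D[r [Dr rX]]] := pselect (e%:E < `|D w - (X w ^+ 2 / a)%:E|)%E; [by right|left].
  move: Dt; rewrite Dr lee_fin => rt; rewrite -sqrtr_sqr ler_wsqrtr//.
  rewrite mulrC -ler_pdivrMr//.
  by move: rX; rewrite ler_norml => /andP[? ?]; lra.
have lo : 0 <= t - e -> abs_cdf P X (Num.sqrt (a * (t - e))) <= fine o + e.
  move=> te; rewrite -lee_fin EFinD oE abs_cdfE// -outerP_measurable; last exact: measurable_abs_le.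
  apply: (le_outerPU _ (lexx _) HD) => w /= Xt.
  have [?|/near_D[r [Dr rX]]] := pselect (e%:E < `|D w - (X w ^+ 2 / a)%:E|)%E; [by right|left].
  rewrite Dr lee_fin.
  have : X w ^+ 2 / a <= t - e.
    by rewrite ler_pdivrMr// mulrC; apply: sq => //; rewrite mulr_ge0// ltW.
  by move: rX; rewrite ler_norml => /andP[? ?]; lra.
have s1 : Num.sqrt (a * (t + e)) <= Num.sqrt (a * t) + Num.sqrt (a * e).
  by rewrite mulrDr; exact: sqrtr_sub.
have s2 : Num.sqrt (a * t) <= Num.sqrt (a * (t - e)) + Num.sqrt (a * e).
  by rewrite -[in leLHS](subrK e t) mulrDr; exact: sqrtr_sub.
have s3 : Num.sqrt (a * t) <= Num.sqrt (a * (t + e)).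
  by rewrite ler_wsqrtr// ler_pM2l// lerDl.
have := HX (Num.sqrt (a * (t + e))); have := normal_abs_cdf_lip s3.
rewrite !ler_norml => g1 /andP[g2 g3]; apply/andP; split; last by lra.
have [te|te] := leP 0 (t - e).
  have s4 : Num.sqrt (a * (t - e)) <= Num.sqrt (a * t).
    by rewrite ler_wsqrtr// ler_pM2l// gerBl.
  have := HX (Num.sqrt (a * (t - e))); have := normal_abs_cdf_lip s4.
  have := lo te; rewrite ler_norml => l1 l2 /andP[l3 l4]; lra.
have : normal_abs_cdf (Num.sqrt (a * t)) <= 2 * Num.sqrt (a * t).
  by apply: normal_abs_cdf_le; rewrite sqrtr_ge0.
have : Num.sqrt (a * t) <= Num.sqrt (a * e).
  by rewrite ler_wsqrtr// ler_pM2l//; lra.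
have : 0 <= eta by apply: le_trans (HX 0).
have : 0 <= fine o by rewrite fine_ge0// outerP_ge0.
lra.
Qed.

End square_distribution.

(** * Quadratic forms of symmetric matrices *)

Section quadratic_forms.
Context {R : realType}.

Lemma qform_lin n (S : 'M[R]_n) (c : R) u v w :
  qform S (c *: u + v) w = c * qform S u w + qform S v w.
Proof. by rewrite /qform linearP/= !mulmxDl -!scalemxAl !mxE. Qed.

Lemma qform0 n (S : 'M[R]_n) w : qform S 0 w = 0.
Proof. by rewrite /qform trmx0 !mul0mx mxE. Qed.

Lemma posdef_unitmx n (S : 'M[R]_n) : posdef S -> S \in unitmx.
Proof.
move=> [_ Sp]; rewrite unitmxE unitfE; apply/det0P => -[v v0 vS].
have : v^T != 0 by rewrite -trmx0 (inj_eq trmx_inj).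
by move=> /Sp; rewrite trmxK vS mul0mx mxE ltxx.
Qed.

Lemma qformE n (S : 'M[R]_n) (u v : 'cV[R]_n) : posdef S ->
  qform S u v = ((invmx S *m u)^T *m S *m (invmx S *m v)) 0 0.
Proof.
move=> pS; have uS := posdef_unitmx pS; have [SS _] := pS.
by rewrite /qform trmx_mul trmx_inv SS -!mulmxA mulKVmx.
Qed.

Lemma qformC n (S : 'M[R]_n) (u v : 'cV[R]_n) : posdef S ->
  qform S u v = qform S v u.
Proof.
move=> [SS _]; have tr11 (A : 'M[R]_1) : A 0 0 = A^T 0 0 by rewrite mxE.
by rewrite /qform tr11 !trmx_mul trmxK trmx_inv SS mulmxA.
Qed.

Lemma qform_gt0 n (S : 'M[R]_n) (v : 'cV[R]_n) : posdef S -> v != 0 ->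
  0 < qform S v v.
Proof.
move=> pS v0; rewrite qformE//; have [_ Sp] := pS; apply: Sp.
apply: contraNneq v0 => iv0.
by rewrite -(mulKVmx (posdef_unitmx pS) v) iv0 mulmx0.
Qed.

Lemma qform_ge0 n (S : 'M[R]_n) (v : 'cV[R]_n) : posdef S -> 0 <= qform S v v.
Proof.
by move=> pS; have [->|v0] := eqVneq v 0; [rewrite qform0|exact/ltW/qform_gt0].
Qed.

Lemma qform_eq0 n (S : 'M[R]_n) (v : 'cV[R]_n) : posdef S ->
  qform S v v = 0 -> v = 0.
Proof.
move=> pS; have [//|v0] := eqVneq v 0.
by have := qform_gt0 pS v0 => /gt_eqF /eqP.
Qed.

Lemma qform_abs_le n (S : 'M[R]_n) (u v : 'cV[R]_n) : posdef S ->
  `|qform S u v| <= qform S u u + qform S v v.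
Proof.
move=> pS; have h (s : R) :
    0 <= qform S u u + 2 * s * qform S u v + s ^+ 2 * qform S v v.
  have := qform_ge0 (s *: v + u) pS.
  rewrite qform_lin [qform S v _]qformC// [qform S u (_ + _)]qformC// !qform_lin.
  rewrite [qform S v u]qformC//.
  move: (qform S u u) (qform S u v) (qform S v v) => a b c.
  by congr (0 <= _); ring.
have := h 1; have := h (-1); have := qform_ge0 u pS; have := qform_ge0 v pS.
move: (qform S u u) (qform S u v) (qform S v v) => a b c.
by rewrite ler_norml => *; apply/andP; split; lra.
Qed.

End quadratic_forms.

Section Rayleigh.
Context {R : realType} (n : nat) (S : 'M[R]_n).
Context (symS : S^T = S).

Let q (x y : 'rV[R]_n) : R := (x *m S *m y^T) 0 0.
Let s (x : 'rV[R]_n) : R := (x *m x^T) 0 0.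

Let sE x : s x = \sum_j x 0 j ^+ 2.
Proof. by rewrite /s mxE; apply: eq_bigr => j _; rewrite mxE expr2. Qed.

Let s_ge0 x : 0 <= s x.
Proof. by rewrite sE sumr_ge0// => j _; exact: sqr_ge0. Qed.

Let coord_le (x : 'rV[R]_n) j : x 0 j ^+ 2 <= s x.
Proof.
by rewrite sE (bigD1 j)//= lerDl sumr_ge0// => i _; exact: sqr_ge0.
Qed.

Let s_eq0 x : s x = 0 -> x = 0.
Proof.
move=> sx; apply/rowP => j; rewrite mxE; apply/eqP.
by rewrite -sqrf_eq0 eq_le sqr_ge0 andbT -sx coord_le.
Qed.

Let qC x y : q x y = q y x.
Proof.
rewrite /q; have tr11 (A : 'M[R]_1) : A 0 0 = A^T 0 0 by rewrite mxE.
by rewrite tr11 !trmx_mul trmxK symS mulmxA.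
Qed.

Let qDr x y z : q x (y + z) = q x y + q x z.
Proof. by rewrite /q linearD/= mulmxDr mxE. Qed.

Let qZr c x y : q x (c *: y) = c * q x y.
Proof. by rewrite /q linearZ/= -scalemxAr mxE. Qed.

Let sZ c x : s (c *: x) = c ^+ 2 * s x.
Proof. by rewrite /s linearZ/= -scalemxAl -scalemxAr !mxE mulrA expr2. Qed.

Let sum_continuous (U : topologicalType) (F : 'I_n -> U -> R) :
  (forall j, continuous (F j)) -> continuous (fun x => \sum_j F j x).
Proof.
move=> cF; apply: continuous_big => // x.
by apply: (@cvgD _ R^o); [exact: cvg_fst|exact: cvg_snd].
Qed.

Let entry_continuous (f : 'rV[R]_n -> 'rV[R]_n) :
  (forall j, continuous (fun x => f x 0 j)) ->
  continuous (fun x : 'rV[R]_n => \sum_j f x 0 j * x 0 j).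
Proof.
move=> cf; apply: (@sum_continuous _ (fun j x => f x 0 j * x 0 j)) => j x.
by apply: (@continuousM R); [exact: cf|exact: coord_continuous].
Qed.

Let q_continuous : continuous (fun x => q x x).
Proof.
have -> : (fun x => q x x) = (fun x => \sum_j (x *m S) 0 j * x 0 j).
  by apply/funext => x; rewrite /q mxE; apply: eq_bigr => j _; rewrite [x^T _ _]mxE.
apply: (entry_continuous (f := fun x => x *m S)) => j.
have -> : (fun x : 'rV[R]_n => (x *m S) 0 j) = (fun x => \sum_i x 0 i * S i j).
  by apply/funext => x; rewrite mxE.
apply: (@sum_continuous 'rV[R]_n (fun i x => x 0 i * S i j)) => i x.
by apply: (@continuousM R); [exact: coord_continuous|exact: cst_continuous].
Qed.

Let s_continuous : continuous s.
Proof.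
have -> : s = (fun x => \sum_j x 0 j * x 0 j).
  by apply/funext => x; rewrite sE; apply: eq_bigr => j _; rewrite expr2.
by apply: (entry_continuous (f := id)) => j; exact: coord_continuous.
Qed.

Let sphere : set 'rV[R]_n := [set x | s x = 1].

Let sphere_compact : compact sphere.
Proof.
apply: bounded_closed_compact.
  exists 1; split => // M M1 x sx; apply: le_trans (ltW M1).
  rewrite -[leLHS]/(mx_norm x) mx_normrE; apply/bigmax_leP; split => // -[i j] _ /=.
  rewrite -[leRHS](@normr1 R) -ler_sqr ?nnegrE// !real_normK ?num_real// expr1n.
  by rewrite (ord1 i) -sx coord_le.
rewrite /sphere (_ : [set x | _] = s @^-1` [set 1]); last by [].
by apply: closed_comp; [move=> x _; exact: s_continuous|exact: closed_eq].
Qed.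

(** The maximum of the quadratic form over the compact unit sphere is attained,
    and its first-order condition says that a maximizer is an eigenvector. *)
Lemma Rayleigh_le (C : R) : (forall y, eigenvalue S y -> y <= C) ->
  forall x : 'rV[R]_n, (x *m S *m x^T) 0 0 <= C * (x *m x^T) 0 0.
Proof.
move=> HC x; rewrite -/(q x x) -/(s x).
have [->|x0] := eqVneq x 0; first by rewrite /q /s !mul0mx !mxE mulr0.
have sx0 : s x != 0 by apply: contraNneq x0 => /s_eq0 ->.
have sx : 0 < s x by rewrite lt_def sx0 s_ge0.
pose nrm (y : 'rV[R]_n) := (Num.sqrt (s y))^-1 *: y.
have nrmS y : 0 < s y -> sphere (nrm y).
  move=> y0; rewrite /sphere /= /nrm sZ exprVn sqr_sqrtr ?ltW//.
  by rewrite mulVf// gt_eqF.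
have [e eS emax] := @EVT_max_rV R n (fun y => q y y) sphere
  (ex_intro _ _ (nrmS _ sx)) sphere_compact (continuous_subspaceT q_continuous).
pose l := q e e.
have es : s e = 1 by move: eS; rewrite inE.
have ql y : q y y <= l * s y.
  have [->|y0] := eqVneq y 0; first by rewrite /q /s !mul0mx !mxE mulr0.
  have sy : 0 < s y.
    rewrite lt_def s_ge0 andbT; by apply: contraNneq y0 => /s_eq0 ->.
  have := emax (nrm y); rewrite inE => /(_ (nrmS _ sy)).
  rewrite /nrm qZr qC qZr mulrA -expr2 exprVn (sqr_sqrtr (ltW sy)).
  by rewrite [_^-1 * _]mulrC ler_pdivrMr.
pose p (y : 'rV[R]_n) := (y *m e^T) 0 0.
(* a quadratic in t that is bounded below by 0 and vanishes at t = 0 has no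
   linear term *)
have lin0 y : q y e = l * p y.
  pose b := q y e - l * p y; pose a := l * s y - q y y.
  have ab t : 2 * t * b <= t ^+ 2 * a.
    have := ql (e + t *: y).
    have -> : q (e + t *: y) (e + t *: y) = l + 2 * t * q y e + t ^+ 2 * q y y.
      rewrite !qDr ![q (e + _) _]qC !qDr !qZr ![q (t *: y) _]qC !qZr (qC e y) -/l.
      by ring.
    have -> : s (e + t *: y) = 1 + 2 * t * p y + t ^+ 2 * s y.
      have sDE u v : s (u + v) = s u + 2 * (v *m u^T) 0 0 + s v.
        rewrite !sE !mxE mulr_sumr -!big_split/=; apply: eq_bigr => j _.
        by rewrite !mxE; ring.
      by rewrite sDE es sZ -scalemxAl mxE -/(p y); ring.
    by rewrite /a /b; nra.
  apply/eqP; rewrite -subr_eq0 -/b; apply/negPn/negP => b0.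
  have a0 : 0 <= a by rewrite subr_ge0.
  have := ab (b / (a + 1)).
  have -> : 2 * (b / (a + 1)) * b = 2 * b ^+ 2 / (a + 1).
    by field; rewrite gt_eqF// ltr_wpDl.
  have -> : (b / (a + 1)) ^+ 2 * a = b ^+ 2 / (a + 1) * (a / (a + 1)).
    by field; rewrite gt_eqF// ltr_wpDl.
  have b2 : 0 < b ^+ 2 / (a + 1).
    by rewrite divr_gt0 ?ltr_wpDl// exprn_even_gt0.
  have a1 : a / (a + 1) <= 1 by rewrite ler_pdivrMr ?ltr_wpDl//; lra.
  by move: b2 a1; move: (b ^+ 2) (a / (a + 1)) (a + 1)^-1 => B A I; nra.
have el : eigenvalue S l.
  apply/eigenvalueP; exists e; last first.
    apply/eqP => e0; move: es; rewrite e0 /s mul0mx mxE => /eqP.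
    by rewrite eq_sym oner_eq0.
  apply/rowP => j; have := lin0 (delta_mx 0 j).
  rewrite qC /q /p trmx_delta -colE !mxE => ->.
  by congr (_ * _); rewrite (bigD1 j)//= !mxE !eqxx mul1r big1 ?addr0// => i ij;
    rewrite !mxE (negbTE ij) andbF mul0r.
apply: le_trans (ql x) _; rewrite ler_pM2r//; exact: HC.
Qed.

End Rayleigh.

Section eigenvalue_bounds.
Context {R : realType} (n : nat) (S : 'M[R]_n).
Context (symS : S^T = S).

Lemma eigenvalue_le (C : R) (v : 'cV[R]_n) :
  (forall y, eigenvalue S y -> y <= C) ->
  (v^T *m S *m v) 0 0 <= C * (v^T *m v) 0 0.
Proof. by move=> /(Rayleigh_le symS)/(_ v^T); rewrite trmxK. Qed.

Lemma eigenvalue_ge (c : R) (v : 'cV[R]_n) :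
  (forall y, eigenvalue S y -> c <= y) ->
  c * (v^T *m v) 0 0 <= (v^T *m S *m v) 0 0.
Proof.
move=> Hc; have symN : (- S)^T = - S by rewrite linearN/= symS.
have := Rayleigh_le symN (C := - c) _ v^T.
rewrite trmxK mulmxN mulNmx mxE mulNr lerN2; apply => y /eigenvalueP[u uS u0].
rewrite lerNr; apply: Hc; apply/eigenvalueP; exists u => //.
by rewrite -[LHS]opprK -mulmxN uS scaleNr.
Qed.

End eigenvalue_bounds.

(** * Borel functions of random vectors *)

Section Borel.
Context {R : realType} {d : measure_display} {T : measurableType d}.
Variable P : probability T R.

Lemma measurable_borel_comp (T' : topologicalType) (X : T -> T') (g : T' -> R) :
  borel_rv X -> borel_fun g -> measurable_fun setT (g \o X).
Proof.
by move=> mX mg _ B mB; rewrite setTI; exact: (mX _ (mg _ mB)).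
Qed.

Lemma borel_rv_comp (T' T'' : topologicalType) (X : T -> T') (h : T' -> T'') :
  borel_rv X -> continuous h -> borel_rv (h \o X).
Proof.
move=> mX ch; have sub : borel_set (T := T'') `<=` [set B | borel_set (h @^-1` B)].
  apply: smallest_sub; last first.
    move=> U /= oU; apply: sub_sigma_algebra => /=.
    by move/continuousP: ch; exact.
  have [s0 sC sU] := @smallest_sigma_algebra T' setT [set U : set T' | open U].
  split => /=; first by rewrite preimage_set0; exact: s0.
  - by move=> B hB; rewrite setTD -preimage_setC -setTD; exact: sC.
  - by move=> F hF; rewrite preimage_bigcup; exact: sU.
by move=> B /sub hB; exact: (mX _ hB).
Qed.

Lemma borel_fun_sub (n : nat) (g1 g2 : 'rV[R]_n -> R) :
  borel_fun g1 -> borel_fun g2 -> borel_fun (fun x => g1 x - g2 x).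
Proof.
pose S := g_sigma_algebraType [set U : set 'rV[R]_n | open U].
have toS (g : 'rV[R]_n -> R) : borel_fun g -> measurable_fun setT (g : S -> R).
  by move=> hg _ B mB; rewrite setTI; exact: hg.
move=> /toS m1 /toS m2 B mB.
by have := measurable_funB m1 m2 measurableT mB; rewrite setTI.
Qed.

(** On the set where [g1] exceeds [g2] both have the integral of [U], so the
    set is null. *)
Lemma condexp_unique n (X : T -> 'rV[R]_n) (U : T -> R) (g1 g2 : 'rV[R]_n -> R) :
  borel_rv X -> is_condexp P X U g1 -> is_condexp P X U g2 ->
  {ae P, forall w, g1 (X w) <= g2 (X w)}.
Proof.
move=> mX [_ b1 i1 e1] [_ b2 i2 e2].
pose D (x : 'rV[R]_n) := g1 x - g2 x.
have bD : borel_fun D by exact: borel_fun_sub.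
pose B := D @^-1` `]0, +oo[%classic.
have bB : borel_set B by apply: bD; exact: measurable_itv.
pose A := X @^-1` B; have mA : measurable A by exact: mX.
have mD : measurable_fun setT (D \o X) by exact: measurable_borel_comp.
have iA g : P.-integrable setT (EFin \o g \o X) -> P.-integrable A (EFin \o g \o X).
  by move=> ig; exact: (integrableS measurableT).
have DA : (\int[P]_(w in A) (D (X w))%:E = 0)%E.
  rewrite (_ : (fun w => _) = (fun w => (g1 (X w))%:E - (g2 (X w))%:E)%E)//.
  rewrite (integralB mA (iA _ i1) (iA _ i2)) /= e1// e2// subee//.
  rewrite -e1//; apply: integrable_fin_num => //; exact: (iA _ i1).
have mf : measurable_fun A (EFin \o (D \o X)).
  by apply/measurable_EFinP; exact: measurable_funS mD.
have [N [mN N0 sN]] : ae_eq P A (EFin \o (D \o X)) (cst 0%E).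
  apply/(@ae_eq_integral_abs _ _ _ P A mA _ mf); rewrite -[RHS]DA; apply: eq_integral => w.
  rewrite inE /A /B /= in_itv/= andbT => D0.
  by rewrite ger0_norm// ltW.
exists N; split => // w /= /negP; rewrite -ltNge => g21; apply: sN => /= h.
have Aw : A w by rewrite /A /B /= in_itv/= andbT subr_gt0.
by have /= [] := h Aw => /eqP; rewrite subr_eq0 gt_eqF.
Qed.

(** A second countable space is covered, outside of the support, by countably
    many null open sets: here the balls with rational centres and radii
    1 / (k + 1). *)
Lemma ae_support n (X : T -> 'rV[R]_n) : borel_rv X ->
  {ae P, forall w, Defs.support P X (X w)}.
Proof.
move=> mX.
pose cb (p : 'rV[rat]_n * nat) := ball (map_mx ratr p.1 : 'rV[R]_n) (p.2.+1%:R^-1 : R).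
pose F i := if @unpickle ('rV[rat]_n * nat)%type i is Some p then
  if P (X @^-1` cb p) == 0%E then X @^-1` cb p else set0 else set0.
have mcb p : measurable (X @^-1` cb p).
  by apply: mX; apply: sub_sigma_algebra; exact: ball_open.
have NF : P.-negligible (\bigcup_i F i).
  apply: negligible_bigcup => i; rewrite /F; case: unpickle => [p|]; last first.
    exact: negligible_set0.
  by case: eqP => [P0|_]; [exists (X @^-1` cb p); split|exact: negligible_set0].
apply: negligibleS NF => w /=.
move=> /existsNP[U /not_implyP[oU /not_implyP[Uw PU]]].
have PU0 : P (X @^-1` U) = 0%E.
  by apply/eqP; rewrite eq_le measure_ge0 andbT leNgt; apply/negP.
have [e e0 eU] : exists2 e : R, 0 < e & ball (X w) e `<=` U.
  have /nbhs_ballP[e e0 eU] : nbhs (X w) U by exact: open_nbhs_nbhs.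
  by exists e.
pose k := Num.truncn (2 / e).
have ke : 2 / k.+1%:R < e.
  by rewrite ltr_pdivrMr// mulrC -ltr_pdivrMr// truncnS_gt.
have rk : (0 : R) < k.+1%:R^-1 by rewrite invr_gt0.
have /choice[q hq] : forall j, exists q : rat, ball (X w 0 j) k.+1%:R^-1 (ratr q : R).
  move=> j; move: (k.+1%:R^-1) rk => r rk.
  have rr : X w 0 j - r < X w 0 j + r by rewrite ltrBlDr -addrA ltrDl addr_gt0.
  have [q] := rat_in_itvoo rr.
  rewrite in_itv/= => /andP[q1 q2]; exists q.
  by rewrite /ball/= ltr_norml; apply/andP; split; lra.
pose p : 'rV[rat]_n * nat := (\row_j q j, k).
have bp : ball (X w) k.+1%:R^-1 (map_mx ratr p.1).
  by split => // i j; rewrite (ord1 i) !mxE; exact: hq.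
exists (pickle p) => //; rewrite /F pickleK.
have -> : P (X @^-1` cb p) == 0%E.
  rewrite eq_le measure_ge0 andbT -PU0; apply: le_measure; rewrite ?inE//.
    by apply: mX; exact: sub_sigma_algebra.
  apply: preimage_subset => y py; apply: eU.
  apply: (le_ball (ltW ke)); rewrite mulr2n mulrDl mul1r.
  exact: ball_triangle bp py.
exact: ball_sym.
Qed.

End Borel.

Section measurable_matrices.
Context {R : realType} {d : measure_display} {T : measurableType d}.

Definition measurable_mx m n (A : T -> 'M[R]_(m, n)) : Prop :=
  forall i j, measurable_fun setT (fun w => A w i j).

Lemma measurable_mulmx m n p (A : T -> 'M[R]_(m, n)) (B : T -> 'M[R]_(n, p)) :
  measurable_mx A -> measurable_mx B -> measurable_mx (fun w => A w *m B w).
Proof.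
move=> mA mB i j; under eq_fun do rewrite mxE.
by apply: measurable_sum => k; exact: measurable_funM.
Qed.

Lemma measurable_trmx m n (A : T -> 'M[R]_(m, n)) :
  measurable_mx A -> measurable_mx (fun w => (A w)^T).
Proof. by move=> mA i j; under eq_fun do rewrite mxE; exact: mA. Qed.

Lemma measurable_det n (A : T -> 'M[R]_n) :
  measurable_mx A -> measurable_fun setT (fun w => \det (A w)).
Proof.
move=> mA; rewrite /determinant; apply: measurable_sum => s.
by apply: measurable_funM => //; apply: measurable_prod => i _; exact: mA.
Qed.

Lemma measurable_invr (f : T -> R) : measurable_fun setT f ->
  measurable_fun setT (fun w => (f w)^-1).
Proof.
move=> mf; have mi : measurable_fun setT (@GRing.inv R).
  have -> : setT = [set (0 : R)] `|` ~` [set 0] by rewrite setUv.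
  apply/measurable_funU => //; first exact: measurableC.
  split; first exact: measurable_fun_set1.
  apply: open_continuous_measurable_fun; first by rewrite openC; exact: closed_eq.
  by move=> x; rewrite inE /= => /eqP; exact: inv_continuous.
exact: (measurableT_comp mi mf).
Qed.

Lemma measurable_invmx n (A : T -> 'M[R]_n) : (forall w, A w \in unitmx) ->
  measurable_mx A -> measurable_mx (fun w => invmx (A w)).
Proof.
move=> uA mA i j; rewrite /invmx; under eq_fun do rewrite uA !mxE.
apply: measurable_funM; first by apply: measurable_invr; exact: measurable_det.
apply: measurable_funM => //; apply: measurable_det => a b.
by under eq_fun do rewrite !mxE; exact: mA.
Qed.

Lemma measurable_qform n (S : T -> 'M[R]_n) (u v : T -> 'cV[R]_n) :
  (forall w, posdef (S w)) -> measurable_mx S -> measurable_mx u ->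
  measurable_mx v -> measurable_fun setT (fun w => qform (S w) (u w) (v w)).
Proof.
move=> pS mS mu mv; have mI : measurable_mx (fun w => invmx (S w)).
  by apply: measurable_invmx => // w; exact: posdef_unitmx.
exact: (measurable_mulmx (measurable_mulmx (measurable_trmx mu) mI) mv).
Qed.

End measurable_matrices.

(** * Linear spans and semi-inner products *)

Section spans.
Context {R : realType} {V : lmodType R}.
Implicit Types (S W : set V).

Lemma linspan_incl S : S `<=` linspan S.
Proof.
move=> v Sv; exists 1%N, (fun=> 1), (fun=> v); split => //.
by rewrite big_ord1 scale1r.
Qed.

Lemma linspan0 S : linspan S 0.
Proof.
exists 0%N, (fun=> 0), (fun=> 0); split; last by rewrite big_ord0.
by move=> [].
Qed.

Lemma linspan_lin S (c : R) (u v : V) :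
  linspan S u -> linspan S v -> linspan S (c *: u + v).
Proof.
move=> [n [a [s [Ss ->]]]] [m [b [t [St ->]]]].
exists (n + m)%N, (fun i => match fintype.split i with inl j => c * a j | inr j => b j end),
  (fun i => match fintype.split i with inl j => s j | inr j => t j end); split.
  by move=> i; case: fintype.split.
rewrite big_split_ord/= scaler_sumr; congr (_ + _); apply: eq_bigr => i _.
  by rewrite (@unsplitK n m (inl i : 'I_n + 'I_m)) scalerA.
by rewrite (@unsplitK n m (inr i : 'I_n + 'I_m)).
Qed.

Lemma linspan_min S W : S `<=` W -> W 0 ->
  (forall (c : R) u v, W u -> W v -> W (c *: u + v)) -> linspan S `<=` W.
Proof.
move=> SW W0 Wl v [n [c [s [Ss ->]]]].
by apply: big_rec => // i x _ Wx; apply: Wl => //; exact: SW.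
Qed.

Lemma linspanZ S (c : R) u : linspan S u -> linspan S (c *: u).
Proof. by move=> ?; rewrite -[c *: u]addr0; apply: linspan_lin => //; exact: linspan0. Qed.

Lemma linspanB S u v : linspan S u -> linspan S v -> linspan S (u - v).
Proof. by move=> ? ?; rewrite addrC -scaleN1r; exact: linspan_lin. Qed.

End spans.

(** The quadratic is tested at its minimizer or, when it is affine, far away
    in the direction where it decreases. *)
Lemma discriminant_le (R : realFieldType) (a b c : R) : 0 <= a -> 0 <= c ->
  (forall s, 0 <= a + 2 * s * b + s ^+ 2 * c) -> b ^+ 2 <= a * c.
Proof.
move=> a_ge0 c_ge0 h; have [c0|c0] := eqVneq c 0.
  rewrite c0 mulr0; have [->|b0] := eqVneq b 0; first by rewrite expr0n.
  have := h (- (a + 1) / (2 * b)); rewrite c0 mulr0 addr0.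
  have -> : 2 * (- (a + 1) / (2 * b)) * b = - (a + 1) by field.
  by lra.
have {}c0 : 0 < c by rewrite lt_def c0.
have := h (- b / c).
have -> : a + 2 * (- b / c) * b + (- b / c) ^+ 2 * c = (a * c - b ^+ 2) / c.
  by field; rewrite gt_eqF.
by rewrite pmulr_lge0 ?invr_gt0// subr_ge0.
Qed.

Section semi_inner_product.
Context {R : realType} {V : lmodType R} (D : set V) (B : V -> V -> R).
Context (Dlin : forall (c : R) u v, D u -> D v -> D (c *: u + v)) (D0 : D 0).
Context (BC : forall u v, B u v = B v u).
Context (Blin : forall (c : R) u v w, D u -> D v -> D w ->
  B (c *: u + v) w = c * B u w + B v w).
Context (B_ge0 : forall v, D v -> 0 <= B v v).

Let nrm v := Num.sqrt (B v v).

Let nrm_sqr v : D v -> nrm v ^+ 2 = B v v.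
Proof. by move=> Dv; rewrite sqr_sqrtr// B_ge0. Qed.

Let nrm_ge0 v : 0 <= nrm v.
Proof. exact: sqrtr_ge0. Qed.

Lemma semi_ipZ (c : R) u v : D u -> D v -> B (c *: u) v = c * B u v.
Proof.
move=> Du Dv; have B0 : B 0 v = 0.
  by have := Blin 1 D0 D0 Dv; rewrite scale1r addr0 mul1r; lra.
by have := Blin c Du D0 Dv; rewrite !addr0 B0 addr0.
Qed.

Let line u v (s : R) : D u -> D v ->
  B (s *: v + u) (s *: v + u) = B u u + 2 * s * B u v + s ^+ 2 * B v v.
Proof.
move=> Du Dv; have Dw : D (s *: v + u) by exact: Dlin.
rewrite (Blin s Dv Du Dw) (BC v) (BC u (_ + _)).
rewrite (Blin s Dv Du Dv) (Blin s Dv Du Du) (BC v u).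
by ring.
Qed.

Lemma semi_Cauchy_Schwarz u v : D u -> D v -> `|B u v| <= nrm u * nrm v.
Proof.
move=> Du Dv; rewrite -(@ler_pXn2r _ 2)// ?nnegrE ?mulr_ge0//.
rewrite exprMn !nrm_sqr// real_normK ?num_real//.
apply: discriminant_le; [exact: B_ge0..|] => s.
by rewrite -line//; exact/B_ge0/Dlin.
Qed.

Lemma semi_normZ (c : R) v : D v -> nrm (c *: v) = `|c| * nrm v.
Proof.
move=> Dv; have Dcv : D (c *: v) by rewrite -[_ *: _]addr0; exact: Dlin.
rewrite /nrm semi_ipZ// BC semi_ipZ// mulrA -expr2.
by rewrite sqrtrM ?sqr_ge0// sqrtr_sqr.
Qed.

Lemma semi_normD u v : D u -> D v -> nrm (u + v) <= nrm u + nrm v.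
Proof.
move=> Du Dv; have Duv : D (u + v) by rewrite -[u]scale1r; exact: Dlin.
rewrite -(@ler_pXn2r _ 2)// ?nnegrE ?addr_ge0//.
rewrite sqrrD !nrm_sqr//; have := line 1 Dv Du; rewrite scale1r => ->.
have := le_trans (ler_norm _) (semi_Cauchy_Schwarz Dv Du).
by rewrite -mulr_natl; lra.
Qed.

(** Variational characterization of the projection: the quadratic [s |-> nrm
    (s *: v + p) ^+ 2] is minimal at 0. *)
Lemma semi_norm_min_orth v p : D v -> D p ->
  (forall s : R, nrm p <= nrm (s *: v + p)) -> B v p = 0.
Proof.
move=> Dv Dp Hmin.
have h (s : R) : 0 <= 0 + 2 * s * B p v + s ^+ 2 * B v v.
  have := Hmin s; rewrite -(@ler_pXn2r _ 2)// ?nnegrE//.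
  by rewrite !nrm_sqr ?line//; [lra|exact: Dlin].
have := discriminant_le (lexx 0) (B_ge0 Dv) h; rewrite BC mul0r => b2.
by apply/eqP; rewrite -sqrf_eq0 eq_le b2 sqr_ge0.
Qed.

End semi_inner_product.

Section ae_comparison.
Context {R : realType} {d : measure_display} {T : measurableType d}.
Variable P : probability T R.

(** Integrability of [g] comes from that of [f] after [g] is replaced by its
    truncation between 0 and [K * f], which changes it on a null set only. *)
Lemma ae_comparable_Rintegral (f g : T -> R) (K : R) : 0 < K ->
  measurable_fun setT g -> P.-integrable setT (EFin \o f) ->
  (forall w, 0 <= f w) ->
  {ae P, forall w, [/\ 0 <= g w, g w <= K * f w & f w <= K * g w]} ->
  [/\ 0 <= \int[P]_w g w, \int[P]_w g w <= K * \int[P]_w f w &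
      \int[P]_w f w <= K * \int[P]_w g w].
Proof.
move=> K0 mg intf f0 fg.
have mf : measurable_fun setT f by apply/measurable_EFinP; exact: measurable_int intf.
pose h w := Num.max 0 (Num.min (g w) (K * f w)).
have mh : measurable_fun setT h.
  by apply: measurable_maxr => //; apply: measurable_minr => //; exact: measurable_funM.
have h0 w : 0 <= h w by rewrite le_max lexx.
have hK w : h w <= K * f w by rewrite ge_max mulr_ge0 ?(ltW K0)// ge_min lexx orbT.
have gh : (\int[P]_w (g w)%:E = \int[P]_w (h w)%:E)%E.
  apply: ae_eq_integral => //; [exact/measurable_EFinP..|].
  apply: filterS fg => w [g0 gK _] _ /=; congr EFin.
  by rewrite /h (min_idPl gK) (max_idPr g0).
have inth : P.-integrable setT (EFin \o h).
  apply: (le_integrable measurableT _ _ (integrableZl measurableT K intf)).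
    exact/measurable_EFinP.
  by move=> w _ /=; rewrite lee_fin ger0_norm// ger0_norm// mulr_ge0// ltW.
have -> : \int[P]_w g w = \int[P]_w h w by rewrite /Rintegral gh.
split.
- by apply: Rintegral_ge0.
- rewrite -RintegralZl//; apply: le_Rintegral => //.
  exact: (integrableZl measurableT K intf).
rewrite -lee_fin EFinM /Rintegral !fineK; try exact: integrable_fin_num.
rewrite -ge0_integralZl//=; last 3 first.
- exact/measurable_EFinP.
- by move=> w _; rewrite lee_fin.
- by rewrite lee_fin ltW.
apply: ae_ge0_le_integral => //.
- by move=> w _; rewrite lee_fin.
- exact/measurable_EFinP.
- by move=> w _; rewrite mule_ge0// lee_fin// ltW.
- by apply: measurable_funeM; exact/measurable_EFinP.
apply: filterS fg => w [g0 gK fK] _.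
by rewrite -EFinM lee_fin /h (min_idPl gK) (max_idPr g0).
Qed.

End ae_comparison.

(** * The weak inner product and the Riesz representer *)

Section geometry.
Context {R : realType} {d : measure_display} {T : measurableType d}.
Context {P : probability T R} {dY dX dt dr : nat}.
Context {H : completeNormedModType R}.
Context (Mo : model P dY dX dt dr H) (L : local_objects dY dX dt H).
Context (Hdata : data_ok Mo) (Hmom : moment_ok Mo) (Hwt : weighting_ok Mo).
Context (HID : cond_ID Mo) (Hnb : neighborhood_ok Mo L).
Context (Hpd : pathwise_diff Mo L) (Hriesz : riesz_ok Mo L).

Local Notation par := ('rV[R]_dt * H)%type.
Local Notation dir := (directions Mo L).
Local Notation X := (Xgen Mo).
Local Notation ip := (ip Mo).
Local Notation wnorm := (wnorm Mo).
Local Notation a0 := (alpha0 Mo).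

Let q (u v : par) (w : T) : R := qform (Sigma Mo (X w)) (dm Mo (X w) u) (dm Mo (X w) v).

Lemma Xgen_borel : borel_rv X.
Proof.
have [mZ _ _ _] := Hdata.
by apply: (borel_rv_comp (h := snd)) mZ _ => x; exact: cvg_snd.
Qed.

Lemma Sigma_posdef x : posdef (Sigma Mo x).
Proof. by have [pS _ _] := Hwt. Qed.

Lemma measurable_Sigma : measurable_mx (fun w => Sigma Mo (X w)).
Proof.
move=> i j; have [_ bS _] := Hwt.
exact: (measurable_borel_comp Xgen_borel (bS i j)).
Qed.

Lemma measurable_dm v : dir v -> measurable_mx (fun w => dm Mo (X w) v).
Proof.
move=> dv i j; rewrite (ord1 j); have [_ _ _ bd _] := Hpd.
exact: (measurable_borel_comp Xgen_borel (bd v i dv)).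
Qed.

Let mq u v : dir u -> dir v -> measurable_fun setT (q u v).
Proof.
move=> du dv; apply: measurable_qform.
- by move=> w; exact: Sigma_posdef.
- exact: measurable_Sigma.
- exact: measurable_dm.
- exact: measurable_dm.
Qed.

Let qC u v w : q u v w = q v u w.
Proof. by apply: qformC; exact: Sigma_posdef. Qed.

Let q_ge0 v w : 0 <= q v v w.
Proof. by apply: qform_ge0; exact: Sigma_posdef. Qed.

Lemma ae_dm_lin : {ae P, forall w, forall (c : R) v1 v2, dir v1 -> dir v2 ->
  dm Mo (X w) (c *: v1 + v2) = c *: dm Mo (X w) v1 + dm Mo (X w) v2}.
Proof.
have [_ lin _ _ _] := Hpd; have [_ A0 _ _] := Hnb; have [_ _ I0 _] := Hmom.
by apply: filterS lin => w lin c v1 v2 d1 d2; exact: lin.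
Qed.

Let ae_q_lin : {ae P, forall w, forall (c : R) v1 v2 u, dir v1 -> dir v2 ->
  q (c *: v1 + v2) u w = c * q v1 u w + q v2 u w}.
Proof.
by apply: filterS ae_dm_lin => w lin c v1 v2 u d1 d2; rewrite /q lin// qform_lin.
Qed.

Let iq_diag v : dir v -> P.-integrable setT (EFin \o q v v).
Proof. by have [_ _ _ _] := Hpd; apply. Qed.

Let iq u v : dir u -> dir v -> P.-integrable setT (EFin \o q u v).
Proof.
move=> du dv.
have iqq : P.-integrable setT (EFin \o (fun w => q u u w + q v v w)).
  rewrite (_ : _ \o _ = (EFin \o q u u) \+ (EFin \o q v v))%E//.
  exact: integrableD (iq_diag du) (iq_diag dv).
apply: (le_integrable measurableT _ _ iqq); first exact/measurable_EFinP/mq.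
move=> w _ /=; rewrite lee_fin [leRHS]ger0_norm ?addr_ge0//.
by apply: qform_abs_le; exact: Sigma_posdef.
Qed.

Lemma ipC u v : ip u v = ip v u.
Proof. by rewrite /ip; apply: eq_Rintegral => w _; exact: qC. Qed.

(** The pathwise derivative is linear almost surely, which is all that the
    integral sees. *)
Lemma ip_lin (c : R) v1 v2 u : dir v1 -> dir v2 -> dir u ->
  ip (c *: v1 + v2) u = c * ip v1 u + ip v2 u.
Proof.
move=> d1 d2 du; have d12 : dir (c *: v1 + v2) by exact: linspan_lin.
have icq : P.-integrable setT (EFin \o (fun w => c * q v1 u w)).
  exact: (integrableZl measurableT c (iq d1 du)).
rewrite -RintegralZl//; last exact: iq.
rewrite -RintegralD//; last exact: iq.
rewrite /ip /Rintegral; congr fine; apply: ae_eq_integral => //.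
- exact/measurable_EFinP/mq.
- apply/measurable_EFinP; apply: measurable_funD; last exact: mq.
  by apply: measurable_funM => //; exact: mq.
by apply: filterS ae_q_lin => w lin _ /=; congr EFin; exact: lin.
Qed.

Lemma ip_ge0 v : 0 <= ip v v.
Proof. by apply: Rintegral_ge0 => w _; exact: q_ge0. Qed.

Lemma wnorm_ge0 v : 0 <= wnorm v.
Proof. exact: sqrtr_ge0. Qed.

Lemma wnorm_sqr v : wnorm v ^+ 2 = ip v v.
Proof. by rewrite sqr_sqrtr// ip_ge0. Qed.

Lemma dirZ (c : R) u : dir u -> dir (c *: u).
Proof. exact: linspanZ. Qed.

Let dirL (c : R) u v : dir u -> dir v -> dir (c *: u + v).
Proof. exact: linspan_lin. Qed.

Let dir0 : dir 0.
Proof. exact: linspan0. Qed.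

Let ipP v : dir v -> 0 <= ip v v.
Proof. by move=> _; exact: ip_ge0. Qed.

Lemma ipZ (c : R) u v : dir u -> dir v -> ip (c *: u) v = c * ip u v.
Proof. exact: (semi_ipZ dir0 ip_lin). Qed.

Lemma ipD u v w : dir u -> dir v -> dir w -> ip (u + v) w = ip u w + ip v w.
Proof.
by move=> du dv dw; have := ip_lin 1 du dv dw; rewrite scale1r mul1r.
Qed.

Lemma wnormZ (c : R) v : dir v -> wnorm (c *: v) = `|c| * wnorm v.
Proof. exact: (semi_normZ dirL dir0 ipC ip_lin). Qed.

Lemma Cauchy_Schwarz u v : dir u -> dir v -> `|ip u v| <= wnorm u * wnorm v.
Proof. exact: (semi_Cauchy_Schwarz dirL ipC ip_lin ipP). Qed.

Lemma wnormD u v : dir u -> dir v -> wnorm (u + v) <= wnorm u + wnorm v.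
Proof. exact: (semi_normD dirL ipC ip_lin ipP). Qed.

Lemma dir_Aos a : Aos L a -> dir (a - a0).
Proof. by move=> Aa; apply: linspan_incl; left; exists a. Qed.

Lemma dir_hull K a : sieve_hull Mo K a -> dir (a - a0).
Proof. by move=> Ha; apply: linspan_incl; right; exists K => //; exists a. Qed.

Lemma sieve_sub_hull K a : sieve Mo K a -> sieve_hull Mo K a.
Proof. by case. Qed.

Lemma dir_sieve K a : sieve Mo K a -> dir (a - a0).
Proof. by move=> /sieve_sub_hull; exact: dir_hull. Qed.

Lemma sieve_hull_lin K (c : R) a b : sieve_hull Mo K a -> sieve_hull Mo K b ->
  sieve_hull Mo K (c *: a + b).
Proof.
move=> [x xE] [y yE]; exists (fun i => c * x i + y i) => /=.
rewrite xE yE scaler_sumr -big_split/=; apply: eq_bigr => i _.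
by rewrite scalerA -scalerDl.
Qed.

Lemma aproj_hull K : sieve_hull Mo K (aproj L K).
Proof. by have [/(_ K)[]] := Hriesz. Qed.

Lemma Vsieve_hull K : Vsieve Mo L K `<=` sieve_hull Mo K.
Proof.
apply: linspan_min.
- move=> _ [a [_ Sa] <-]; rewrite addrC -scaleN1r; apply: sieve_hull_lin.
    exact: aproj_hull.
  exact: sieve_sub_hull.
- by exists (fun=> 0) => /=; rewrite big1// => i _; rewrite scale0r.
- by move=> c u v; exact: sieve_hull_lin.
Qed.

Lemma dir_Vsieve K v : Vsieve Mo L K v -> dir v.
Proof.
move=> Vv; have := dir_hull (aproj_hull K).
have : dir (v + aproj L K - a0).
  apply: (@dir_hull K); rewrite -[v]scale1r; apply: sieve_hull_lin.
    exact: Vsieve_hull.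
  exact: aproj_hull.
move=> h1 h2; have := linspanB h1 h2.
by rewrite opprB addrA subrK addrK.
Qed.

(** First-order condition of the projection. *)
Lemma aproj_orth K v : Vsieve Mo L K v -> ip v (aproj L K - a0) = 0.
Proof.
move=> Vv; have dv := dir_Vsieve Vv; have da := dir_hull (aproj_hull K).
apply: (semi_norm_min_orth dirL ipC ip_lin ipP dv da) => s.
have [/(_ K)[_ /(_ (s *: v + aproj L K))] pmin _ _] := Hriesz.
rewrite addrA; apply: pmin; apply: sieve_hull_lin; last exact: aproj_hull.
exact: Vsieve_hull.
Qed.

(** The representer only represents the functional on the sieve directions, so
    the projection of alpha0 on the sieve stands between: what it leaves is
    orthogonal to the representer. *)
Lemma dphi_Riesz (Hphi : functional_ok Mo) n a : Aos_sieve Mo L (kdim Mo n) a ->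
  dphi Mo (a - a0) =
  ip (vstar L n) (a - a0) + dphi Mo (aproj L (kdim Mo n) - a0).
Proof.
move=> Aa; have [_ _ dlin _] := Hphi; have [_ _ /(_ n)[Vv Rv]] := Hriesz.
have dv := dir_Vsieve Vv.
have Va : Vsieve Mo L (kdim Mo n) (a - aproj L (kdim Mo n)).
  by apply: linspan_incl; exists a.
have da := dir_Vsieve Va; have dp := dir_hull (aproj_hull (kdim Mo n)).
have split : (a - aproj L (kdim Mo n)) + (aproj L (kdim Mo n) - a0) = a - a0.
  by rewrite addrA subrK.
have phiE := dlin 1 (a - aproj L (kdim Mo n)) (aproj L (kdim Mo n) - a0).
rewrite mul1r scale1r split (Rv _ Va) in phiE.
have ipE := ipD da dp dv.
rewrite split ipC (ipC (a - _)) (ipC (aproj _ _ - _)) (aproj_orth Vv) addr0 in ipE.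
by rewrite phiE ipE.
Qed.

(** Entries (i, j) and (j, i) are versions of the same conditional
    expectation. Symmetry is what makes eigenvalue bounds control the
    quadratic form. *)
Lemma ae_Sigma0_sym : {ae P, forall w, (Sigma0 Mo (X w))^T = Sigma0 Mo (X w)}.
Proof.
have [_ _ cS] := Hwt.
have key i j : {ae P, forall w, Sigma0 Mo (X w) i j <= Sigma0 Mo (X w) j i}.
  have cji : is_condexp P X (fun w =>
      let e := rho Mo (Z Mo w) a0 - m Mo (X w) a0 in e i 0 * e j 0)
      (fun x => Sigma0 Mo x j i).
    have := cS j i; congr (is_condexp _ _ _ _); apply/funext => w.
    by rewrite /= mulrC.
  exact: (condexp_unique Xgen_borel (cS i j) cji).
have all_ae : {ae P, forall w, forall p : 'I_dr * 'I_dr,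
    Sigma0 Mo (X w) p.1 p.2 <= Sigma0 Mo (X w) p.2 p.1}.
  by apply: filter_forall => p; exact: key.
apply: filterS all_ae => w Hw; apply/matrixP => i j; rewrite mxE.
by apply/eqP; rewrite eq_le (Hw (j, i)) (Hw (i, j)).
Qed.

(** The eigenvalue bounds make the variance norm of the score equivalent to
    the weak norm. *)
Lemma sdnorm_wnorm : exists K : R, 0 < K /\ forall v, dir v ->
  sdnorm Mo v ^+ 2 <= K * wnorm v ^+ 2 /\ wnorm v ^+ 2 <= K * sdnorm Mo v ^+ 2.
Proof.
have [_ _ _ [c [C [c0 eig]]]] := HID.
pose K := (`|C| + 1) / c.
have C0 : 0 <= `|C| by [].
have K0 : 0 < K by rewrite divr_gt0// ltr_wpDl.
exists K; split => // v dv.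
pose g w := ((dm Mo (X w) v)^T *m invmx (Sigma Mo (X w)) *m Sigma0 Mo (X w)
  *m invmx (Sigma Mo (X w)) *m dm Mo (X w) v) 0 0.
have mI : measurable_mx (fun w => invmx (Sigma Mo (X w))).
  apply: measurable_invmx; last exact: measurable_Sigma.
  by move=> w; apply: posdef_unitmx; exact: Sigma_posdef.
have mS0 : measurable_mx (fun w => Sigma0 Mo (X w)).
  move=> i j; have [_ _ cS] := Hwt; have [_ bS _ _] := cS i j.
  exact: (measurable_borel_comp Xgen_borel bS).
have mg : measurable_fun setT g.
  have mdv := measurable_dm dv.
  exact: (measurable_mulmx (measurable_mulmx (measurable_mulmx (measurable_mulmx
    (measurable_trmx mdv) mI) mS0) mI) mdv).
have [g0 gK Kg] : [/\ 0 <= \int[P]_w g w, \int[P]_w g w <= K * \int[P]_w q v v w &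
      \int[P]_w q v v w <= K * \int[P]_w g w].
  apply: ae_comparable_Rintegral => //; first exact: iq_diag.
  apply: filterS (filterI (ae_support P Xgen_borel) ae_Sigma0_sym) => w [sw sym0].
  have [symS _] := Sigma_posdef (X w).
  set y := invmx (Sigma Mo (X w)) *m dm Mo (X w) v.
  have gE : g w = (y^T *m Sigma0 Mo (X w) *m y) 0 0.
    by rewrite /g /y trmx_mul trmx_inv symS !mulmxA.
  have qE : q v v w = (y^T *m Sigma Mo (X w) *m y) 0 0.
    by rewrite /q qformE//; exact: Sigma_posdef.
  have yy : 0 <= (y^T *m y) 0 0.
    by rewrite mxE sumr_ge0// => i _; rewrite mxE -expr2 sqr_ge0.
  have eS z : eigenvalue (Sigma Mo (X w)) z -> c <= z <= C.
    by move=> ez; apply: (eig _ sw); left.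
  have eS0 z : eigenvalue (Sigma0 Mo (X w)) z -> c <= z <= C.
    by move=> ez; apply: (eig _ sw); right.
  have b1 := eigenvalue_le symS y (fun z ez => proj2 (andP (eS z ez))).
  have b2 := eigenvalue_ge symS y (fun z ez => proj1 (andP (eS z ez))).
  have b3 := eigenvalue_le sym0 y (fun z ez => proj2 (andP (eS0 z ez))).
  have b4 := eigenvalue_ge sym0 y (fun z ez => proj1 (andP (eS0 z ez))).
  rewrite gE qE; move: b1 b2 b3 b4 yy.
  move: (_ 0 0) => b; move: (_ 0 0) => s; move: (_ 0 0) => s0 b1 b2 b3 b4 yy.
  have CN : C * s <= (`|C| + 1) * s.
    by apply: ler_wpM2r => //; apply: le_trans (ler_norm _) _; rewrite lerDl.
  have KE z : K * z = (`|C| + 1) * z / c by rewrite /K mulrAC.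
  have cs : 0 <= c * s by rewrite mulr_ge0// ltW.
  have C1 : 0 <= `|C| + 1 by rewrite addr_ge0.
  rewrite !KE !ler_pdivlMr//; split; first exact: le_trans b4.
    apply: (@le_trans _ _ ((`|C| + 1) * s * c)).
      by rewrite ler_pM2r//; exact: le_trans b3 CN.
    by rewrite -mulrA (mulrC s); exact: ler_wpM2l.
  apply: (@le_trans _ _ ((`|C| + 1) * s * c)).
    by rewrite ler_pM2r//; exact: le_trans b1 CN.
  by rewrite -mulrA (mulrC s); exact: ler_wpM2l.
have sdE : sdnorm Mo v ^+ 2 = \int[P]_w g w by exact: (sqr_sqrtr g0).
by split; rewrite sdE wnorm_sqr; [exact: gK|exact: Kg].
Qed.

End geometry.

(** * The strong norm *)

Section strong_norm.
Context {R : realType} {dt : nat} {H : completeNormedModType R}.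
Local Notation par := ('rV[R]_dt * H)%type.

Lemma enorm_ge0 (x : 'rV[R]_dt) : 0 <= enorm x.
Proof. exact: sqrtr_ge0. Qed.

Lemma enorm_eq0 (x : 'rV[R]_dt) : enorm x = 0 -> x = 0.
Proof.
move=> /eqP; rewrite sqrtr_eq0 => s0; apply/rowP => j; rewrite mxE.
apply/eqP; rewrite -sqrf_eq0 eq_le sqr_ge0 andbT; apply: le_trans s0.
by rewrite (bigD1 j)//= lerDl sumr_ge0// => i _; exact: sqr_ge0.
Qed.

Lemma enormZ (c : R) (x : 'rV[R]_dt) : enorm (c *: x) = `|c| * enorm x.
Proof.
rewrite /enorm -sqrtr_sqr -sqrtrM ?sqr_ge0// mulr_sumr; congr Num.sqrt.
by apply: eq_bigr => j _; rewrite mxE exprMn.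
Qed.

Lemma enorm_le (x : 'rV[R]_dt) : enorm x <= dt%:R * `|x|.
Proof.
have x0 : 0 <= dt%:R * `|x| by rewrite mulr_ge0.
rewrite -[leRHS]ger0_norm// -sqrtr_sqr ler_wsqrtr// exprMn.
apply: (@le_trans _ _ (\sum_(j < dt) `|x| ^+ 2)).
  apply: ler_sum => j _; rewrite -real_normK ?num_real// ler_sqr ?nnegrE//.
  rewrite -[leRHS]/(mx_norm x) mx_normrE.
  by apply: (le_bigmax _ (fun i => `|x i.1 i.2|) (0, j)).
rewrite sumr_const card_ord -[leLHS]mulr_natl; apply: ler_wpM2r; first exact: sqr_ge0.
rewrite -natrX ler_nat; by case: (dt) => // n; rewrite leq_pmulr.
Qed.

Lemma norm_s_ge0 (a : par) : 0 <= norm_s a.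
Proof. by rewrite addr_ge0// enorm_ge0. Qed.

Lemma norm_s_eq0 (a : par) : norm_s a = 0 -> a = 0.
Proof.
move=> /eqP; rewrite paddr_eq0 ?enorm_ge0// => /andP[/eqP/enorm_eq0 h1].
by rewrite normr_eq0 => /eqP h2; apply/eqP; rewrite -pair_eqE /= h1 h2 !eqxx.
Qed.

Lemma norm_sZ (c : R) (a : par) : norm_s (c *: a) = `|c| * norm_s a.
Proof. by rewrite /norm_s enormZ normrZ mulrDr. Qed.

Lemma norm_s_nbhs (p : par) (r : R) : 0 < r -> nbhs p [set b | norm_s (b - p) < r].
Proof.
move=> r0; apply/nbhs_ballP; exists (r / dt.+1%:R); first by rewrite /= divr_gt0.
move=> b [b1 b2]; rewrite /= /norm_s.
have {}b1 : `|b.1 - p.1| < r / dt.+1%:R by move: b1; rewrite -ball_normE/= distrC.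
have {}b2 : `|b.2 - p.2| < r / dt.+1%:R by move: b2; rewrite -ball_normE/= distrC.
have -> : r = dt%:R * (r / dt.+1%:R) + r / dt.+1%:R.
  by rewrite -[dt.+1%:R]natr1; field; rewrite natr1.
apply: ler_ltD => //; apply: le_trans (enorm_le _) _.
by apply: ler_wpM2l => //; exact: ltW.
Qed.

End strong_norm.

(** * Identification and bounds on the estimators *)

Section identification.
Context {R : realType} {d : measure_display} {T : measurableType d}.
Context {P : probability T R} {dY dX dt dr : nat}.
Context {H : completeNormedModType R}.
Context (Mo : model P dY dX dt dr H).
Context (Hdata : data_ok Mo) (Hmom : moment_ok Mo) (Hwt : weighting_ok Mo).
Context (HID : cond_ID Mo) (HPEN : cond_PEN Mo).

Local Notation par := ('rV[R]_dt * H)%type.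
Local Notation X := (Xgen Mo).
Local Notation a0 := (alpha0 Mo).

Let qm (a : par) w : R := qform (Sigma Mo (X w)) (m Mo (X w) a) (m Mo (X w) a).

Let qm_ge0 a w : 0 <= qm a w.
Proof. by apply: qform_ge0; exact: Sigma_posdef. Qed.

Lemma crit_Q_ge0 a : (0 <= crit_Q Mo a)%E.
Proof. by apply: integral_ge0 => w _; rewrite lee_fin; exact: qm_ge0. Qed.

Lemma crit_Q_eq0 a : params Mo a -> crit_Q Mo a = 0%E -> a = a0.
Proof.
move=> pa Qa.
have mm : measurable_mx (fun w => m Mo (X w) a).
  move=> i j; rewrite (ord1 j); have [_ cm _ _] := Hmom.
  have [_ bm _ _] := cm a i pa.
  exact: (measurable_borel_comp (Xgen_borel Hdata) bm).
have mqm : measurable_fun setT (qm a).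
  apply: measurable_qform => //; last exact: measurable_Sigma.
  by move=> w; exact: Sigma_posdef.
have /(@ae_eq_integral_abs _ _ _ P setT measurableT) h : measurable_fun setT (EFin \o qm a).
  exact/measurable_EFinP.
have {}h : ae_eq P setT (EFin \o qm a) (cst 0%E).
  apply/h; rewrite -[RHS]Qa; apply: eq_integral => w _ /=.
  by rewrite ger0_norm//; exact: qm_ge0.
have [idn _ _ _] := HID.
suff : {ae P, forall w, m Mo (X w) a = 0}.
  by move/(idn a pa)/norm_s_eq0/eqP; rewrite subr_eq0 => /eqP.
apply: filterS h => w /(_ I) /= [qw].
by apply: qform_eq0 qw; exact: Sigma_posdef.
Qed.

(** A sequence of points away from alpha0 with vanishing criterion would
    accumulate, in the compact set of bounded penalty, at a zero of the lower
    semicontinuous criterion, that is at alpha0. *)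
Lemma crit_Q_separated (C r : R) : 0 < r -> exists2 e : R, 0 < e &
  forall a, params Mo a -> (Pen Mo a.2 <= C%:E)%E -> r <= norm_s (a - a0) ->
    (e%:E < crit_Q Mo a)%E.
Proof.
move=> r0; apply: contrapT => /forall2NP nsep.
have {}nsep (k : nat) : exists a, [/\ params Mo a, (Pen Mo a.2 <= C%:E)%E,
    r <= norm_s (a - a0) & (crit_Q Mo a <= (k.+1%:R^-1)%:E)%E].
  have [/negP|] := nsep (k.+1%:R^-1); first by rewrite invr_gt0 ltr0n.
  move=> /existsNP[a /not_implyP[pa /not_implyP[ca /not_implyP[ra /negP]]]].
  by rewrite -leNgt => qa; exists a.
move/choice : nsep => [s sP].
have [_ [cT _ _ _ _] lsc _] := HID; have [_ _ _ cP] := HPEN.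
have cK : compact (Theta Mo `*` [set h | (Pen Mo h <= C%:E)%E]).
  by apply: compact_setX => //; exact: cP.
have FK : (s @ \oo) (Theta Mo `*` [set h | (Pen Mo h <= C%:E)%E]).
  by exists 0%N => // k _; have [] := sP k.
have [p [[pT _] clp]] := cK (s @ \oo) _ FK.
have freq (r' : R) (N : nat) : 0 < r' ->
    exists2 k, (N <= k)%N & norm_s (s k - p) < r'.
  move=> r'0; pose A := [set s k | k in [set k | (N <= k)%N]].
  have FA : (s @ \oo) A by exists N => // k Nk; exists k.
  have [_ [[k Nk <-] h]] := clp _ _ FA (norm_s_nbhs p r'0).
  by exists k.
have [Q0|Q0] := eqVneq (crit_Q Mo p) 0%E.
  have pa := crit_Q_eq0 pT Q0.
  have [k _] := freq r 0 r0; rewrite pa ltNge.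
  by have [_ _ -> _] := sP k.
have {}Q0 : (0 < crit_Q Mo p)%E by rewrite lt_def Q0 crit_Q_ge0.
have [y /andP[y0 yQ]] : exists y : R, (0 < y) && (y%:E < crit_Q Mo p)%E.
  move: Q0; case: (crit_Q Mo p) => [z||]//.
  - by rewrite lte_fin => z0; exists (z / 2); rewrite lte_fin; apply/andP; split; lra.
  - by exists 1; rewrite ltry ltr01.
have [r' r'0 Hr'] := lsc p y%:E pT yQ.
have [k Nk] := freq r' (Num.truncn y^-1) r'0.
have [pk _ _ Qk] := sP k; move=> /(Hr' _ pk) /lt_le_trans /(_ Qk).
rewrite lte_fin ltNge => /negP; apply.
rewrite -[leRHS]invrK lef_pV2 ?posrE ?invr_gt0//.
by apply: le_trans (ltW (truncnS_gt _)) _; rewrite ler_nat.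
Qed.

Lemma lambda_gt0 n : 0 < lambda Mo n.
Proof. by have [/(_ n)] := HPEN. Qed.

Lemma Theta_alpha0 : Theta Mo a0.1.
Proof. by have [_ _ /interior_subset] := Hmom. Qed.

Lemma Pi_sieve n : sieve Mo (kdim Mo n) (Pi_alpha0 Mo n).
Proof.
by split; [exact: Theta_alpha0|have [_ [_ _ _ + _]] := HID; exact].
Qed.

End identification.

Section penalty_bounds.
Context {R : realType} {d : measure_display} {T : measurableType d}.
Context {P : probability T R} {dY dX dt dr : nat}.
Context {H : completeNormedModType R}.
Context (Mo : model P dY dX dt dr H).
Context (Hmodel : model_ok Mo) (HID : cond_ID Mo) (HPEN : cond_PEN Mo).

Local Notation ZT := ('rV[R]_dY * 'rV[R]_dX)%type.
Local Notation par := ('rV[R]_dt * H)%type.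
Local Notation Pi := (Pi_alpha0 Mo).
Local Notation ZN := (@Zn _ _ _ P _ _ _ _ _ Mo).
Local Notation WN := (@Wn _ _ _ P _ _ _ _ _ Mo).
Local Notation W := (cond_wpa1 P ZN WN).
Local Notation unit := (@unit_weights R _).

Let Hmom : moment_ok Mo. Proof. by case: Hmodel => -[]. Qed.
Let lambda_pos n : 0 < lambda Mo n. Proof. exact: lambda_gt0 HPEN n. Qed.
Let Pen_ge0 h : (0 <= Pen Mo h)%E. Proof. by case: Hmodel => _ [[]]. Qed.

Lemma Qhatb_ge0 n (z : 'I_n -> ZT) b a : 0 <= Qhatb Mo z b a.
Proof.
have [_ _ pS _] : first_step_ok Mo by case: Hmodel => -[].
rewrite mulr_ge0 ?invr_ge0// sumr_ge0// => i _.
exact: qform_ge0.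
Qed.

Lemma Pen_Pi_le : exists p : R, 0 <= p /\
  \forall n \near \oo, (Pen Mo (Pi_h0 Mo n) <= p%:E)%E.
Proof.
have [_ _ [[C HC] Pfin] _] := HPEN.
have Pf : Pen Mo (alpha0 Mo).2 \is a fin_num by rewrite ge0_fin_numE.
exists (`|C| + fine (Pen Mo (alpha0 Mo).2)); split; first by rewrite addr_ge0// fine_ge0.
apply: filterS HC => n; rewrite -(fineK Pf); move: (Pen_ge0 (Pi_h0 Mo n)).
case: (Pen Mo (Pi_h0 Mo n)) => [x||]// _; rewrite /= !lee_fin => h.
rewrite -lerBlDr; apply: le_trans (ler_norm _) _; apply: le_trans h _.
exact: ler_norm.
Qed.

Let drop_lambda (x : \bar R) (l y : R) : 0 < l -> (l%:E * x <= (y * l)%:E)%E -> (x <= y%:E)%E.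
Proof. by move=> l0; rewrite mulrC EFinM lee_pmul2l. Qed.

(** Comparison with a feasible point bounds both the penalty and the criterion
    of an approximate minimizer, because neither is negative. *)
Lemma approx_min_bound n (z : 'I_n -> ZT) b (S : set par) a a' (p q t : R) :
  approx_min Mo z b S a -> S a' -> (Pen Mo a'.2 <= p%:E)%E ->
  Qhatb Mo z b a' <= q * lambda Mo n -> tol Mo n <= t * lambda Mo n ->
  (Pen Mo a.2 <= (q + p + t)%:E)%E /\ Qhatb Mo z b a <= (q + p + t) * lambda Mo n.
Proof.
move=> ha Sa' pa' qa' tl; have l0 := lambda_pos n.
have le : (pen_crit Mo z b a <= ((q + p + t) * lambda Mo n)%:E)%E.
  apply: le_trans ha _; rewrite mulrDl EFinD; apply: leeD; last by rewrite lee_fin.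
  apply: (@le_trans _ _ (pen_crit Mo z b a')); first by apply: ereal_inf_lbound; exists a'.
  rewrite mulrDl EFinD; apply: leeD; first by rewrite lee_fin.
  by rewrite mulrC EFinM lee_pmul2l.
have lP : (0 <= (lambda Mo n)%:E * Pen Mo a.2)%E.
  by apply: mule_ge0 (Pen_ge0 _); rewrite lee_fin ltW.
split.
  apply: (drop_lambda l0); apply: le_trans le; apply: leeDr.
  by rewrite lee_fin; exact: Qhatb_ge0.
by rewrite -lee_fin; apply: le_trans le; exact: leeDl.
Qed.

Let crit_tol : exists C : R, 0 <= C /\ \forall n \near \oo,
  (crit_Q Mo (Pi n) <= (C * lambda Mo n)%:E)%E /\ tol Mo n <= C * lambda Mo n.
Proof.
have [_ [C HC] _ _] := HPEN; have [tol0 _] : tol_ok Mo by case: Hmodel => _ [].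
have Hwt : weighting_ok Mo by case: Hmodel => -[].
exists `|C|; split; first exact: normr_ge0.
apply: filterS HC => n h; have Q0 := crit_Q_ge0 Hwt (Pi n).
have t0 : (0 <= (tol Mo n)%:E)%E by rewrite lee_fin ltW.
have hC : ((C * lambda Mo n)%:E <= (`|C| * lambda Mo n)%:E)%E.
  by rewrite lee_fin ler_pM2r// ler_norm.
have {}h := le_trans h hC; split; first exact: le_trans (leeDl _ t0) h.
by rewrite -lee_fin; exact: le_trans (leeDr _ Q0) h.
Qed.

Section hat.
Context (HCRIT : cond_CRIT_i Mo).

Lemma alphahat_bounds : exists p : R, 0 <= p /\
  W (fun n z _ => (Pen Mo (alphahat Mo z).2 <= p%:E)%E /\
                  Qhat Mo z (alphahat Mo z) <= p * lambda Mo n).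
Proof.
have [C [C0 HC]] := crit_tol; have [p [p0 Hp]] := Pen_Pi_le.
have [c0 [c00 Hc]] := HCRIT.
have [_ amin] : estimator_ok Mo by case: Hmodel => _ [].
pose q := c0 * C + C; have q0 : 0 <= q by exact: (addr_ge0 (mulr_ge0 (ltW c00) _) C0).
exists (q + p + C); split; first exact: (addr_ge0 (addr_ge0 q0 p0) C0).
apply: (wpa1_and_mono (proj1 (@wpa1_sample _ _ _ P _ ZN WN
    (fun n z => approx_min Mo z unit (sieve Mo (kdim Mo n)) (alphahat Mo z))) amin)
  (proj1 (@wpa1_sample _ _ _ P _ ZN WN (fun n z => ((Qhat Mo z (Pi n))%:E <=
     c0%:E * crit_Q Mo (Pi n) + (tol Mo n)%:E)%E)) Hc)).
apply: filterS2 HC Hp => n [QC tC] pPi z _ ha hQ.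
apply: (approx_min_bound ha (Pi_sieve Hmom HID n) pPi _ tC).
rewrite -lee_fin; apply: le_trans hQ _; rewrite mulrDl EFinD; apply: leeD.
  by rewrite -mulrA EFinM lee_pmul2l.
by rewrite lee_fin.
Qed.

Context (HBCRIT : cond_BCRIT_i Mo).

Lemma bootstrap_bounds : exists p : R, 0 <= p /\
  W (fun n z b => [/\ (Pen Mo (alphaB Mo z b).2 <= p%:E)%E,
     Qhatb Mo z b (alphaB Mo z b) <= p * lambda Mo n,
     (Pen Mo (alphaRB Mo z b).2 <= p%:E)%E &
     Qhatb Mo z b (alphaRB Mo z b) <= p * lambda Mo n]).
Proof.
have [C [C0 HC]] := crit_tol; have [p [p0 Hp]] := alphahat_bounds.
have [c0 [c00 Hc]] := HBCRIT.
have [sv _] : estimator_ok Mo by case: Hmodel => _ [].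
have [_ aminB _ aminRB _] : bootstrap_ok Mo by case: Hmodel => _ [].
pose q := c0 * p + C; have q0 : 0 <= q by exact: (addr_ge0 (mulr_ge0 (ltW c00) _) C0).
exists (q + p + C); split; first exact: (addr_ge0 (addr_ge0 q0 p0) C0).
apply: (wpa1_and_mono (wpa1_and aminB aminRB) (wpa1_and Hp Hc)).
apply: filterS HC => n [_ tC] z b [hB hRB] [[pp Qp] QB].
have Qb : Qhatb Mo z b (alphahat Mo z) <= q * lambda Mo n.
  apply: le_trans QB _; rewrite mulrDl; apply: lerD tC; rewrite -mulrA ler_pM2l//.
have [h1 h2] := approx_min_bound hB (sv n z) pp Qb tC.
have [h3 h4] := approx_min_bound hRB (conj (sv n z) erefl) pp Qb tC.
by split.
Qed.

End hat.

End penalty_bounds.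

(** * Local expansions *)

Lemma affine_path_continuous (R : realType) (V : normedModType R) (a v : V) (r : R) :
  continuous (fun s : R => a + (s / r) *: v).
Proof.
move=> s; apply: cvgD; first exact: cvg_cst.
by apply: cvgZr_tmp; apply: (@continuousM R R id); [exact: cvg_id|exact: cst_continuous].
Qed.

Lemma scaled_continuous (R : realType) (F : R -> R) (r y s : R) :
  continuous F -> continuous (fun t => r * (F t - y) / s).
Proof.
move=> cF t; apply: (@continuousM R R (fun t => r * (F t - y)) (fun=> s^-1)).
  apply: (@continuousM R R (fun=> r) (fun t => F t - y)); first exact: cst_continuous.
  by apply: (@continuousB _ R^o); [exact: cF|exact: cst_continuous].
exact: cst_continuous.
Qed.

(** Intermediate value theorem between the two points where the affine
    approximation misses the target by twice its error. *)
Lemma almost_affine_reaches (R : realType) (G : R -> R) (a l x xt h M K : R) :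
  continuous G -> 0 < K -> K^-1 <= a -> 0 < h -> h <= 1 ->
  (forall s, `|s| <= (M + 2) * K -> `|G s - (l + s * a)| <= h) ->
  `|xt - x| <= h -> `|x - l| <= M ->
  exists s, [/\ `|s| <= (M + 2) * K, G s = xt & `|s * a - (x - l)| <= 2 * h].
Proof.
move=> cG K0 aK h0 h1 HG xtx xM.
have a0 : 0 < a by apply: lt_le_trans aK; rewrite invr_gt0.
have M0 : 0 <= M by exact: le_trans xM.
pose e y := (x - l + y * (2 * h)) / a.
have eS y : `|y| <= 1 -> `|e y| <= (M + 2) * K.
  move=> y1; rewrite /e normrM [`|a^-1|]gtr0_norm ?invr_gt0//.
  apply: ler_pM => //; first by rewrite invr_ge0 ltW.
    apply: le_trans (ler_normD _ _) _; apply: lerD => //.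
    rewrite normrM [`|2 * h|]gtr0_norm ?mulr_gt0//.
    rewrite -[leRHS]mul1r; apply: ler_pM => //; first by rewrite mulr_ge0// ltW.
    by lra.
  by rewrite -[leRHS]invrK lef_pV2 ?posrE ?invr_gt0.
have ea y : e y * a = x - l + y * (2 * h) by rewrite /e divfK// gt_eqF.
have n1 : `|1 : R| <= 1 by rewrite normr1.
have nN1 : `|-1 : R| <= 1 by rewrite normrN1.
have up : xt <= G (e 1).
  by have := HG _ (eS 1 n1); rewrite ea; move: xtx; rewrite !ler_norml; lra.
have dn : G (e (-1)) <= xt.
  by have := HG _ (eS (-1) nN1); rewrite ea; move: xtx; rewrite !ler_norml; lra.
have ee : e (-1) <= e 1 by rewrite /e ler_pM2r ?invr_gt0//; lra.
have [|s] := @IVT R G (e (-1)) (e 1) xt ee (continuous_subspaceT cG).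
  by rewrite ge_min le_max dn up orbT.
rewrite in_itv/= => /andP[s1 s2] Gs; exists s; split => //.
  have := eS 1 n1; have := eS (-1) nN1; rewrite !ler_norml; lra.
have := ler_wpM2r (ltW a0) s1; have := ler_wpM2r (ltW a0) s2; rewrite !ea ler_norml.
by move: (s * a) => y; lra.
Qed.

Section local_expansion.
Context {R : realType} {d : measure_display} {T : measurableType d}.
Context {P : probability T R} {dY dX dt dr : nat}.
Context {H : completeNormedModType R}.
Context (Mo : model P dY dX dt dr H) (L : local_objects dY dX dt H).
Context (Hmodel : model_ok Mo) (HID : cond_ID Mo) (HPEN : cond_PEN Mo).
Context (HCRIT : cond_CRIT_i Mo).
Context (Hlocal : local_ok Mo L) (HLOC : cond_LOC Mo L) (HPHI : cond_PHI Mo L).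
Context (HLQA : cond_LQA Mo L).
(* [p] bounds the penalties of the sieve approximations and of the estimators;
   below M0, so that points of that penalty near alpha0 lie in [Aos] *)
Context (p : R) (pM : p < M0 L).
Context (HpPi : \forall n \near \oo, (Pen Mo (Pi_h0 Mo n) <= p%:E)%E).

Local Notation ZT := ('rV[R]_dY * 'rV[R]_dX)%type.
Local Notation par := ('rV[R]_dt * H)%type.
Local Notation dir := (directions Mo L).
Local Notation wnorm := (wnorm Mo).
Local Notation a0 := (alpha0 Mo).
Local Notation Pi := (Pi_alpha0 Mo).
Local Notation ip := (ip Mo).
Local Notation u := (ustar Mo L).
Local Notation sh := (Defs.shift Mo L).
Local Notation ZN := (@Zn _ _ _ P _ _ _ _ _ Mo).
Local Notation WN := (@Wn _ _ _ P _ _ _ _ _ Mo).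
Local Notation smp n w := (@Zn _ _ _ P _ _ _ _ _ Mo n w).
Local Notation W := (cond_wpa1 P ZN WN).
Local Notation unit := (@unit_weights R _).

Let Hdata : data_ok Mo. Proof. by case: Hmodel => -[]. Qed.
Let Hmom : moment_ok Mo. Proof. by case: Hmodel => -[]. Qed.
Let Hwt : weighting_ok Mo. Proof. by case: Hmodel => -[]. Qed.
Let Htol : tol_ok Mo. Proof. by case: Hmodel => _ []. Qed.
Let Hnb : neighborhood_ok Mo L. Proof. by case: Hlocal. Qed.
Let Hriesz : riesz_ok Mo L. Proof. by case: Hlocal. Qed.
Let Hpd : pathwise_diff Mo L. Proof. by have [[]] := HLOC. Qed.
Let Hrates : rates_ok Mo L. Proof. by case: Hlocal. Qed.
Let lambda_pos n : 0 < lambda Mo n. Proof. exact: lambda_gt0 HPEN n. Qed.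
Local Notation an n := (wnorm (u n) ^+ 2).
Local Notation sd n := (sdnorm Mo (vstar L n)).
Local Notation sw := (sigma_w Mo).

(** ** Rates of convergence *)

Let delta_pos n : 0 < delta L n.
Proof. by have [_ [/(_ n)/andP[]]] := Hrates. Qed.

Lemma norm_s_Pi n : norm_s (Pi n - a0) = `|Pi_h0 Mo n - a0.2|.
Proof.
rewrite /norm_s /= subrr (_ : enorm 0 = 0) ?add0r//.
by rewrite /enorm big1 ?sqrtr0// => j _; rewrite mxE expr0n.
Qed.

Lemma near_Pi_h0 (e : R) : 0 < e -> \forall n \near \oo, `|Pi_h0 Mo n - a0.2| <= e.
Proof.
move=> e0; have [_ [_ _ _ _ cPi] _ _] := HID.
by apply: filterS (rcvg0_near cPi e0) => n; rewrite normr_id.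
Qed.

Lemma Aos_radius (y : R) : y < M0 L -> exists2 r : R, 0 < r & forall a,
  params Mo a -> norm_s (a - a0) < r -> (Pen Mo a.2 <= y%:E)%E -> Aos L a.
Proof.
move=> yM; have [_ _ _ [r r0 Hr]] := Hnb; exists r => // a pa ra pena.
by apply: Hr => //; apply: le_lt_trans pena _; rewrite lte_fin.
Qed.

Lemma Pi_Aos : \forall n \near \oo, Aos_sieve Mo L (kdim Mo n) (Pi n).
Proof.
have [r r0 Hr] := Aos_radius pM.
have r2 : 0 < r / 2 by rewrite divr_gt0.
near=> n; split; last exact: Pi_sieve.
apply: Hr.
- exact: Theta_alpha0.
- rewrite norm_s_Pi; apply: (@le_lt_trans _ _ (r / 2)); last by lra.
  by near: n; exact: near_Pi_h0.
- by near: n.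
Unshelve. all: by end_near. Qed.

(** Positivity of tau needs a point of the sieve other than the approximation
    of alpha0: were there none, tau would be the supremum of the empty set,
    which is not finite. Where the weak norm vanishes so does the vector,
    since the weak norm is definite on the sieve directions. *)
Lemma tau_bound : \forall n \near \oo, exists t : R,
  [/\ 0 < t, tau Mo L n = t%:E & forall a, Aos_sieve Mo L (kdim Mo n) a ->
    norm_s (a - Pi n) <= t * wnorm (a - Pi n)].
Proof.
have [_ _ _ tfin _] := Hrates.
apply: filterS2 Pi_Aos tfin => n PA tfin.
have [[_ _ inj _ _] _ _] := HPHI.
exists (fine (tau Mo L n)).
have tE : tau Mo L n = (fine (tau Mo L n))%:E by rewrite fineK.
have wn0 : wnorm 0 = 0.
  have d0 : dir 0 by exact: linspan0.
  have := wnormZ Hdata Hmom Hwt Hnb Hpd 0 d0; rewrite scale0r => ->.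
  by rewrite normr0 mul0r.
have bnd a : Aos_sieve Mo L (kdim Mo n) a -> wnorm (a - Pi n) != 0 ->
    norm_s (a - Pi n) / wnorm (a - Pi n) <= fine (tau Mo L n).
  move=> Aa wa; rewrite -lee_fin -tE; apply: ereal_sup_ubound.
  by exists a.
split=> //.
  have [a [Aa wa]] : exists a, Aos_sieve Mo L (kdim Mo n) a /\ wnorm (a - Pi n) != 0.
    apply: contrapT => /forallNP none; move: tfin.
    rewrite /tau; set A := (X in ereal_sup X); have -> : A = set0.
      by apply/seteqP; split => // x [a [Aa wa] _]; apply: (none a).
    by rewrite ereal_sup0.
  apply: lt_le_trans (bnd a Aa wa); rewrite divr_gt0//; last first.
    by rewrite lt_def wa wnorm_ge0.
  rewrite lt_def norm_s_ge0 andbT; apply: contra_neq wa.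
  by move=> /norm_s_eq0 ->.
move=> a Aa; have [w0|wa] := eqVneq (wnorm (a - Pi n)) 0; last first.
  by rewrite -ler_pdivrMr ?bnd// lt_def wa wnorm_ge0.
have V x : Aos_sieve Mo L (kdim Mo n) x -> Vsieve Mo L (kdim Mo n) (x - aproj L (kdim Mo n)).
  by move=> Ax; apply: linspan_incl; exists x.
have := linspanB (V _ Aa) (V _ PA); rewrite opprB addrA subrK => VaPi.
have [_ /(_ _ VaPi w0) ->] := inj (kdim Mo n).
by rewrite wn0 mulr0 /norm_s normr0 addr0 /enorm big1 ?sqrtr0// => j _; rewrite mxE expr0n.
Qed.

Lemma delta_s_gt0 : \forall n \near \oo, 0 < delta_s Mo L n.
Proof.
apply: filterS tau_bound => n [t [t0 tE _]].
by rewrite /delta_s tE ltr_wpDl// mulr_gt0 ?delta_pos.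
Qed.

Lemma Mseq_infty (K : R) : \forall n \near \oo, K <= Mseq Mo L n.
Proof.
have [_ _ _ _ cds] := Hrates.
have eK : 0 < (expR K)^-1 by rewrite invr_gt0 expR_gt0.
have big : \forall n \near \oo, expR (expR K) <= (n%:R : R).
  exists (Num.truncn (expR (expR K))).+1 => // n /= Nn.
  by apply: le_trans (ltW (truncnS_gt _)) _; rewrite ler_nat.
have ge_ln (x y : R) : expR x <= y -> x <= ln y.
  move=> xy; rewrite -[leLHS]expRK ler_ln// posrE ?expR_gt0//.
  exact: lt_le_trans (expR_gt0 _) xy.
near=> n; rewrite /Mseq le_min; apply/andP; split.
  apply: (ge_ln); apply: (ge_ln); apply: (@le_trans _ _ n%:R); last by rewrite lerDl.
  by near: n.
apply: ge_ln; have ds0 : 0 < delta_s Mo L n by near: n; exact: delta_s_gt0.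
apply: (@le_trans _ _ (delta_s Mo L n)^-1); last by rewrite lerDl.
rewrite -[leLHS]invrK lef_pV2 ?posrE//.
apply: le_trans (ler_norm _) _.
by near: n; exact: (rcvg0_near cds).
Unshelve. all: by end_near. Qed.

(** The sieve approximation error is of the order of the penalty weight, hence
    below the local rate. *)
Lemma Pi_rate : exists K : R, 0 < K /\ \forall n \near \oo,
  [/\ (crit_Q Mo (Pi n) <= (K * lambda Mo n)%:E)%E, tol Mo n <= K * lambda Mo n,
      lambda Mo n <= delta L n ^+ 2, tol Mo n <= delta L n ^+ 2 &
      wnorm (Pi n - a0) ^+ 2 <= K * lambda Mo n].
Proof.
have [_ [C HC] _ _] := HPEN.
have [_ [c1 [c2 [c10 Qeq]]] [_ dmax] _] := HLOC.
pose K := `|C| + `|C| / c1 + 1.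
have K0 : 0 < K by rewrite ltr_wpDl// addr_ge0// divr_ge0// ltW.
exists K; split => //.
apply: filterS3 Pi_Aos HC dmax => n [PA _] HC dmax.
have l0 := lambda_pos n; have [t0 _] := Htol; have {}t0 := t0 n.
have Q0 := crit_Q_ge0 Hwt (Pi n).
have CK : C <= K.
  rewrite /K -addrA; apply: le_trans (ler_norm C) _; rewrite lerDl addr_ge0//.
  by rewrite divr_ge0// ltW.
have below x : (x <= maxe (maxe (delta L n ^+ 2)%:E (crit_Q Mo (Pi n)))
    (maxe (lambda Mo n)%:E (tol Mo n)%:E))%E -> (x <= (delta L n ^+ 2)%:E)%E.
  by rewrite dmax.
have QC : (crit_Q Mo (Pi n) <= (C * lambda Mo n)%:E)%E.
  by apply: le_trans HC; rewrite leeDl// lee_fin ltW.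
have Ql : (C * lambda Mo n <= K * lambda Mo n) by rewrite ler_pM2r.
have tC : tol Mo n <= C * lambda Mo n.
  by rewrite -lee_fin; apply: le_trans HC; rewrite leeDr.
split.
- by apply: le_trans QC _; rewrite lee_fin.
- exact: le_trans tC Ql.
- by rewrite -lee_fin; apply: below; rewrite !le_max lexx !orbT.
- by rewrite -lee_fin; apply: below; rewrite !le_max lexx !orbT.
have [/le_trans/(_ QC) + _] := andP (Qeq _ PA); rewrite lee_fin => w.
rewrite mulrC -ler_pdivlMr// in w; apply: le_trans w _.
rewrite mulrAC ler_pM2r//.
apply: (@le_trans _ _ (`|C| / c1)); first by rewrite ler_pM2r ?invr_gt0// ler_norm.
by rewrite /K addrAC lerDr addr_ge0.
Qed.

Lemma wnormB v w : dir v -> dir w -> wnorm (v - w) <= wnorm v + wnorm w.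
Proof.
move=> dv dw; have dNw : dir (- w) by rewrite -scaleN1r; exact: dirZ.
apply: le_trans (wnormD Hdata Hmom Hwt Hnb Hpd dv dNw) _.
by rewrite -scaleN1r (wnormZ Hdata Hmom Hwt Hnb Hpd _ dw) normrN1 mul1r.
Qed.

Let sqr_le (x K l : R) : 0 <= x -> 0 <= l -> 0 <= K -> x ^+ 2 <= K * l ^+ 2 ->
  x <= Num.sqrt K * l.
Proof.
move=> x0 l0 K0 h; rewrite -(@ler_pXn2r _ 2)// ?nnegrE ?mulr_ge0 ?sqrtr_ge0//.
by rewrite exprMn sqr_sqrtr.
Qed.

Lemma wnorm_Pi_le : exists K : R, 0 < K /\
  \forall n \near \oo, wnorm (Pi n - a0) <= K * delta L n.
Proof.
have [K [K0 HK]] := Pi_rate.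
exists (Num.sqrt K); split; first by rewrite sqrtr_gt0.
apply: filterS HK => n [_ _ ld _ wl].
apply: sqr_le; [exact: wnorm_ge0|exact: ltW|exact: ltW|].
by apply: le_trans wl _; rewrite ler_pM2l.
Qed.

(** The factor [Mseq], which tends to infinity, absorbs the constant [K]; the
    strong norm is bounded by tau times the weak one. *)
Lemma Nosn_of_wnorm (K : R) : \forall n \near \oo, forall a,
  Aos_sieve Mo L (kdim Mo n) a -> wnorm (a - a0) <= K * delta L n -> Nosn Mo L n a.
Proof.
have [K' [K'0 HK']] := wnorm_Pi_le.
pose M := Num.max 1 (Num.max K (K + K')).
near=> n => a [Aa Sa] wa.
have MM : M <= Mseq Mo L n.
  by near: n; exact: (Mseq_infty).
have wPi : wnorm (Pi n - a0) <= K' * delta L n by near: n.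
have [t [t0 tE tau_le]] : exists t : R,
  [/\ 0 < t, tau Mo L n = t%:E & forall a, Aos_sieve Mo L (kdim Mo n) a ->
    norm_s (a - Pi n) <= t * wnorm (a - Pi n)].
  by near: n; exact: (tau_bound).
have [M1 MK MKK] : [/\ 1 <= Mseq Mo L n, K <= Mseq Mo L n & K + K' <= Mseq Mo L n].
  by split; apply: le_trans MM; rewrite /M !le_max lexx ?orbT.
have [_ _ Apen _] := Hnb; have [pa _ Aa_pen] := Apen a Aa.
have d1 := dir_Aos Mo Aa; have d2 := dir_sieve L (Pi_sieve Hmom HID n).
split=> //; split=> //.
- by apply: le_trans wa _; rewrite ler_pM2r.
- have w3 : wnorm (a - Pi n) <= (K + K') * delta L n.
    rewrite mulrDl; have -> : a - Pi n = (a - a0) - (Pi n - a0).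
      by rewrite opprB addrA subrK.
    by apply: le_trans (wnormB d1 d2) _; apply: lerD.
  have s1 := tau_le a (conj Aa Sa).
  have s2 : norm_s (a - a0) <= norm_s (a - Pi n) + `|a0.2 - Pi_h0 Mo n|.
    rewrite /norm_s /= -addrA lerD2l [X in _ <= _ + X]distrC.
    by apply: le_trans (ler_normD _ _); rewrite addrA subrK.
  have s3 : t * wnorm (a - Pi n) <= Mseq Mo L n * (t * delta L n).
    rewrite mulrCA ler_pM2l//; apply: le_trans w3 _; rewrite ler_pM2r//.
  apply: le_trans s2 _; rewrite /delta_s tE /= mulrDr addrC.
  apply: lerD; last exact: le_trans s1 s3.
  by rewrite ler_peMl.
- exact/ltW/Aa_pen.
Unshelve. all: by end_near. Qed.

Lemma Pi_Nosn : \forall n \near \oo, Nosn Mo L n (Pi n).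
Proof.
have [K [K0 HK]] := wnorm_Pi_le.
apply: filterS3 (Nosn_of_wnorm K) (Pi_Aos) HK.
by move=> n; apply.
Qed.

(** Consistency places the estimator in the local neighbourhood, where the
    sharper lower bound on the criterion and its equivalence with the weak norm
    give the rate delta. *)
Lemma rate_Nosn (c K C : R) (eps : nat -> R) : 0 < c ->
  eps n @[n --> \oo] --> (0 : R) ->
  \forall n \near \oo, forall a (F : R), sieve Mo (kdim Mo n) a ->
    (Pen Mo a.2 <= p%:E)%E -> F <= K * delta L n ^+ 2 ->
    (c%:E * crit_Q Mo a <= (F + C * eps n ^+ 2)%:E)%E ->
    (Aos_sieve Mo L (kdim Mo n) a ->
      (c%:E * crit_Q Mo a <= (F + C * delta L n ^+ 2)%:E)%E) ->
    Aos L a /\ Nosn Mo L n a.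
Proof.
move=> c0 ceps; have [r r0 Hr] := Aos_radius pM.
have [e e0 He] := crit_Q_separated Hdata Hmom Hwt HID HPEN p r0.
have [_ [c1 [c2 [c10 Qeq]]] _ _] := HLOC.
have [_ [_ cdelta] _ _ _] := Hrates.
have small (s : R) (f : nat -> R) (x : R) : 0 < x -> f n @[n --> \oo] --> (0 : R) ->
    \forall n \near \oo, s * f n ^+ 2 <= x.
  move=> x0 cf; pose y := Num.min 1 (x / (`|s| + 1)).
  have s1 : 0 < `|s| + 1 by rewrite ltr_wpDl.
  have y0 : 0 < y by rewrite lt_min ltr01 divr_gt0.
  apply: filterS (rcvg0_near cf y0) => n fy.
  apply: (@le_trans _ _ ((`|s| + 1) * y)); last first.
    by rewrite mulrC -ler_pdivlMr// ge_min lexx orbT.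
  apply: (@le_trans _ _ ((`|s| + 1) * f n ^+ 2)).
    by apply: ler_wpM2r; [exact: sqr_ge0|apply: le_trans (ler_norm s) _; rewrite lerDl].
  rewrite ler_pM2l// -real_normK ?num_real// expr2.
  apply: (@le_trans _ _ (`|f n| * 1)); last by rewrite mulr1.
  by apply: ler_wpM2l => //; apply: le_trans fy _; rewrite ge_min lexx.
have ce2 : 0 < c * e / 2 by rewrite divr_gt0// mulr_gt0.
pose K2 := (`|K| + `|C|) / (c * c1).
have K20 : 0 <= K2 by rewrite divr_ge0 ?addr_ge0// mulr_ge0// ltW.
near=> n => a F Sa pena FK glob loc.
have sm1 : K * delta L n ^+ 2 <= c * e / 2 by near: n; exact: small.
have sm2 : C * eps n ^+ 2 <= c * e / 2 by near: n; exact: small.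
have pa : params Mo a by case: Sa.
have Aa : Aos L a.
  apply: Hr => //; rewrite ltNge; apply/negP => ra.
  have Qe := He a pa pena ra.
  have : (c%:E * crit_Q Mo a <= (c * e)%:E)%E.
    apply: le_trans glob _; rewrite lee_fin [c * e]splitr.
    by apply: lerD => //; exact: le_trans FK sm1.
  rewrite leNgt => /negP; apply; rewrite EFinM lte_pmul2l//.
split=> //; have NW : forall a, Aos_sieve Mo L (kdim Mo n) a ->
    wnorm (a - a0) <= Num.sqrt K2 * delta L n -> Nosn Mo L n a.
  by near: n; exact: Nosn_of_wnorm.
apply: NW => //; apply: sqr_le; [exact: wnorm_ge0|exact: ltW|exact: K20|].
have [Q1 _] := andP (Qeq a Aa).
have := loc (conj Aa Sa).
have cQ : ((c * (c1 * wnorm (a - a0) ^+ 2))%:E <= c%:E * crit_Q Mo a)%E.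
  by rewrite EFinM lee_pmul2l.
move=> /(le_trans cQ); rewrite lee_fin => h.
rewrite /K2 mulrAC ler_pdivlMr ?mulr_gt0// mulrC -mulrA.
apply: le_trans h _; rewrite mulrDl.
have d2 : 0 <= delta L n ^+ 2 by exact: sqr_ge0.
apply: lerD; last by apply: ler_wpM2r => //; exact: ler_norm.
by apply: le_trans FK _; apply: ler_wpM2r => //; exact: ler_norm.
Unshelve. all: by end_near. Qed.

Lemma ustar_Vsieve n : Vsieve Mo L (kdim Mo n) (u n).
Proof. by apply: linspanZ; have [_ _ /(_ n)[]] := Hriesz. Qed.

Lemma ustar_dir n : dir (u n).
Proof. exact: (dir_Vsieve Hriesz (ustar_Vsieve n)). Qed.

(** The direction has unit variance norm, to which the weak norm is
    equivalent. *)
Lemma wnorm_ustar : exists K : R, [/\ 0 < K, forall n, wnorm (u n) ^+ 2 <= K &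
  forall n, sdnorm Mo (vstar L n) != 0 -> K^-1 <= wnorm (u n) ^+ 2].
Proof.
have [K [K0 HK]] := sdnorm_wnorm Hdata Hwt HID Hpd.
have vd n : dir (vstar L n) by have [_ _ /(_ n)[/(dir_Vsieve Hriesz)]] := Hriesz.
have uE n : wnorm (u n) ^+ 2 = (sdnorm Mo (vstar L n) ^+ 2)^-1 * wnorm (vstar L n) ^+ 2.
  rewrite /ustar (wnormZ Hdata Hmom Hwt Hnb Hpd _ (vd n)) exprMn.
  by rewrite real_normK ?num_real// exprVn.
exists K; split => // n.
  rewrite uE; have [_] := HK _ (vd n).
  move: (sdnorm _ _) (wnorm _) => s w ws.
  have [->|s0] := eqVneq s 0; first by rewrite expr0n invr0 mul0r ltW.
  by rewrite mulrC ler_pdivrMr// exprn_even_gt0.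
move=> s0; rewrite uE; have [+ _] := HK _ (vd n).
move: s0; move: (sdnorm _ _) (wnorm _) => s w s0 sw.
by rewrite mulrC ler_pdivlMr ?exprn_even_gt0// mulrC ler_pdivrMr// mulrC.
Qed.

Let dir_u n : dir (u n). Proof. exact: ustar_dir. Qed.
Local Opaque Defs.wnorm Defs.ip Defs.sdnorm.

(** ** The score *)

Let tol_pos n : 0 < tol Mo n. Proof. by case: Htol. Qed.

Lemma near_ntol (e : R) : 0 < e -> \forall n \near \oo, n%:R * tol Mo n <= e.
Proof.
move=> e0; have [_ ct] := Htol; apply: filterS (rcvg0_near ct e0) => n.
by apply: le_trans; exact: ler_norm.
Qed.

Lemma near_gt0 : \forall n \near \oo, (0 < n)%N.
Proof. by exists 1%N. Qed.

Definition std_score n (z : 'I_n -> ZT) (b : 'I_n -> R) : R :=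
  Num.sqrt n%:R * Zscore Mo L z b.

Let measurable_score_term n (i : nat) : measurable_fun setT (fun w =>
  qform (Sigma Mo (Zobs Mo i w).2) (dm Mo (Zobs Mo i w).2 (u n))
        (rho Mo (Zobs Mo i w) a0)).
Proof.
have [_ bZ _ _] := Hdata.
have bX : borel_rv (snd \o Zobs Mo i) by apply: borel_rv_comp (bZ i) _ => x; exact: cvg_snd.
have [_ bS _] := Hwt; have [brho _ _ _] := Hmom.
apply: measurable_qform.
- by move=> w; exact: Sigma_posdef.
- by move=> j k; exact: (measurable_borel_comp bX (bS j k)).
- move=> j k; rewrite (ord1 k); have [_ _ _ bd _] := Hpd.
  exact: (measurable_borel_comp bX (bd _ j (dir_u n))).
- move=> j k; rewrite (ord1 k).
  exact: (measurable_borel_comp (bZ i) (brho a0 j (Theta_alpha0 Hmom))).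
Qed.

Lemma measurable_std_score n :
  measurable_fun setT (fun w => std_score (smp n w) unit).
Proof.
apply: measurable_funM => //; apply: measurable_funM => //.
apply: measurable_sum => i; apply: measurable_funM => //.
exact: measurable_score_term.
Qed.

Lemma measurable_std_score_weights n (z : 'I_n -> ZT) (f : 'I_n -> T -> R) :
  (forall i, measurable_fun setT (f i)) ->
  measurable_fun setT (fun w => std_score z (fun i => f i w)).
Proof.
move=> mf; apply: measurable_funM => //; apply: measurable_funM => //.
by apply: measurable_sum => i; exact: measurable_funM.
Qed.

Lemma score_abs_close (e : R) : 0 < e -> \forall n \near \oo,
  abs_close P (fun w => std_score (smp n w) unit) e.
Proof.
by have [_ cX] := HLQA; apply: cvg_std_normal_abs_close => // n; exact: measurable_std_score.
Qed.

Lemma dm0 x : dm Mo x 0 = 0.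
Proof.
rewrite /dm /derive; under eq_fun do rewrite scaler0 /= add0r subrr scaler0.
exact: lim_cst.
Qed.

(** A vanishing variance norm would make the score identically zero, against
    its normal limit. *)
Lemma sdnorm_neq0 : \forall n \near \oo, sdnorm Mo (vstar L n) != 0.
Proof.
have h2 : (0 : R) < 2^-1 by [].
apply: filterS (score_abs_close h2) => n HX; apply/eqP => s0.
have := HX 0; rewrite /abs_cdf.
have -> : [set w | `|std_score (smp n w) unit| <= 0] = setT.
  apply/seteqP; split => // w _ /=.
  rewrite /std_score /Zscore /ustar s0 invr0 scale0r big1 ?mulr0 ?normr0// => i _.
  by rewrite dm0 qform0 mulr0.
rewrite probability_setT /= ler_norml => /andP[_].
by have := normal_abs_cdf_le (lexx (0 : R)); lra.
Qed.

Lemma wnorm_ustar_bounds : exists K : R, 0 < K /\ \forall n \near \oo,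
  K^-1 <= wnorm (u n) ^+ 2 <= K.
Proof.
have [K [K0 Kub Klb]] := wnorm_ustar.
by exists K; split => //; apply: filterS sdnorm_neq0 => n s0; rewrite Klb//=.
Qed.

(** ** Using the quadratic approximation *)

Definition lqa_within (e : R) n (z : 'I_n -> ZT) (b : 'I_n -> R) (B : R) : Prop :=
  (`|lqa_remainder Mo L z b B| <= e%:E)%E.

(** The rate [rate_r] is at least the inverse of a sum; in this form the sign
    of [t] no longer matters. *)
Lemma lqa_withinP (e : R) n (z : 'I_n -> ZT) b B a t : lqa_within e z b B ->
  Nosn Mo L n a -> Tn Mo L n t ->
  `|2^-1 * (Qhatb Mo z b (sh n a t) - Qhatb Mo z b a)
    - t * (Zscore Mo L z b + ip (u n) (a - a0)) - B / 2 * t ^+ 2|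
  <= e * (t ^+ 2 + `|t| / Num.sqrt n%:R + tol Mo n).
Proof.
move=> he Na Tt.
have : ((rate_r Mo n t * `|2^-1 * (Qhatb Mo z b (sh n a t) - Qhatb Mo z b a)
    - t * (Zscore Mo L z b + ip (u n) (a - a0)) - B / 2 * t ^+ 2|)%:E <= e%:E)%E.
  apply: le_trans he; apply: le_trans (lee_abs _).
  by apply: ereal_sup_ubound; exists (a, t).
rewrite lee_fin; move: `|_ - _| => v; rewrite /rate_r.
set M := Num.max _ _ => Mv.
have tn0 : 0 <= `|t| / Num.sqrt n%:R by rewrite divr_ge0 ?sqrtr_ge0.
have tpos := tol_pos n.
have M0 : 0 < M by rewrite !lt_max tpos !orbT.
have Mle : M <= t ^+ 2 + `|t| / Num.sqrt n%:R + tol Mo n.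
  have t2 : 0 <= t ^+ 2 by exact: sqr_ge0.
  have tt : t / Num.sqrt n%:R <= `|t| / Num.sqrt n%:R.
    by apply: ler_wpM2r; [rewrite invr_ge0 sqrtr_ge0|exact: ler_norm].
  move: t2 tt tn0 tpos; rewrite /M !ge_max.
  move: (t ^+ 2) (t / _) (`|t| / _) (tol _ _) => A B' C D *.
  by apply/andP; split; [|apply/andP; split]; lra.
move: Mv; rewrite mulrC ler_pdivrMr// => Mv; apply: le_trans Mv _.
have e0 : 0 <= e by rewrite -lee_fin; exact: le_trans (abse_ge0 _) he.
exact: ler_wpM2l.
Qed.

Let lqa_wpa1 (e : R) : 0 < e -> W (fun n z _ => lqa_within e z unit (Bn L z)).
Proof.
have [[_ _ _ _ h] _] := HLQA.
exact: (proj1 (@oPP _ _ _ P _ ZN WN (fun n z => lqa_remainder Mo L z unit (Bn L z))) h).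
Qed.

Let Mseq_ge1 : \forall n \near \oo, 1 <= Mseq Mo L n.
Proof. exact: (Mseq_infty). Qed.

Let le_sqrtr (x y : R) : 0 <= x -> x ^+ 2 <= y -> x <= Num.sqrt y.
Proof. by move=> x0 xy; rewrite -[leLHS](ger0_norm x0) -sqrtr_sqr ler_wsqrtr. Qed.

Let ip_u_Pi : exists K : R, 0 < K /\ \forall n \near \oo,
  `|ip (u n) (Pi n - a0)| <= K * Num.sqrt (lambda Mo n).
Proof.
have [K [K0 HK]] := Pi_rate.
have [K' [K'0 HK']] := wnorm_ustar_bounds.
exists (Num.sqrt K' * Num.sqrt K); split; first by rewrite mulr_gt0// sqrtr_gt0.
apply: filterS2 HK HK' => n [_ _ _ _ wPi] /andP[_ wu].
apply: le_trans (Cauchy_Schwarz Hdata Hmom Hwt Hnb Hpd (dir_u n)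
  (dir_sieve L (Pi_sieve Hmom HID n))) _.
have -> : Num.sqrt K' * Num.sqrt K * Num.sqrt (lambda Mo n) =
    Num.sqrt K' * Num.sqrt (K * lambda Mo n) by rewrite (sqrtrM _ (ltW K0)) mulrA.
apply: ler_pM; [exact: wnorm_ge0|exact: wnorm_ge0| |];
  by apply: le_sqrtr => //; exact: wnorm_ge0.
Qed.

Let score_bound_real (r s x A e : R) : 0 < s -> 0 < r ->
  s * `|x| <= s ^+ 2 * A + e * (s / r) -> r * `|x| <= r * s * A + e.
Proof.
move=> s0 r0 h; rewrite -(ler_pM2l s0).
have -> : s * (r * s * A + e) = r * (s ^+ 2 * A + e * (s / r)).
  by field; rewrite gt_eqF.
by rewrite mulrCA ler_pM2l.
Qed.

(** At the sieve approximation of alpha0 the criterion is at most of order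
    lambda and nonnegative around it, which bounds the score by a multiple of
    sqrt (n lambda). *)
Lemma score_le_lambda (c0 : R) : 0 < c0 -> exists K : R, 0 < K /\
  forall e : R, 0 < e <= 1 -> \forall n \near \oo, forall z : 'I_n -> ZT,
    lqa_within e z unit (Bn L z) ->
    ((Qhat Mo z (Pi n))%:E <= c0%:E * crit_Q Mo (Pi n) + (tol Mo n)%:E)%E ->
    0 < Bn L z ->
    `|std_score z unit| <= Num.sqrt (n%:R * lambda Mo n) * (K + Bn L z) + e.
Proof.
move=> c00; have [K1 [K10 HK1]] := Pi_rate.
have [K2 [K20 HK2]] := ip_u_Pi.
exists ((c0 + 1) * K1 + 1 + K1 + K2); split.
  by rewrite !addr_gt0// mulr_gt0// addr_gt0.
move=> e /andP[e0 e1].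
have NPi := Pi_Nosn.
apply: filterS3 (filterI Mseq_ge1 NPi) (filterI near_gt0 HK2) HK1 =>
  n [M1 Na] [n0 ipb] [QPi tl ld _ _] z he Qz B0.
have r0 : 0 < Num.sqrt (n%:R : R) by rewrite sqrtr_gt0 ltr0n.
have l0 := lambda_pos n; have dn := delta_pos n.
set s := Num.sqrt (lambda Mo n) in ipb *.
have s0 : 0 < s by rewrite sqrtr_gt0.
have s2 : s ^+ 2 = lambda Mo n by rewrite sqr_sqrtr// ltW.
have sT : Tn Mo L n s /\ Tn Mo L n (- s).
  rewrite /Tn /= normrN ger0_norm ?(ltW s0)//.
  suff : s <= 4 * Mseq Mo L n ^+ 2 * delta L n by [].
  have sd : s <= delta L n.
    by rewrite -(@ler_pXn2r _ 2)// ?nnegrE ?s2//; exact: ltW.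
  apply: le_trans sd _; rewrite ler_peMl// ?(ltW dn)//.
  by have : 1 <= Mseq Mo L n ^+ 2 by [rewrite exprn_ege1//]; lra.
have Qu : Qhat Mo z (Pi n) <= (c0 + 1) * K1 * lambda Mo n.
  rewrite -lee_fin; apply: le_trans Qz _.
  have -> : (c0 + 1) * K1 * lambda Mo n =
      c0 * (K1 * lambda Mo n) + K1 * lambda Mo n by ring.
  by rewrite EFinD EFinM leeD// ?lee_fin// lee_pmul2l.
have Qp a : 0 <= Qhatb Mo z unit a by exact: (Qhatb_ge0 Hmodel).
have := lqa_withinP he Na sT.1; have := lqa_withinP he Na sT.2.
have := Qp (sh n (Pi n) s); have := Qp (sh n (Pi n) (- s)).
move: Qu; rewrite -/(Qhat Mo z (Pi n)).
rewrite normrN sqrrN (ger0_norm (ltW s0)) s2.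
rewrite sqrtrM ?ler0n// -/s /std_score normrM (ger0_norm (ltW r0)).
move: (Qhatb Mo z unit _) (Qhatb Mo z unit _) (Qhat _ _ _) => q1 q2 q3.
move: (Zscore _ _ _ _) (ip (u n) _) ipb (Bn L z) B0 => Z I ipb B B0.
move: l0 tl s2 (tol_pos n); move: (lambda Mo n) (tol Mo n) => l t l0 tl s2 t0.
move: (Num.sqrt n%:R) r0 => r r0 Qu Q2 Q1 hm hp.
pose A := (c0 + 1) * K1 / 2 + B / 2 + 1 + K1.
have key : s * `|Z + I| <= s ^+ 2 * A + e * (s / r).
  have sr : 0 <= s / r by rewrite divr_ge0 ?ltW.
  have el : e * l <= l by rewrite ger_pMl.
  have et : e * t <= K1 * l.
    by apply: le_trans tl; rewrite ger_pMl.
  move: hm hp; rewrite !ler_norml => /andP[h1 h2] /andP[h3 h4].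
  have E : e * (l + s / r + t) = e * l + e * (s / r) + e * t by ring.
  rewrite E in h1 h2 h3 h4.
  move: sr el et h1 h2 h3 h4; rewrite /A s2.
  move: (e * (s / r)) (e * l) (e * t) => x1 x2 x3 sr el et h1 h2 h3 h4.
  have h2' : s * (Z + I) >= - (q3 / 2 + B / 2 * l + x2 + x1 + x3) by lra.
  have h4' : - s * (Z + I) >= - (q3 / 2 + B / 2 * l + x2 + x1 + x3) by lra.
  have -> : s * `|Z + I| = `|s * (Z + I)| by rewrite normrM (ger0_norm (ltW s0)).
  have D : l * ((c0 + 1) * K1 / 2 + B / 2 + 1 + K1) =
    ((c0 + 1) * K1 * l) / 2 + B / 2 * l + l + K1 * l by ring.
  rewrite D ler_norml mulNr in h4' *; move: h2' h4' Qu.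
  move: (s * (Z + I)) ((c0 + 1) * K1 * l) (B / 2 * l) (K1 * l) el et => v1 v2 v3 v4.
  by move=> *; apply/andP; split; lra.
have := score_bound_real s0 r0 key.
have rI : r * `|I| <= r * s * K2 by rewrite -mulrA ler_pM2l// mulrC.
have rZ : r * `|Z| <= r * `|Z + I| + r * `|I|.
  rewrite -mulrDr ler_pM2l//.
  by apply: le_trans (ler_normB _ _); rewrite addrK.
have rs0 : 0 <= r * s by rewrite mulr_ge0 ?ltW.
have : r * s * (A + K2) <= r * s * ((c0 + 1) * K1 + 1 + K1 + K2 + B).
  apply: ler_wpM2l => //; have : 0 <= (c0 + 1) * K1.
    by rewrite mulr_ge0 ?addr_ge0 ?ltW.
  by rewrite /A; move: ((c0 + 1) * K1) => X X0; lra.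
rewrite mulrDr; move: rI rZ.
move: (r * `|I|) (r * `|Z|) (r * `|Z + I|) (r * s * A) (r * s * K2) => *; lra.
Qed.

(** A small n lambda_n would confine the score to a small interval with
    probability close to one, while its normal limit charges such an interval
    little. *)
Lemma n_lambda_lower : exists c : R, 0 < c /\ \forall n \near \oo, c <= n%:R * lambda Mo n.
Proof.
have [c0 [c00 HC]] := HCRIT.
have [K [K0 HK]] := score_le_lambda c00.
have e8 : (0 : R) < 8^-1 by [].
have [[_ Bpos _ tB oL] _] := HLQA; have [M HM] := tB _ e8.
pose e : R := 16^-1; have e0 : 0 < e by rewrite invr_gt0.
have e01 : 0 < e <= 1 by rewrite e0 invf_le1// ler1n.
have HL := proj1 (ecvg0P (fun n => outerP_ge0 P _)) (oL e e0) _ e8.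
have HC8 := proj1 (ecvg0P (fun n => outerP_ge0 P _)) HC _ e8.
pose q : R := (16 * (K + `|M| + 1))^-1.
have q0 : 0 < q by rewrite invr_gt0 mulr_gt0// ltr_wpDl// addr_ge0// ltW.
exists (q ^+ 2); split; first by rewrite exprn_gt0.
have HX := score_abs_close e8.
near=> n.
have HKn : forall z : 'I_n -> ZT, lqa_within e z unit (Bn L z) ->
    ((Qhat Mo z (Pi n))%:E <= c0%:E * crit_Q Mo (Pi n) + (tol Mo n)%:E)%E ->
    0 < Bn L z ->
    `|std_score z unit| <= Num.sqrt (n%:R * lambda Mo n) * (K + Bn L z) + e.
  by near: n; exact: HK.
pose X w := std_score (smp n w) unit.
(* the four excluded events have total probability at most 6 / 8; at a sample
   outside of them the bound on the score reads 1 / 8 < sqrt (n lambda) * (K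
   + M) + 1 / 16 *)
have [w [Xw [Bw [Lw Cw]]]] : exists w, ~ (`|X w| <= 8^-1) /\
    (~ (M%:E < `|(Bn L (smp n w))%:E|)%E /\
    (~ (e%:E < `|lqa_remainder Mo L (smp n w) unit (Bn L (smp n w))|)%E /\
    ~ ~ ((Qhat Mo (smp n w) (Pi n))%:E <=
         c0%:E * crit_Q Mo (Pi n) + (tol Mo n)%:E)%E)).
  apply: contrapT => /forallNP none.
  have : (outerP P setT <= (4^-1 + 8^-1)%:E + (8^-1%:E + (8^-1%:E + 8^-1%:E)))%E.
    apply: (@le_outerPU _ _ _ P setT [set w | `|X w| <= 8^-1]
      ([set w | (M%:E < `|(Bn L (smp n w))%:E|)%E] `|`
       ([set w | (e%:E < `|lqa_remainder Mo L (smp n w) unit (Bn L (smp n w))|)%E] `|`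
        [set w | ~ ((Qhat Mo (smp n w) (Pi n))%:E <=
           c0%:E * crit_Q Mo (Pi n) + (tol Mo n)%:E)%E]))).
    - move=> w _; have /not_andP[/contrapT|] := none w; first by left.
      move=> /not_andP[/contrapT|]; first by right; left.
      by move=> /not_andP[/contrapT|/contrapT]; right; right; [left|right].
    - rewrite outerP_measurable; last exact/measurable_abs_le/measurable_std_score.
      have : abs_close P (fun w => std_score (smp n w) unit) 8^-1 by near: n; exact: HX.
      move=> /(_ 8^-1); have := normal_abs_cdf_le (ltW e8).
      rewrite ler_norml => h1 /andP[_ h2].
      rewrite -abs_cdfE; last exact: measurable_std_score.
      by rewrite lee_fin; lra.
    - apply: (le_outerPU (fun w (h : _ w) => h)); first by near: n; exact: HM.
      apply: (le_outerPU (fun w (h : _ w) => h)); first by near: n; exact: HL.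
      by near: n; exact: HC8.
  rewrite outerP_measurable// probability_setT -!EFinD lee_fin. by lra.
have {}Bw : Bn L (smp n w) <= `|M|.
  move/negP: Bw; rewrite -leNgt /= lee_fin => Bw.
  by apply: le_trans (ler_norm _) _; apply: le_trans Bw (ler_norm _).
have {}Lw : lqa_within e (smp n w) unit (Bn L (smp n w)).
  by move/negP: Lw; rewrite -leNgt.
have := HKn _ Lw (contrapT Cw) (Bpos _ _).
move/negP: Xw; rewrite -ltNge -/(X w).
have nl : 0 <= n%:R * lambda Mo n by rewrite mulr_ge0// ltW.
rewrite -[in X in _ -> _ -> X](sqr_sqrtr nl).
have := sqrtr_ge0 (n%:R * lambda Mo n); move: (Num.sqrt _) => s s0.
have B0 := Bpos _ (smp n w).
move=> Xw1 Xw2; rewrite ler_sqr ?nnegrE ?(ltW q0)//.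
have D0 : 0 < 16 * (K + `|M| + 1) by rewrite mulr_gt0// ltr_wpDl// addr_ge0// ltW.
rewrite /q -[leLHS]mul1r ler_pdivrMr//.
have h1 : s * (K + Bn L (smp n w)) <= s * (K + `|M| + 1).
  by apply: ler_wpM2l => //; rewrite -addrA lerD2l; apply: le_trans Bw _; rewrite lerDl.
have h2 := lt_le_trans Xw1 Xw2; rewrite mulrCA.
move: h1 h2; rewrite /e; move: (s * (K + Bn L _)) (s * (K + _ + _)) => v v'.
by lra.
Unshelve. all: by end_near. Qed.

(** ** Local scale *)

Let mid_le (x y q M : R) : y <= q -> x - y <= (M - q) / 2 -> x <= (q + M) / 2.
Proof. by move=> *; lra. Qed.

Let le4 (x : R) : 1 <= x -> 1 <= 4 * x.
Proof. by move=> *; lra. Qed.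

(** The rate delta is not faster than the parametric one, because its square
    dominates lambda_n. *)
Lemma delta_lower : exists c : R, 0 < c /\ \forall n \near \oo,
  c / Num.sqrt n%:R <= delta L n.
Proof.
have [c [c0 Hc]] := n_lambda_lower.
have [K [K0 HK]] := Pi_rate.
exists (Num.sqrt c); split; first by rewrite sqrtr_gt0.
apply: filterS3 Hc HK near_gt0 => n cn [_ _ ld _ _] n0.
have r0 : 0 < Num.sqrt (n%:R : R) by rewrite sqrtr_gt0 ltr0n.
rewrite ler_pdivrMr// -(@ler_pXn2r _ 2)// ?nnegrE ?mulr_ge0 ?sqrtr_ge0 ?(ltW (delta_pos n))//.
rewrite exprMn !sqr_sqrtr ?(ltW c0)//; apply: le_trans cn _.
by rewrite mulrC ler_pM2r ?ltr0n.
Qed.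

Lemma Tn_scaled (S : R) : \forall n \near \oo, forall s : R, `|s| <= S ->
  Tn Mo L n (s / Num.sqrt n%:R).
Proof.
have [c [c0 Hc]] := delta_lower.
pose M := Num.max 1 (S / c).
have HM := Mseq_infty M.
apply: filterS3 Hc HM near_gt0 => n cn Mn n0 s sS.
have r0 : 0 < Num.sqrt (n%:R : R) by rewrite sqrtr_gt0 ltr0n.
suff : `|s / Num.sqrt n%:R| <= 4 * Mseq Mo L n ^+ 2 * delta L n by [].
rewrite normrM [`|_^-1|]ger0_norm ?invr_ge0 ?(ltW r0)//.
have := delta_pos n; move: (Mseq _ _ _) (delta _ _) (Num.sqrt _) Mn cn r0.
move=> m D r Mm cD r0 D0.
have m1 : 1 <= m by apply: le_trans Mm; rewrite le_max lexx.
have Sm : S <= m * c by rewrite -ler_pdivrMr//; apply: le_trans Mm; rewrite le_max lexx orbT.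
apply: (@le_trans _ _ (m * (c / r))).
  by rewrite mulrA ler_pM2r ?invr_gt0//; exact: le_trans sS Sm.
have m0 : 0 < m by exact: lt_le_trans ltr01 m1.
apply: (@le_trans _ _ (m * D)); first by rewrite ler_pM2l.
rewrite ler_pM2r//; apply: (@le_trans _ _ (m ^+ 2)).
  by rewrite expr2 ler_peMl// ltW.
by rewrite ler_peMl ?sqr_ge0// ler1n.
Qed.

(** ** The penalty is asymptotically constant near alpha0 *)

Definition pen (a : par) : R := fine (Pen Mo a.2).

Let Pen_ge0 h : (0 <= Pen Mo h)%E.
Proof. by case: Hmodel => _ [[]]. Qed.

Lemma Pen_fin (a : par) (y : R) : (Pen Mo a.2 <= y%:E)%E -> Pen Mo a.2 = (pen a)%:E.
Proof.
move=> h; rewrite fineK// ge0_fin_numE//; apply: le_lt_trans h _; exact: ltry.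
Qed.

Lemma pen_ge0 a : 0 <= pen a.
Proof. exact: fine_ge0. Qed.

Let cancel_lambda n (x : \bar R) (y : R) :
  ((lambda Mo n)%:E * x <= (lambda Mo n * y)%:E)%E -> (x <= y%:E)%E.
Proof. by rewrite EFinM lee_pmul2l// lte_fin lambda_pos. Qed.

Lemma Nosn_Pen n a : Nosn Mo L n a -> Pen Mo a.2 = (pen a)%:E.
Proof. by move=> [[_ _ _ /cancel_lambda h] _]; exact: Pen_fin h. Qed.

Lemma Aos_Pen a : Aos L a -> Pen Mo a.2 = (pen a)%:E.
Proof.
have [_ _ Ap _] := Hnb; move=> /Ap[_ _ /(_ 0%N)/ltW/cancel_lambda h].
exact: Pen_fin h.
Qed.

Let mul_le_fin (l e : R) (x : \bar R) : 0 < l -> (0 <= x)%E ->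
  (l%:E * x <= e%:E)%E -> exists2 y : R, x = y%:E & l * y <= e.
Proof.
move=> l0; case: x => [y||] // _; first by rewrite -EFinM lee_fin; exists y.
by rewrite mulry gtr0_sg// mul1e leye_eq.
Qed.

Lemma pen_shift (e : R) : 0 < e -> \forall n \near \oo, forall a t,
  Nosn Mo L n a -> Tn Mo L n t -> Pen Mo (sh n a t).2 = (pen (sh n a t))%:E /\
  n%:R * lambda Mo n * `|pen (sh n a t) - pen a| <= e.
Proof.
move=> e0; have [_ _ _ [_ cp]] := HLOC.
apply: filterS2 (ecvg0_near cp e0) near_gt0 => n hn n0 a t Na Tt.
have l0 : 0 < n%:R * lambda Mo n by rewrite mulr_gt0// ltr0n.
have pa := Nosn_Pen Na.
have : ((n%:R * lambda Mo n)%:E * `|Pen Mo (sh n a t).2 - Pen Mo a.2| <= e%:E)%E.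
  apply: le_trans hn; apply: le_trans (lee_abs _).
  rewrite lee_pmul2l//; apply: ereal_sup_ubound; by exists (a, t).
move=> /(mul_le_fin l0 (abse_ge0 _))[y]; rewrite pa.
case E : (Pen Mo (sh n a t).2) => [z||] //= [yE] h.
by rewrite /pen E /=; split => //; rewrite yE.
Qed.

(** The second alternative of the penalty condition, n lambda_n -> 0,
    contradicts the lower bound on n lambda_n. *)
Lemma pen_Aos (e : R) : 0 < e -> \forall n \near \oo, forall a b,
  Aos L a -> Aos L b -> n%:R * lambda Mo n * `|pen a - pen b| <= e.
Proof.
move=> e0; have [_ _ _ [[cp|cl] _]] := HLOC; last first.
  have [c [c0 Hc]] := n_lambda_lower.
  have c2 : 0 < c / 2 by rewrite divr_gt0.
  apply: filterS2 (rcvg0_near cl c2) Hc => n h1 h2.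
  have := le_trans h2 (le_trans (ler_norm _) h1); lra.
apply: filterS2 (ecvg0_near cp e0) near_gt0 => n hn n0 a b Aa Ab.
have l0 : 0 < n%:R * lambda Mo n by rewrite mulr_gt0// ltr0n.
have : ((n%:R * lambda Mo n)%:E * `|Pen Mo a.2 - Pen Mo b.2| <= e%:E)%E.
  apply: le_trans hn; apply: le_trans (lee_abs _).
  rewrite lee_pmul2l//; apply: ereal_sup_ubound; by exists (a, b).
by rewrite (Aos_Pen Aa) (Aos_Pen Ab) -EFinB abse_EFin -EFinM lee_fin.
Qed.

(** ** Perturbations of the sieve approximation stay in the neighbourhood *)

Let norm_s_shift n t : norm_s (sh n (Pi n) t - a0) <=
  `|Pi_h0 Mo n - a0.2| + `|t| * norm_s (u n).
Proof.
rewrite -norm_sZ /norm_s /Defs.shift /= addrAC subrr add0r addrCA lerD2l.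
by rewrite -addrA addrCA addrC; apply: le_trans (ler_normD _ _) _; rewrite addrC.
Qed.

(** The direction may have a large strong norm. The bound [nu] on it in terms
    of the weak norm comes from [tau], applied to a perturbation so small that
    it remains in the neighbourhood. *)
Lemma Pi_shift_Nosn (S : R) : \forall n \near \oo, forall s, `|s| <= S ->
  Nosn Mo L n (sh n (Pi n) (s / Num.sqrt n%:R)).
Proof.
have [c [c0 Hc]] := n_lambda_lower; have [c' [c'0 Hc']] := delta_lower.
have [Ku [Ku0 HKu]] := wnorm_ustar_bounds.
have [Kp [Kp0 HKp]] := wnorm_Pi_le.
pose p' := (p + M0 L) / 2.
have p'M : p' < M0 L by rewrite /p' ltr_pdivrMr// mulr_natr mulr2n ltrD2r.
have [r r0 Hr] := Aos_radius p'M.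
have r2 : 0 < r / 2 by rewrite divr_gt0.
have e0 : 0 < c * ((M0 L - p) / 2) by rewrite mulr_gt0// divr_gt0// subr_gt0.
have [_ _ _ _ cds] : rates_ok Mo L by case: Hlocal.
have [[shin _ _ _ _] _] := HLQA.
pose su := Num.sqrt Ku.
pose S' := `|S|.
have S'0 : 0 <= S' by exact: normr_ge0.
have k0 : 0 <= S' * su / c' by rewrite divr_ge0 ?(ltW c'0)// mulr_ge0// sqrtr_ge0.
have r4 : 0 < r / 4 by rewrite divr_gt0.
have ds0 : 0 < r / 4 / (S' * su / c' + 1) by rewrite divr_gt0// ltr_wpDl.
have HPi := Pi_Nosn.
have Ht := tau_bound.
have HM := Mseq_infty 1.
have HN := Nosn_of_wnorm
  (Kp + S' * su / c').
apply: filterS3 (filterI (filterI near_gt0 HPi) (filterI Hc Hc'))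
  (filterI (filterI HKu HKp) (filterI Ht HpPi))
  (filterI (filterI (near_Pi_h0 r4) (filterI (pen_shift e0) shin))
    (filterI (filterI HM HN) (filterI (Tn_scaled S) (rcvg0_near cds ds0)))) =>
  n [[n0 NPi] [cn cn']] [[/andP[_ wu] wPi] [[t [t0 tE tau_le]] pPi]]
  [[hPi [pens sieve_sh]] [[M1 NW] [TS dsn]]].
rewrite -[Pi_h0 Mo n]/((Pi n).2) in pPi.
have rn0 : 0 < Num.sqrt (n%:R : R) by rewrite sqrtr_gt0 ltr0n.
have wuS : wnorm (u n) <= su.
  rewrite /su -[leLHS](ger0_norm (wnorm_ge0 Mo _)) -sqrtr_sqr; exact: ler_wsqrtr.
have inA t' : Tn Mo L n t' -> `|t'| * norm_s (u n) < r / 2 ->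
    Aos_sieve Mo L (kdim Mo n) (sh n (Pi n) t').
  move=> Tt tu; have Ssh := sieve_sh _ _ NPi Tt; split => //; apply: Hr.
  - by case: Ssh.
  - apply: le_lt_trans (norm_s_shift n t') _.
    rewrite [r]splitr; apply: ler_ltD => //; apply: le_trans hPi _.
    by rewrite ler_pM2l// lef_pV2 ?posrE// ler_nat.
  - have [-> hp] := pens _ _ NPi Tt.
    have pPi' := Pen_fin pPi; move: pPi; rewrite pPi' !lee_fin => pPi.
    have : c * `|pen (sh n (Pi n) t') - pen (Pi n)| <= c * ((M0 L - p) / 2).
      by apply: le_trans hp; apply: ler_wpM2r.
    rewrite ler_pM2l// ler_norml => /andP[_].
    by move: (pen _) (pen _) pPi => x y h1 h2; exact: (mid_le h1 h2).
have nu : norm_s (u n) <= t * wnorm (u n).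
  pose q := r / 2 / (norm_s (u n) + 1).
  have nu1 : 0 < norm_s (u n) + 1 by rewrite ltr_wpDl// norm_s_ge0.
  have q0 : 0 < q by rewrite divr_gt0.
  pose t1 := Num.min (delta L n) q.
  have t10 : 0 < t1 by rewrite lt_min delta_pos q0.
  have Tt1 : Tn Mo L n t1.
    suff : `|t1| <= 4 * Mseq Mo L n ^+ 2 * delta L n by [].
    rewrite ger0_norm ?(ltW t10)//; apply: (@le_trans _ _ (delta L n)).
      by rewrite ge_min lexx.
    rewrite ler_peMl// ?(ltW (delta_pos n))//.
    by apply: le4; rewrite exprn_ege1.
  have t1u : `|t1| * norm_s (u n) < r / 2.
    rewrite ger0_norm ?(ltW t10)//; apply: (@le_lt_trans _ _ (q * norm_s (u n))).
      by apply: ler_wpM2r; [exact: norm_s_ge0|rewrite ge_min lexx orbT].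
    by rewrite /q mulrAC ltr_pdivrMr// ltr_pM2l// ltrDl.
  have := tau_le _ (inA _ Tt1 t1u).
  have -> : sh n (Pi n) t1 - Pi n = t1 *: u n by rewrite /Defs.shift addrAC subrr add0r.
  rewrite norm_sZ (wnormZ Hdata Hmom Hwt Hnb Hpd _ (dir_u n)) mulrCA.
  by rewrite ler_pM2l// gtr0_norm.
move=> s sS.
have tD : t * delta L n <= delta_s Mo L n by rewrite /delta_s tE lerDr.
have As : Aos_sieve Mo L (kdim Mo n) (sh n (Pi n) (s / Num.sqrt n%:R)).
  apply: inA; first exact: TS.
  rewrite normrM [`|_^-1|]gtr0_norm ?invr_gt0//.
  have S0 : 0 <= S' by exact: normr_ge0.
  have sS' : `|s| <= S' by apply: le_trans sS _; exact: ler_norm.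
  have su0 : 0 <= su by exact: sqrtr_ge0.
  have ds1 := le_trans (ler_norm _) dsn.
  apply: (@le_lt_trans _ _ (S' / c' * delta L n * (t * su))).
    apply: ler_pM.
    - by rewrite divr_ge0// ltW.
    - exact: norm_s_ge0.
    - rewrite -mulrA; apply: ler_pM; [exact: normr_ge0|by rewrite invr_ge0 ltW|by []|].
      by rewrite mulrC ler_pdivlMr// mulrC.
    - by apply: le_trans nu _; rewrite ler_pM2l.
  have -> : S' / c' * delta L n * (t * su) = S' * su / c' * (t * delta L n) by ring.
  apply: (@le_lt_trans _ _ ((S' * su / c' + 1) * (t * delta L n))).
    by apply: ler_wpM2r; [rewrite mulr_ge0 ?ltW|rewrite lerDl].
  apply: (@le_lt_trans _ _ (r / 4)).
    by rewrite mulrC -ler_pdivlMr ?ltr_wpDl//; exact: le_trans tD ds1.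
  by rewrite ltr_pM2l// ltf_pV2 ?posrE// ltr_nat.
apply: NW => //.
have -> : sh n (Pi n) (s / Num.sqrt n%:R) - a0 = (Pi n - a0) + (s / Num.sqrt n%:R) *: u n.
  by rewrite /Defs.shift addrAC.
have dPi := dir_sieve L (Pi_sieve Hmom HID n).
apply: le_trans (wnormD Hdata Hmom Hwt Hnb Hpd dPi (dirZ _ (dir_u n))) _.
rewrite mulrDl; apply: lerD => //.
rewrite (wnormZ Hdata Hmom Hwt Hnb Hpd _ (dir_u n)) normrM [`|_^-1|]gtr0_norm ?invr_gt0//.
have -> : S' * su / c' * delta L n = (S' * (delta L n / c')) * su by ring.
apply: ler_pM.
- by rewrite mulr_ge0// invr_ge0 ltW.
- exact: wnorm_ge0.
- apply: ler_pM; [exact: normr_ge0|by rewrite invr_ge0 ltW| |].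
    by apply: le_trans sS _; exact: ler_norm.
  by rewrite ler_pdivlMr// mulrC.
- exact: wuS.
Qed.

(** ** Expansion of the criterion at scale n^(-1/2) *)

Definition lin_score n (a : par) : R := Num.sqrt n%:R * ip (u n) (a - a0).

Let rescale (e v t Z I B r tol s S : R) : 0 < r -> s = t * r -> `|s| <= S ->
  0 < e -> r ^+ 2 * tol <= 1 ->
  `|2^-1 * v - t * (Z + I) - B / 2 * t ^+ 2| <= e * (t ^+ 2 + `|t| / r + tol) ->
  `|r ^+ 2 / 2 * v - s * (r * Z + r * I) - B / 2 * s ^+ 2| <= e * (S ^+ 2 + S + 1).
Proof.
move=> r0 -> sS e0 tol1 h.
have -> : r ^+ 2 / 2 * v - t * r * (r * Z + r * I) - B / 2 * (t * r) ^+ 2 =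
  r ^+ 2 * (2^-1 * v - t * (Z + I) - B / 2 * t ^+ 2) by field.
rewrite normrM (ger0_norm (sqr_ge0 r)).
apply: (@le_trans _ _ (r ^+ 2 * (e * (t ^+ 2 + `|t| / r + tol)))).
  by rewrite ler_pM2l// exprn_gt0.
rewrite mulrCA ler_pM2l// !mulrDr; apply: lerD => //; apply: lerD.
  rewrite -exprMn mulrC -real_normK ?num_real// ler_sqr ?nnegrE//.
  exact: le_trans sS.
have -> : r ^+ 2 * (`|t| / r) = `|t * r|.
  by rewrite normrM (gtr0_norm r0); field; rewrite gt_eqF.
exact: sS.
Qed.

(** At steps s / sqrt n all three terms of the rate are of order 1 / n. *)
Lemma lqa_scaled (S e : R) : 0 < e -> \forall n \near \oo,
  forall (z : 'I_n -> ZT) b B a s, lqa_within e z b B -> Nosn Mo L n a ->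
  `|s| <= S ->
  `|n%:R / 2 * (Qhatb Mo z b (sh n a (s / Num.sqrt n%:R)) - Qhatb Mo z b a)
    - s * (std_score z b + lin_score n a) - B / 2 * s ^+ 2|
  <= e * (S ^+ 2 + S + 1).
Proof.
move=> e0.
have HT := Tn_scaled S.
have Ht := near_ntol (@ltr01 R).
apply: filterS3 HT Ht near_gt0 => n HT Ht n0 z b B a s he Na sS.
have r0 : 0 < Num.sqrt (n%:R : R) by rewrite sqrtr_gt0 ltr0n.
have r2 : Num.sqrt (n%:R : R) ^+ 2 = n%:R by rewrite sqr_sqrtr ?ler0n.
have := lqa_withinP he Na (HT s sS); rewrite -[in X in _ -> `|X / 2 * _ - _ - _| <= _]r2.
rewrite -r2 in Ht.
apply: rescale => //; first by rewrite divfK// gt_eqF.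
Qed.

Lemma sh_sh n a s t : sh n (sh n a s) t = sh n a (s + t).
Proof. by rewrite /Defs.shift -addrA -scalerDl. Qed.

Lemma lin_score_shift n a s : dir (a - a0) -> (0 < n)%N ->
  lin_score n (sh n a (s / Num.sqrt n%:R)) = lin_score n a + s * an n.
Proof.
move=> da n0; rewrite /lin_score (wnorm_sqr Hwt).
have -> : sh n a (s / Num.sqrt n%:R) - a0 = (s / Num.sqrt n%:R) *: u n + (a - a0).
  by rewrite /Defs.shift addrAC addrC.
rewrite (ipC Hwt) (ip_lin Hdata Hmom Hwt Hnb Hpd _ (dir_u n) da (dir_u n)).
rewrite (ipC Hwt (a - a0)).
have r0 : Num.sqrt (n%:R : R) != 0 by rewrite gt_eqF// sqrtr_gt0 ltr0n.
move: (ip _ _) (ip _ _) (Num.sqrt _) r0 => x y r r0.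
by field.
Qed.

(** Comparing a step of length 2 / sqrt n with two steps of half its length
    identifies the curvature of the criterion: the linear term moves by the
    squared norm of the direction. *)
Lemma Bn_consistent (e : R) : 0 < e -> W (fun n z _ => `|Bn L z - an n| <= e).
Proof.
(* the curvature is a combination of three steps of length at most 2, each
   with a remainder of 7 times the tolerance *)
move=> e0; have e1 : 0 < e / 22 by rewrite divr_gt0.
have [[_ _ _ _ hL] _] := HLQA.
have := proj1 (@oPP _ _ _ P _ ZN WN (fun n z => lqa_remainder Mo L z unit (Bn L z))) hL _ e1.
apply: wpa1_mono.
have HPi1 := Pi_Nosn.
have HPi2 := Pi_shift_Nosn 1.
have Hs := lqa_scaled 2 e1.
apply: filterS3 (filterI near_gt0 Hs) HPi1 HPi2 => n [n0 scaled] N1 HN2 z _ he.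
have N2 : Nosn Mo L n (sh n (Pi n) (1 / Num.sqrt n%:R)).
  by apply: HN2; rewrite normr1.
have l1 : `|1 : R| <= 2 by rewrite normr1 ler1n.
have l2 : `|2 : R| <= 2 by rewrite ger0_norm.
have h1 := scaled z unit (Bn L z) _ 1 he N1 l1.
have h2 := scaled z unit (Bn L z) _ 2 he N1 l2.
have h3 := scaled z unit (Bn L z) _ 1 he N2 l1.
have dPi := dir_sieve L (Pi_sieve Hmom HID n).
rewrite (lin_score_shift _ dPi n0) sh_sh -mulrDl in h3.
rewrite (_ : 1 + 1 = 2 :> R) in h3; last by [].
move: h1 h2 h3.
move: (Qhatb _ _ _ _) (Qhatb _ _ _ _) (Qhatb _ _ _ _) => q1 q2 q3.
move: (std_score _ _) (lin_score _ _) (an n) (Bn L z) (n%:R / 2) => Z I a B N.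
rewrite !ler_norml => /andP[? ?] /andP[? ?] /andP[? ?].
by apply/andP; split; lra.
Qed.

Lemma approx_min_le n (z : 'I_n -> ZT) b (S : set par) a a' :
  approx_min Mo z b S a -> S a' -> Pen Mo a.2 = (pen a)%:E ->
  Pen Mo a'.2 = (pen a')%:E ->
  Qhatb Mo z b a + lambda Mo n * pen a <=
  Qhatb Mo z b a' + lambda Mo n * pen a' + tol Mo n.
Proof.
move=> ha Sa' pa pa'; rewrite -lee_fin.
have : (pen_crit Mo z b a <= pen_crit Mo z b a' + (tol Mo n)%:E)%E.
  by apply: le_trans ha _; rewrite leeD2r//; apply: ereal_inf_lbound; exists a'.
by rewrite /pen_crit pa pa' -!EFinM -!EFinD.
Qed.

(** ** First-order condition *)

Let foc_real (y B h k : R) : 0 < h -> 0 <= B <= k ->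
  - (2 * h ^+ 2) <= h * y + B / 2 * h ^+ 2 ->
  - (2 * h ^+ 2) <= - h * y + B / 2 * (- h) ^+ 2 -> `|y| <= (2 + k) * h.
Proof.
move=> h0 /andP[B0 Bk]; rewrite sqrrN mulNr => h1 h2.
rewrite -(ler_pM2l h0) -[X in X * `|_|](gtr0_norm h0) -normrM.
have -> : h * ((2 + k) * h) = 2 * h ^+ 2 + k * h ^+ 2 by ring.
have k2 : B / 2 * h ^+ 2 <= k * h ^+ 2 by apply: ler_wpM2r; [exact: sqr_ge0|lra].
rewrite ler_norml; move: h1 h2 k2; move: (h * y) (h ^+ 2) (B / 2 * _) (k * _) => *.
by apply/andP; split; lra.
Qed.

Let half_step (N q1 q2 p1 p2 l t Y C k : R) : 0 <= N -> 0 <= l ->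
  q2 + l * p2 <= q1 + l * p1 + t -> N * l * `|p1 - p2| <= k -> N * t <= k ->
  `|N / 2 * (q1 - q2) - Y - C| <= k / 3 * (1 ^+ 2 + 1 + 1) ->
  - (2 * k) <= Y + C.
Proof.
move=> N0 l0 am pe nt; rewrite expr1n ler_norml => /andP[_ h].
have Nl : N * l * (p1 - p2) <= k.
  by apply: le_trans pe; apply: ler_wpM2l; [exact: mulr_ge0|exact: ler_norm].
have : N * (q2 + l * p2) <= N * (q1 + l * p1 + t) by exact: ler_wpM2l.
have E1 : N * (q2 + l * p2) = N * q2 + N * l * p2 by ring.
have E2 : N * (q1 + l * p1 + t) = N * q1 + N * l * p1 + N * t by ring.
have E3 : N * l * (p1 - p2) = N * l * p1 - N * l * p2 by ring.
have E4 : N / 2 * (q1 - q2) = (N * q1 - N * q2) / 2 by field.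
rewrite {}E1 {}E2; rewrite {}E3 in Nl; rewrite {}E4 in h; move: Nl h nt.
move: (N * l * p1) (N * l * p2) (N * q1) (N * q2) (N * t) => *; lra.
Qed.

(** An approximate minimizer in the neighbourhood nearly solves the linearized
    score equation along the direction of the representer. *)
Lemma approx_min_foc (k h : R) : 0 < h <= 1 -> exists2 e : R, 0 < e &
  \forall n \near \oo, forall (z : 'I_n -> ZT) b B a,
    lqa_within e z b B -> 0 <= B <= k -> Nosn Mo L n a ->
    approx_min Mo z b (sieve Mo (kdim Mo n)) a ->
    `|std_score z b + lin_score n a| <= (2 + k) * h.
Proof.
(* the remainder of a step of length at most 1 is 3 times the tolerance, and
   the terms at the step h are of order h ^ 2 *)
move=> /andP[h0 h1]; exists (h ^+ 2 / 3); first by rewrite divr_gt0// exprn_gt0.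
have h20 : 0 < h ^+ 2 by rewrite exprn_gt0.
have [[shin _ _ _ _] _] := HLQA.
have e0 : 0 < h ^+ 2 / 3 by rewrite divr_gt0.
have Hs := lqa_scaled 1 e0.
have HT := Tn_scaled 1.
have Hp := pen_shift h20.
have Ht := near_ntol h20.
apply: filterS3 (filterI Hs HT) (filterI Hp shin) Ht =>
  n [scaled Tsc] [pens sieve_sh] nt z b B a he Bk Na mina.
have half s : `|s| <= 1 -> - (2 * h ^+ 2) <=
    s * (std_score z b + lin_score n a) + B / 2 * s ^+ 2.
  move=> s1; have Ts := Tsc s s1; have [pe1 pe2] := pens _ _ Na Ts.
  have am := approx_min_le mina (sieve_sh _ _ Na Ts) (Nosn_Pen Na) pe1.
  apply: half_step (ler0n R n) (ltW (lambda_pos n)) am pe2 nt _.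
  exact: scaled.
apply: (foc_real h0 Bk); [apply: (half h)|apply: (half (- h))].
- by rewrite gtr0_norm.
- by rewrite normrN gtr0_norm.
Qed.

Local Notation lin := lin_score.

(** ** Linearization of the functional *)

Let Hphi : functional_ok Mo. Proof. by case: Hmodel => _ []. Qed.

Let unscale_real (s wu w : R) : 0 < s -> wu = `|s^-1| * w -> w = wu * s.
Proof. by move=> s0 ->; rewrite gtr0_norm ?invr_gt0// mulrAC mulVf ?mul1r// gt_eqF. Qed.

Let phi_real (r s0 w wu f D DA dpu dpj ipv ipu s a h K : R) : 0 < r -> 0 < s0 ->
  0 < w -> w = wu * s0 -> wu <= K -> 0 < h ->
  r * `|f - D| / w <= h -> r * `|dpj| / w <= h -> D = s / r * dpu + DA ->
  DA = ipv + dpj -> ipv = s0 * ipu -> dpu = s0 * a ->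
  `|r * f / s0 - (r * ipu + s * a)| <= 2 * K * h.
Proof.
move=> r0 s00 w0 wE wK h0 h1 h2 DE DAE ipE duE.
have E : r * f / s0 - (r * ipu + s * a) = (r * (f - D) + r * dpj) / s0.
  by rewrite DE DAE ipE duE; field; rewrite !gt_eqF.
rewrite E normrM [`|s0^-1|]gtr0_norm ?invr_gt0// ler_pdivrMr//.
apply: le_trans (ler_normD _ _) _; rewrite !normrM (gtr0_norm r0).
rewrite !ler_pdivrMr// in h1 h2.
have hw : h * w <= h * (K * s0) by rewrite ler_pM2l// wE ler_pM2r.
have -> : 2 * K * h * s0 = h * (K * s0) + h * (K * s0) by ring.
by apply: lerD; [exact: le_trans h1 hw|exact: le_trans h2 hw].
Qed.

(** The functional is linear in the direction of the representer, with slope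
    given by the Riesz representation. *)
Lemma phi_linear (S h : R) : 0 < h -> \forall n \near \oo, forall a s,
  Nosn Mo L n a -> Aos L a -> `|s| <= S ->
  `|Num.sqrt n%:R * (phi Mo (sh n a (s / Num.sqrt n%:R)) - phi Mo a0) / sd n
    - (lin n a + s * an n)| <= h.
Proof.
move=> h0; have [K [K0 HK]] := wnorm_ustar_bounds.
pose h' := h / (2 * Num.sqrt K).
have sK0 : 0 < Num.sqrt K by rewrite sqrtr_gt0.
have h'0 : 0 < h' by rewrite divr_gt0// mulr_gt0.
have hE : 2 * Num.sqrt K * h' = h.
  by rewrite /h'; field; rewrite gt_eqF.
have [_ P2 P3] := HPHI.
have H2 := ecvg0_near P2 h'0; have H3 := rcvg0_near P3 h'0.
have Hsd := sdnorm_neq0.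
have HT := Tn_scaled S.
apply: filterS3 (filterI near_gt0 Hsd) (filterI HK HT) (filterI H2 H3) =>
  n [n0 s0] [/andP[aK1 aK2] Tsc] [sup2 sup3] a s Na Aa sS.
have r0 : 0 < Num.sqrt (n%:R : R) by rewrite sqrtr_gt0 ltr0n.
have {}s0 : 0 < sd n by rewrite lt_def s0 sqrtr_ge0.
have [_ _ dlin _] := Hphi.
have [_ _ /(_ n)[Vv Rv]] := Hriesz.
have dv := dir_Vsieve Hriesz Vv.
have ua0 : 0 < wnorm (u n).
  rewrite lt_def wnorm_ge0 andbT; apply: contraTneq aK1 => ->.
  by rewrite expr0n /= -ltNge invr_gt0.
have wE : wnorm (vstar L n) = wnorm (u n) * sd n.
  exact: (unscale_real s0 (wnormZ Hdata Hmom Hwt Hnb Hpd (sd n)^-1 dv)).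
have w0 : 0 < wnorm (vstar L n) by rewrite wE; exact: (mulr_gt0 ua0 s0).
have wuK : wnorm (u n) <= Num.sqrt K.
  rewrite -[leLHS](ger0_norm (wnorm_ge0 Mo _)) -sqrtr_sqr; exact: (ler_wsqrtr aK2).
have da : dir (a - a0) by exact: (dir_Aos Mo Aa).
have vE : vstar L n = sd n *: u n by rewrite /ustar scalerA (mulfV (lt0r_neq0 s0)) scale1r.
have ipE : ip (vstar L n) (a - a0) = sd n * ip (u n) (a - a0).
  by rewrite {1}vE (ipZ Hdata Hmom Hwt Hnb Hpd _ (dir_u n) da).
have duE : dphi Mo (u n) = sd n * an n.
  rewrite (Rv _ (ustar_Vsieve n)) (wnorm_sqr Hwt) {1}vE.
  exact: (ipZ Hdata Hmom Hwt Hnb Hpd _ (dir_u n) (dir_u n)).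
have DAE := dphi_Riesz Hdata Hmom Hwt Hnb Hpd Hriesz Hphi (conj Aa (proj2 Na)).
have DE := dlin (s / Num.sqrt n%:R) (u n) (a - a0).
have shE : sh n a (s / Num.sqrt n%:R) - a0 = (s / Num.sqrt n%:R) *: u n + (a - a0).
  by rewrite /Defs.shift addrAC addrC.
rewrite -shE in DE.
have h1 : Num.sqrt n%:R * `|phi Mo (sh n a (s / Num.sqrt n%:R)) - phi Mo a0
   - dphi Mo (sh n a (s / Num.sqrt n%:R) - a0)| / wnorm (vstar L n) <= h'.
  rewrite -lee_fin; apply: le_trans sup2; apply: le_trans (lee_abs _).
  by apply: ereal_sup_ubound; exists (a, s / Num.sqrt n%:R) => //; split => //; exact: Tsc.
have h2 := le_trans (ler_norm _) sup3.
rewrite -hE; exact: (phi_real r0 s0 w0 wE wuK h'0 h1 h2 DE DAE ipE duE).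
Qed.

Let shift_continuous n a (r : R) : continuous (fun s : R => phi Mo (sh n a (s / r))).
Proof.
have [cphi _ _ _] := Hphi; move=> s.
apply: (@continuous_comp _ _ _ (fun s : R => sh n a (s / r)) (phi Mo) s).
  exact: affine_path_continuous.
exact: cphi.
Qed.

(** The intermediate value theorem, along the direction of the representer,
    reaches any nearby value of the functional. *)
Lemma feasible_shift (M h K : R) : 0 < h <= 1 -> 0 < K ->
  (\forall n \near \oo, K^-1 <= an n <= K) ->
  \forall n \near \oo, forall a c x,
  Nosn Mo L n a -> Aos L a ->
  `|Num.sqrt n%:R * (c - phi Mo a0) / sd n - x| <= h -> `|x - lin n a| <= M ->
  exists s : R, [/\ `|s| <= (M + 2) * K, phi Mo (sh n a (s / Num.sqrt n%:R)) = c &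
    `|s * an n - (x - lin n a)| <= 2 * h].
Proof.
move=> /andP[h0 h1] K0 HK; have HP := phi_linear ((M + 2) * K) h0.
have Hsd := sdnorm_neq0.
apply: filterS3 (filterI near_gt0 Hsd) HK HP =>
  n [n0 s0] /andP[aK1 aK2] phil a c x Na Aa cx xM.
have r0 : 0 < Num.sqrt (n%:R : R) by rewrite sqrtr_gt0 ltr0n.
have {}s0 : 0 < sd n by rewrite lt_def s0 sqrtr_ge0.
pose G s := Num.sqrt n%:R * (phi Mo (sh n a (s / Num.sqrt n%:R)) - phi Mo a0) / sd n.
have cG : continuous G.
  exact: (@scaled_continuous R _ _ _ _ (@shift_continuous n a (Num.sqrt n%:R))).

have [s [sS Gs sa]] := almost_affine_reaches cG K0 aK1 h0 h1
  (fun s => phil a s Na Aa) cx xM.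
exists s; split; [exact: sS| |exact: sa].
have := mulIf (invr_neq0 (lt0r_neq0 s0)) Gs.
by move/(mulfI (lt0r_neq0 r0))/addIr.
Qed.

(** ** Expansion of the quasi likelihood ratio *)

(** The step towards the unconstrained minimum, of length - Y / a, would lower the
    quadratic at the restricted point by Y^2 / a; the minimizer does no worse. *)
Let lower_real (N Q1 Q2 Q2s p1 p2 p2s l t Z L2 x B a k S Y s : R) :
  0 < a -> 0 <= N -> 0 <= l -> 0 <= k -> Y = Z + x -> s = - Y / a -> `|s| <= S ->
  Q1 + l * p1 <= Q2s + l * p2s + t -> N * l * `|p2s - p2| <= k ->
  N * l * `|p2 - p1| <= k -> N * t <= k ->
  `|N / 2 * (Q2s - Q2) - s * (Z + L2) - B / 2 * s ^+ 2| <= k ->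
  `|L2 - x| <= 2 * k -> `|B - a| <= k ->
  Y ^+ 2 / a - (5 + 4 * S + S ^+ 2) * k <= N * (Q2 - Q1).
Proof.
move=> a0 N0 l0 k0 YE sE sS am h1 h2 h3; rewrite !ler_norml => /andP[_ h4] h5 h6.
have Nl : 0 <= N * l by exact: mulr_ge0.
have g1 := le_trans (ler_wpM2l Nl (ler_norm _)) h1.
have g2 := le_trans (ler_wpM2l Nl (ler_norm _)) h2.
have g3 := ler_wpM2l N0 am.
have S0 : 0 <= S by exact: le_trans sS.
have s2 : s ^+ 2 <= S ^+ 2 by rewrite -[s ^+ 2]real_normK ?num_real// ler_sqr ?nnegrE.
have g5 : s * (L2 - x) <= S * (2 * k).
  apply: le_trans (ler_norm _) _; rewrite normrM; apply: ler_pM => //.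
  by rewrite ler_norml.
have g6 : (B - a) * s ^+ 2 <= k * S ^+ 2.
  apply: le_trans (ler_wpM2r (sqr_ge0 s) _) (ler_wpM2l k0 s2).
  by case/andP: h6.
have sY : s * Y = - (Y ^+ 2 / a) by rewrite sE; field; rewrite gt_eqF.
have sa : a * s ^+ 2 = Y ^+ 2 / a by rewrite sE; field; rewrite gt_eqF.
have E1 : s * (Z + L2) = s * Y + s * (L2 - x) by rewrite YE; ring.
have E2 : B / 2 * s ^+ 2 = ((B - a) * s ^+ 2 + a * s ^+ 2) / 2 by field.
have E3 : N * (Q1 + l * p1) = N * Q1 + N * l * p1 by ring.
have E4 : N * (Q2s + l * p2s + t) = N * Q2s + N * l * p2s + N * t by ring.
have E5 : N * l * (p2s - p2) = N * l * p2s - N * l * p2 by ring.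
have E6 : N * l * (p2 - p1) = N * l * p2 - N * l * p1 by ring.
have E7 : N / 2 * (Q2s - Q2) = (N * Q2s - N * Q2) / 2 by field.
have E8 : N * (Q2 - Q1) = N * Q2 - N * Q1 by ring.
have E9 : (5 + 4 * S + S ^+ 2) * k = 5 * k + 2 * (S * (2 * k)) + k * S ^+ 2 by ring.
rewrite E1 sY E2 sa E7 in h4; rewrite E3 E4 in g3; rewrite E5 in g1; rewrite E6 in g2.
rewrite E8 E9.
move: h3 h4 g1 g2 g3 g5 g6; move: (Y ^+ 2 / a) (N * Q2) (N * Q1) (N * Q2s) (N * t).
move: (N * l * p1) (N * l * p2) (N * l * p2s) (s * (L2 - x)) (S * (2 * k)).
by move: ((B - a) * s ^+ 2) (k * S ^+ 2) => *; lra.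
Qed.

(** A step that restores the constraint costs Y^2 / a, since its product with a is
    Y up to the errors of the constraint and of the first-order condition. *)
Let upper_real (N Q1 Q1s y B a k kp K M S Y s x l1 Z : R) :
  0 < a -> K^-1 <= a -> 0 < K -> 0 <= N -> 0 <= k <= 1 -> 0 <= kp ->
  Y = Z + x -> y = Z + l1 -> `|y| <= kp * k -> `|s * a - (x - l1)| <= 2 * k ->
  `|Y| <= M -> `|s| <= S -> `|B - a| <= k ->
  `|N / 2 * (Q1s - Q1) - s * y - B / 2 * s ^+ 2| <= k ->
  N * (Q1s - Q1) <= Y ^+ 2 / a +
    (2 + 2 * S * kp + S ^+ 2 + K * (2 * M * (kp + 2) + (kp + 2) ^+ 2)) * k.
Proof.
move=> a0 aK K0 N0 /andP[k0 k1] kp0 YE yE yk sk YM sS; rewrite !ler_norml => /andP[_ h6] /andP[_ h4].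
have S0 : 0 <= S by exact: le_trans sS.
have M0 : 0 <= M by exact: le_trans YM.
have s2 : s ^+ 2 <= S ^+ 2 by rewrite -[s ^+ 2]real_normK ?num_real// ler_sqr ?nnegrE.
have g5 : s * y <= S * (kp * k).
  by apply: le_trans (ler_norm _) _; rewrite normrM; apply: ler_pM.
have g6 : (B - a) * s ^+ 2 <= k * S ^+ 2.
  exact: le_trans (ler_wpM2r (sqr_ge0 s) h6) (ler_wpM2l k0 s2).
pose q := kp + 2; have q0 : 0 <= q by rewrite /q; lra.
pose v := s * a - Y.
have vq : `|v| <= q * k.
  have -> : v = (s * a - (x - l1)) - y by rewrite /v YE yE; ring.
  apply: le_trans (ler_normB _ _) _; have -> : q * k = 2 * k + kp * k by rewrite /q; ring.
  exact: lerD.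
have sa2 : (s * a) ^+ 2 <= Y ^+ 2 + (2 * M * q + q ^+ 2) * k.
  have -> : (s * a) ^+ 2 = Y ^+ 2 + (2 * (Y * v) + v ^+ 2) by rewrite /v; ring.
  have -> : (2 * M * q + q ^+ 2) * k = 2 * M * q * k + q ^+ 2 * k by ring.
  rewrite lerD2l; apply: lerD.
    have -> : 2 * M * q * k = 2 * (M * (q * k)) by ring.
    rewrite ler_pM2l//; apply: le_trans (ler_norm _) _.
    by rewrite normrM; apply: ler_pM.
  apply: (@le_trans _ _ ((q * k) ^+ 2)).
    by rewrite -[v ^+ 2]real_normK ?num_real// ler_sqr ?nnegrE// mulr_ge0.
  rewrite exprMn ler_wpM2l ?sqr_ge0// expr2 -[leRHS]mulr1.
  exact: ler_wpM2l.
have as2 : a * s ^+ 2 <= Y ^+ 2 / a + K * (2 * M * q + q ^+ 2) * k.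
  have -> : a * s ^+ 2 = (s * a) ^+ 2 / a by field; rewrite gt_eqF.
  apply: (@le_trans _ _ ((Y ^+ 2 + (2 * M * q + q ^+ 2) * k) / a)).
    by rewrite ler_pM2r ?invr_gt0.
  have -> : K * (2 * M * q + q ^+ 2) * k = (2 * M * q + q ^+ 2) * k * K by ring.
  rewrite mulrDl lerD2l; apply: ler_wpM2l.
    by rewrite mulr_ge0// addr_ge0 ?sqr_ge0// !mulr_ge0.
  by rewrite -[leRHS]invrK lef_pV2 ?posrE ?invr_gt0.
have E2 : B / 2 * s ^+ 2 = ((B - a) * s ^+ 2 + a * s ^+ 2) / 2 by field.
have E7 : N / 2 * (Q1s - Q1) = (N * (Q1s - Q1)) / 2 by field.
have E9 : (2 + 2 * S * kp + S ^+ 2 + K * (2 * M * (kp + 2) + (kp + 2) ^+ 2)) * k =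
  2 * k + 2 * (S * (kp * k)) + k * S ^+ 2 + K * (2 * M * q + q ^+ 2) * k.
  by rewrite /q; ring.
rewrite E2 E7 in h4; rewrite E9; move: h4 g5 g6 as2.
move: (N * _) (s * y) ((B - a) * _) (a * _) (Y ^+ 2 / a) (S * _) (k * S ^+ 2) (K * _ * k).
by move=> *; lra.
Qed.

Let low_const (S : R) : 0 <= S -> 0 <= 5 + 4 * S + S ^+ 2.
Proof. by move=> S0; have := sqr_ge0 S; lra. Qed.

Let up_const (S kp M K : R) : 0 <= S -> 0 <= kp -> 0 <= M -> 0 <= K ->
  0 <= 2 + 2 * S * kp + S ^+ 2 + K * (2 * M * (kp + 2) + (kp + 2) ^+ 2).
Proof.
move=> S0 kp0 M0 K0; apply: addr_ge0.
  by apply: addr_ge0 (sqr_ge0 _); rewrite addr_ge0// mulr_ge0// mulr_ge0.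
by rewrite mulr_ge0// addr_ge0 ?sqr_ge0// mulr_ge0 ?addr_ge0// mulr_ge0.
Qed.

Let sh0 n a : sh n a 0 = a.
Proof. by rewrite /Defs.shift scale0r addr0. Qed.

Let scaled_le n (I : \bar R) (v q : R) : (I <= v%:E)%E ->
  (n%:R%:E * (I - q%:E) <= (n%:R * (v - q))%:E)%E.
Proof.
by move=> h; rewrite EFinM EFinB; apply: lee_wpmul2l; [rewrite lee_fin|exact: leeB].
Qed.

Let bound_real (B a k K : R) : 0 < B -> a <= K -> `|B - a| <= k -> k <= 1 ->
  0 <= B <= K + 1.
Proof.
by move=> B0 aK; rewrite ler_norml => /andP[_ h] k1; rewrite ltW//=; lra.
Qed.

Let lin_real (Z x l M q k : R) : `|Z + x| <= M -> `|Z + l| <= q * k -> 0 <= q ->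
  k <= 1 -> `|x - l| <= M + q.
Proof.
move=> h1 h2 q0 k1; have -> : x - l = (Z + x) - (Z + l) by ring.
apply: le_trans (ler_normB _ _) _; apply: lerD => //; apply: le_trans h2 _.
by rewrite -[leRHS]mulr1; exact: ler_wpM2l.
Qed.

Let near_real (w l x k : R) : `|w - l| <= k -> `|w - x| <= k -> `|l - x| <= 2 * k.
Proof. by rewrite !ler_norml => /andP[? ?] /andP[? ?]; apply/andP; split; lra. Qed.

Let step_real (Y a K M q : R) : 0 < a -> K^-1 <= a -> 0 < K -> `|Y| <= M -> 0 <= q ->
  `|- Y / a| <= (M + q + 2) * K.
Proof.
move=> a0 aK K0 YM q0; rewrite normrM normrN [`|a^-1|]gtr0_norm ?invr_gt0//.
apply: ler_pM; [exact: normr_ge0|by rewrite invr_ge0 ltW|lra|].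
by rewrite -[leRHS]invrK lef_pV2 ?posrE ?invr_gt0.
Qed.

Let sandwich_real (q : \bar R) (D Y2 k C1 C2 e hi : R) :
  (`|q - D%:E| <= k%:E)%E -> (q <= hi%:E)%E -> hi <= Y2 + C2 * k ->
  Y2 - C1 * k <= D -> (C1 + C2 + 1) * k <= e -> 0 <= k -> 0 <= C1 -> 0 <= C2 ->
  (`|q - Y2%:E| <= e%:E)%E.
Proof.
case: q => [q||]//=; rewrite !lee_fin !ler_norml => /andP[h1 h2] h3 h4 h5 h6 k0 c1 c2.
have {}c1 := mulr_ge0 c1 k0; have {}c2 := mulr_ge0 c2 k0.
rewrite !mulrDl mul1r in h6; move: h4 h5 h6 c1 c2.
by move: (C1 * k) (C2 * k) => x y *; apply/andP; split; lra.
Qed.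

(** The likelihood ratio equals the squared constrained score.  The upper bound
    shifts the unrestricted estimator [a1] onto the constraint; the lower bound
    shifts the restricted one [a2] towards the unconstrained minimum. *)
Lemma QLR_expansion (M e : R) : 0 < e -> exists h tl : R, [/\ 0 < h, 0 < tl &
  \forall n \near \oo, forall (z : 'I_n -> ZT) b B a1 a2 c x,
  lqa_within tl z b B -> 0 < B -> `|B - an n| <= h ->
  Nosn Mo L n a1 -> Aos L a1 -> approx_min Mo z b (sieve Mo (kdim Mo n)) a1 ->
  Nosn Mo L n a2 -> Aos L a2 -> phi Mo a2 = c ->
  `|Num.sqrt n%:R * (c - phi Mo a0) / sd n - x| <= h ->
  `|std_score z b + x| <= M ->
  (`|n%:R%:E * (ereal_inf [set (Qhatb Mo z b a)%:E | a in constrained_sieve Mo n c]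
      - (Qhatb Mo z b a1)%:E) - (n%:R * (Qhatb Mo z b a2 - Qhatb Mo z b a1))%:E| <= h%:E)%E ->
  (`|n%:R%:E * (ereal_inf [set (Qhatb Mo z b a)%:E | a in constrained_sieve Mo n c]
      - (Qhatb Mo z b a1)%:E) - ((std_score z b + x) ^+ 2 / an n)%:E| <= e%:E)%E].
Proof.
move=> e0; have [K [K0 HK]] := wnorm_ustar_bounds.
pose M' := Num.max M 0; have M'0 : 0 <= M' by rewrite le_max lexx orbT.
have MM' : M <= M' by rewrite le_max lexx.
pose kp := 2 + (K + 1); have kp0 : 0 <= kp by rewrite /kp; have := ltW K0; lra.
pose S := (M' + kp + 2) * K.
have S0 : 0 <= S by apply: mulr_ge0 (ltW K0); apply: addr_ge0 (addr_ge0 M'0 kp0) _.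
(* C1 and C2 are the constants of the lower and of the upper bound *)
pose C1 := 5 + 4 * S + S ^+ 2.
pose C2 := 2 + 2 * S * kp + S ^+ 2 + K * (2 * M' * (kp + 2) + (kp + 2) ^+ 2).
have C10 : 0 <= C1 by exact: low_const.
have C20 : 0 <= C2 by exact: (up_const S0 kp0 M'0 (ltW K0)).
pose C := C1 + C2; have C0 : 0 <= C by exact: addr_ge0.
have C3 : 0 < C + 1 by exact: ltr_wpDl.
pose h := Num.min 1 (e / (C + 1)).
have h0 : 0 < h by rewrite lt_min ltr01 divr_gt0.
have h1 : h <= 1 by rewrite ge_min lexx.
have h01 : 0 < h <= 1 by rewrite h0.
have hC : (C + 1) * h <= e by rewrite mulrC -ler_pdivlMr// ge_min lexx orbT.
have [tf tf0 Hfoc] := approx_min_foc (K + 1) h01.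
pose S1 := S ^+ 2 + S + 1; have S10 : 0 < S1 by rewrite ltr_wpDl// addr_ge0 ?sqr_ge0.
pose ts := h / S1; have ts0 : 0 < ts by exact: divr_gt0.
exists h, (Num.min tf ts); split => //; first by rewrite lt_min tf0.
have Hs := lqa_scaled S ts0.
have HT := Tn_scaled S.
have Hps := pen_shift h0.
have HpA := pen_Aos h0.
have Ht := near_ntol h0.
have Hlin := phi_linear 0 h0.
have Hfs := feasible_shift
  (M' + kp) h01 K0 HK.
have [[shin _ _ _ _] _] := HLQA.
apply: filterS3 (filterI HK Hfoc) (filterI (filterI Hs HT) (filterI Hps HpA))
  (filterI (filterI Ht Hlin) (filterI Hfs shin)) => n [/andP[aK1 aK2] Hfocn]
  [[Hsn Tsc] [pens penA]] [[nt phil] [fs sieve_sh]].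
move=> z b B a1 a2 c x hl B0 Ba N1 A1 min1 N2 A2 phi2 cx YM hD.
have Ki : 0 < K^-1 by rewrite invr_gt0.
have apos : 0 < an n by exact: (lt_le_trans Ki aK1).
have {}YM : `|std_score z b + x| <= M' by exact: le_trans YM MM'.
have hlf : lqa_within tf z b B.
  by apply: le_trans hl _; rewrite lee_fin ge_min lexx.
have hls : lqa_within ts z b B.
  by apply: le_trans hl _; rewrite lee_fin ge_min lexx orbT.
have tsE : ts * (S ^+ 2 + S + 1) = h by exact: (divfK (lt0r_neq0 S10)).
have BK : 0 <= B <= K + 1 by exact: (bound_real B0 aK2 Ba h1).
have y1 := Hfocn z b B a1 hlf BK N1 min1.
have l1 : `|x - lin n a1| <= M' + kp by exact: (lin_real YM y1 kp0 h1).
have [s [sS phis sa]] := fs a1 c x N1 A1 cx l1.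
have q1 := Hsn z b B a1 s hls N1 sS; rewrite tsE in q1.
have Z0 : `|0 : R| <= 0 by rewrite normr0.
have l2 := phil a2 0 N2 A2 Z0.
rewrite mul0r (sh0 n a2) phi2 mul0r addr0 in l2.
have l2x : `|lin n a2 - x| <= 2 * h by exact: (near_real l2 cx).
pose s2 := - (std_score z b + x) / an n.
have s2S : `|s2| <= S by exact: (step_real apos aK1 K0 YM kp0).
have q2 := Hsn z b B a2 s2 hls N2 s2S; rewrite tsE in q2.
have [pe2 pd2] := pens _ _ N2 (Tsc _ s2S).
have am := approx_min_le min1 (sieve_sh _ _ N2 (Tsc _ s2S)) (Nosn_Pen N1) pe2.
have low := lower_real apos (ler0n R n) (ltW (lambda_pos n)) (ltW h0) erefl erefl s2S
  am pd2 (penA _ _ A2 A1) nt q2 l2x Ba.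
have k01 : 0 <= h <= 1 by rewrite ltW.
have up := upper_real apos aK1 K0 (ler0n R n) k01 kp0 erefl erefl y1 sa YM sS Ba q1.
have hi : (n%:R%:E * (ereal_inf [set (Qhatb Mo z b a)%:E | a in constrained_sieve Mo n c]
      - (Qhatb Mo z b a1)%:E) <= (n%:R * (Qhatb Mo z b (sh n a1 (s / Num.sqrt n%:R))
      - Qhatb Mo z b a1))%:E)%E.
  apply: scaled_le; apply: ereal_inf_lbound.
  exists (sh n a1 (s / Num.sqrt n%:R)) => //; split; last exact: phis.
  exact: (sieve_sh _ _ N1 (Tsc _ sS)).
exact: (sandwich_real hD hi up low hC (ltW h0) C10 C20).
Qed.

(** ** Localization of the estimators *)

Context (HCRIT2 : cond_CRIT_ii Mo L) (HBCRIT2 : cond_BCRIT_ii_iii Mo L).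

Let sieve_M0_le n a : sieve Mo (kdim Mo n) a -> (Pen Mo a.2 <= p%:E)%E -> sieve_M0 Mo L n a.
Proof.
move=> sa pa; split => //; rewrite EFinM; apply: lee_wpmul2l.
  by rewrite lee_fin; exact: ltW.
by apply: le_trans pa _; rewrite lee_fin; exact: ltW.
Qed.

Let min_le (c1 c2 y x : R) (Q : \bar R) : (0 <= Q)%E -> c1 <= c2 ->
  ~ (y%:E < c2%:E * Q - x%:E)%E -> (c1%:E * Q <= (y + x)%:E)%E.
Proof.
move=> Q0 cc /negP; rewrite -leNgt leeBlDr// -EFinD; apply: le_trans.
by apply: lee_wpmul2r => //; rewrite lee_fin.
Qed.

Let sqr_sum (x y C C' : R) : 0 <= x -> 0 <= y ->
  C * y ^+ 2 + C' * x ^+ 2 <= (`|C| + `|C'|) * (x + y) ^+ 2.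
Proof.
move=> x0 y0; rewrite mulrDl; apply: lerD.
  apply: le_trans (ler_wpM2r (sqr_ge0 _) (ler_norm C)) _.
  by apply: ler_wpM2l => //; rewrite ler_sqr ?nnegrE ?addr_ge0// lerDr.
apply: le_trans (ler_wpM2r (sqr_ge0 _) (ler_norm C')) _.
by apply: ler_wpM2l => //; rewrite ler_sqr ?nnegrE ?addr_ge0// lerDl.
Qed.

Let sqr_sum_same (y C C' : R) : C * y ^+ 2 + C' * y ^+ 2 <= (`|C| + `|C'|) * y ^+ 2.
Proof.
rewrite mulrDl; apply: lerD; apply: ler_wpM2r => //; try exact: sqr_ge0; exact: ler_norm.
Qed.

(** The sample criterion bounds the population one from below, globally up to
    dbar ^ 2 and locally up to delta ^ 2, which is what localization requires.
    The statement is uniform over the sieve, so that it applies to every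
    estimator. *)
Lemma Nosn_of_crit (K : R) : W (fun n z _ => forall a, sieve Mo (kdim Mo n) a ->
  (Pen Mo a.2 <= p%:E)%E -> Qhat Mo z a <= K * dbarstar L n ^+ 2 ->
  (Aos_sieve Mo L (kdim Mo n) a -> Qhat Mo z a <= K * delta L n ^+ 2) ->
  Aos L a /\ Nosn Mo L n a).
Proof.
have [c1 [c10 tight1]] := HCRIT2.
have [_ _ [[c2 [c20 tight2]] _] _] := HLOC.
have [[dbar0 cdbar] _ [dstar0 cdstar] _ _] := Hrates.
pose c := Num.min c1 c2; have c0 : 0 < c by rewrite lt_min c10.
have cc1 : c <= c1 by rewrite ge_min lexx.
have cc2 : c <= c2 by rewrite ge_min lexx orbT.
apply: (wpa1_tight_elim (E0 := fun C n z => exists a, sieve_M0 Mo L n a /\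
  ((Qhat Mo z a)%:E < c1%:E * crit_Q Mo a - (C * dbar L n ^+ 2)%:E)%E) tight1) => C1.
apply: (wpa1_tight_elim (E0 := fun C n z => exists a, Aos_sieve Mo L (kdim Mo n) a /\
  ((Qhat Mo z a)%:E < c2%:E * crit_Q Mo a - (C * delta L n ^+ 2)%:E)%E) tight2) => C2.
apply: wpa1_near.
pose C := `|K| + (`|C1| + `|C2|).
have ceps : dbar L n + dbarstar L n @[n --> \oo] --> (0 : R).
  by rewrite -[X in _ --> X]addr0; exact: cvgD.
have HR := rate_Nosn 0 C c0 ceps.
apply: filterS HR => n HR z _ h2 h1 a sa pa QK Qloc.
have d1 : 0 <= dbar L n by case: (dbar0 n) => /ltW.
have d2 : 0 <= dbarstar L n by case: (dstar0 n) => /ltW.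
have Q0 := crit_Q_ge0 Hwt a.
apply: (HR a 0 sa pa); first by rewrite mul0r.
  have nb : ~ ((Qhat Mo z a)%:E < c1%:E * crit_Q Mo a - (C1 * dbar L n ^+ 2)%:E)%E.
    by move=> hb; apply: h1; exists a; split => //; exact: sieve_M0_le.
  apply: le_trans (min_le Q0 cc1 nb) _; rewrite lee_fin add0r.
  apply: le_trans (lerD QK (lexx _)) _; apply: le_trans (sqr_sum _ _ d1 d2) _.
  apply: ler_wpM2r; first exact: sqr_ge0.
  by rewrite lerD2l lerDl.
move=> Aa; have nb : ~ ((Qhat Mo z a)%:E < c2%:E * crit_Q Mo a - (C2 * delta L n ^+ 2)%:E)%E.
  by move=> hb; apply: h2; exists a.
apply: le_trans (min_le Q0 cc2 nb) _; rewrite lee_fin add0r.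
apply: le_trans (lerD (Qloc Aa) (lexx _)) _; apply: le_trans (sqr_sum_same _ _ _) _.
apply: ler_wpM2r; first exact: sqr_ge0.
by rewrite lerD2l lerDr.
Qed.

Let delta_le_dbarstar n : delta L n ^+ 2 <= dbarstar L n ^+ 2.
Proof.
have [_ _ [dstar0 _] _ _] := Hrates; case: (dstar0 n) => d0 dd.
by rewrite ler_sqr ?nnegrE// ltW.
Qed.

Lemma Nosn_of_Qhat (K : R) : W (fun n z _ => forall a, sieve Mo (kdim Mo n) a ->
  (Pen Mo a.2 <= p%:E)%E -> Qhat Mo z a <= K * delta L n ^+ 2 ->
  Aos L a /\ Nosn Mo L n a).
Proof.
apply: wpa1_mono (Nosn_of_crit `|K|); apply: nearW => n z _ h a sa pa Qa.
have Qa' : Qhat Mo z a <= `|K| * delta L n ^+ 2.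
  by apply: le_trans Qa _; apply: ler_wpM2r (ler_norm _); exact: sqr_ge0.
apply: h => //; apply: le_trans Qa' _; apply: ler_wpM2l => //.
Qed.

(** The bootstrap criterion controls the sample criterion, hence the
    population one. *)
Lemma Nosn_of_Qhatb (K : R) :
  W (fun n z b => forall a, sieve Mo (kdim Mo n) a ->
  (Pen Mo a.2 <= p%:E)%E -> Qhatb Mo z b a <= K * delta L n ^+ 2 ->
  Aos L a /\ Nosn Mo L n a).
Proof.
have [c [c0 tight1 tight2]] := HBCRIT2.
apply: (wpa1_ctight_elim tight1) => C1; apply: (wpa1_ctight_elim tight2) => C2.
apply: wpa1_mono (Nosn_of_crit ((`|K| + (`|C1| + `|C2|)) / c)).
apply: nearW => n z b h h2 h1 a sa pa Qa.
have d2 : 0 <= delta L n ^+ 2 by exact: sqr_ge0.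
have D2 : 0 <= dbarstar L n ^+ 2 by exact: sqr_ge0.
have dd := delta_le_dbarstar n.
have tr (x y C : R) : 0 <= y -> x <= y -> `|C| <= `|C1| + `|C2| ->
    ~ (Qhatb Mo z b a < c * Qhat Mo z a - C * y) -> K * delta L n ^+ 2 <= `|K| * y ->
    Qhat Mo z a <= (`|K| + (`|C1| + `|C2|)) / c * y.
  move=> y0 xy CC /negP; rewrite -leNgt lerBlDr => hq Ky.
  rewrite mulrAC ler_pdivlMr// mulrC; apply: le_trans hq _.
  rewrite mulrDl; apply: lerD; first exact: le_trans Qa Ky.
  by apply: ler_wpM2r => //; apply: le_trans (ler_norm _) CC.
have Kd : K * delta L n ^+ 2 <= `|K| * delta L n ^+ 2.
  by apply: ler_wpM2r (ler_norm _).
apply: h => //.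
  apply: (tr _ _ C1 D2 (lexx _)); first by rewrite lerDl.
    by move=> hb; apply: h1; exists a; split => //; exact: sieve_M0_le.
  by apply: le_trans Kd _; exact: ler_wpM2l.
move=> Aa; apply: (tr _ _ C2 d2 (lexx _)) Kd; first by rewrite lerDr.
by move=> hb; apply: h2; exists a.
Qed.

Lemma std_score_tight :
  tightP P (fun M n w => M < `|std_score (smp n w) unit|).
Proof.
move=> e e0; have e2 : 0 < e / 2 by rewrite divr_gt0.
have [M [M0 HM]] := normal_abs_cdf_tail e2; exists M.
have Hc := score_abs_close e2.
apply: filterS Hc => n /(_ M) hc.
have mX := measurable_std_score n.
have mA := measurable_abs_le M mX.
have -> : [set w | M < `|std_score (smp n w) unit|] =
    ~` [set w | `|std_score (smp n w) unit| <= M].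
  by apply/seteqP; split => w /=; rewrite ltNge => /negP.
rewrite outerP_measurable; last exact: measurableC.
rewrite probability_setC// -abs_cdfE// -EFinB lee_fin.
by move: hc; rewrite ler_norml => /andP[h1 h2]; lra.
Qed.

Lemma Bn_bounded : exists k : R, 0 <= k /\ W (fun n z _ => 0 <= Bn L z <= k).
Proof.
have [K [K0 HK]] := wnorm_ustar_bounds; exists (K + 1); split; first by rewrite addr_ge0// ltW.
have [[_ Bpos _ _ _] _] := HLQA.
apply: wpa1_mono (Bn_consistent ltr01).
apply: filterS HK => n /andP[_ aK] z _ h.
exact: (bound_real (Bpos n z) aK h (lexx _)).
Qed.

Context (q : R) (Hhat : W (fun n z _ => (Pen Mo (alphahat Mo z).2 <= p%:E)%E /\
   Qhat Mo z (alphahat Mo z) <= q * lambda Mo n)).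

Let lambda_delta : \forall n \near \oo, lambda Mo n <= delta L n ^+ 2 /\ tol Mo n <= delta L n ^+ 2.
Proof.
have [K [K0 HK]] := Pi_rate.
by apply: filterS HK => n [_ _ h1 h2 _].
Qed.

Let scale_le (x k l D : R) : x <= k * l -> 0 <= l -> l <= D -> x <= `|k| * D.
Proof.
move=> h l0 lD; apply: le_trans h _; apply: le_trans (ler_wpM2r l0 (ler_norm k)) _.
exact: ler_wpM2l.
Qed.

Let alphahat_sieve n z : sieve Mo (kdim Mo n) (@alphahat _ _ _ _ _ _ _ _ _ Mo n z).
Proof. by have [h _] : estimator_ok Mo by case: Hmodel => _ []. Qed.

Lemma alphahat_Nosn : W (fun n z _ => Aos L (alphahat Mo z) /\ Nosn Mo L n (alphahat Mo z)).
Proof.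
have HN := Nosn_of_Qhat `|q|.
apply: (wpa1_and_mono Hhat HN).
apply: filterS lambda_delta => n [ld _] z _ [pp Qp] h; apply: h => //.
exact: scale_le Qp (ltW (lambda_pos n)) ld.
Qed.

Let amin_hat : W (fun n z _ => approx_min Mo z unit (sieve Mo (kdim Mo n)) (alphahat Mo z)).
Proof.
have [_ amin] : estimator_ok Mo by case: Hmodel => _ [].
exact: (proj1 (@wpa1_sample _ _ _ P _ ZN WN
    (fun n z => approx_min Mo z unit (sieve Mo (kdim Mo n)) (alphahat Mo z))) amin).
Qed.

Lemma alphahat_foc (e : R) : 0 < e ->
  W (fun n z _ => `|std_score z unit + lin n (alphahat Mo z)| <= e).
Proof.
move=> e0; have [k [k0 Hk]] := Bn_bounded.
have k2 : 0 < 2 + k by rewrite ltr_wpDr.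
pose h := Num.min 1 (e / (2 + k)).
have h01 : 0 < h <= 1 by rewrite lt_min ltr01 divr_gt0// ge_min lexx.
have he : (2 + k) * h <= e by rewrite mulrC -ler_pdivlMr// ge_min lexx orbT.
have [tf tf0 Hfoc] := approx_min_foc k h01.
apply: (wpa1_and_mono (wpa1_and (lqa_wpa1 tf0) Hk) (wpa1_and alphahat_Nosn amin_hat)).
apply: filterS Hfoc => n Hfoc z _ [hl hB] [[_ Na] am].
exact: (le_trans (Hfoc z unit (Bn L z) _ hl hB Na am) he).
Qed.

(** ** The restricted estimator *)

Let restricted_real (N l q1 q2 q3 p1 p2 p3 t D c C m : R) : 0 < N -> 0 <= l ->
  0 < c -> 0 <= p3 -> 0 <= C -> q1 <= q * l -> l * p1 <= l * m ->
  N * l * `|p2 - p1| <= 1 -> N * (q2 - q1) <= C ->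
  q3 + l * p3 <= q2 + l * p2 + t -> l <= D -> t <= D -> c <= N * D ->
  q3 <= (`|q| + `|m| + (C + 1) / c + 1) * D.
Proof.
move=> N0 l0 c0 p30 C0 h1 h2 h3 h4 h5 lD tD cD.
have q1D := scale_le h1 l0 lD.
have p1D : l * p1 <= `|m| * D by apply: (scale_le (l := l)) => //; rewrite [m * l]mulrC.
have D0 : 0 <= D by exact: le_trans lD.
have p21 : N * (l * p2 - l * p1) <= 1.
  apply: le_trans h3; rewrite -mulrBr mulrA; apply: ler_wpM2l (ler_norm _).
  by rewrite mulr_ge0// ltW.
have sum : (q2 - q1) + (l * p2 - l * p1) <= (C + 1) / c * D.
  rewrite -(ler_pM2l N0) mulrDr; apply: le_trans (lerD h4 p21) _.
  have -> : N * ((C + 1) / c * D) = (C + 1) * ((N * D) / c) by field; rewrite gt_eqF.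
  rewrite -[leLHS]mulr1; apply: ler_wpM2l; first by rewrite addr_ge0.
  by rewrite ler_pdivlMr// mul1r.
have lp : 0 <= l * p3 by exact: mulr_ge0.
have -> : (`|q| + `|m| + (C + 1) / c + 1) * D =
  `|q| * D + `|m| * D + (C + 1) / c * D + D by ring.
move: sum q1D p1D h5 lp tD.
move: (`|q| * D) (`|m| * D) ((C + 1) / c * D) (l * p1) (l * p2) (l * p3) => *; lra.
Qed.

Let lin_bound (x y M : R) : `|x| <= M -> `|x + y| <= 1 -> `|0 - y| <= M + 1.
Proof.
move=> h1 h2; have -> : 0 - y = x - (x + y) by ring.
by apply: le_trans (ler_normB _ _) _; exact: lerD.
Qed.

Let sqr_bound (c N D : R) : 0 < c -> 0 < Num.sqrt N -> 0 <= N -> c / Num.sqrt N <= D ->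
  c ^+ 2 <= N * D ^+ 2.
Proof.
move=> c0 r0 N0; rewrite ler_pdivrMr// => h.
have -> : N * D ^+ 2 = (D * Num.sqrt N) ^+ 2 by rewrite exprMn sqr_sqrtr// mulrC.
by rewrite ler_sqr ?nnegrE ?(ltW c0)//; exact: le_trans (ltW c0) h.
Qed.

Let quad_bound (N v s y B k S : R) : 0 <= B <= k -> `|y| <= 1 -> `|s| <= S -> 0 <= k ->
  `|N / 2 * v - s * y - B / 2 * s ^+ 2| <= 1 * (S ^+ 2 + S + 1) ->
  N * v <= 2 * (S + k * S ^+ 2 + (S ^+ 2 + S + 1)).
Proof.
move=> /andP[B0 Bk] y1 sS k0; rewrite ler_norml mul1r => /andP[_ h].
have S0 : 0 <= S by exact: le_trans sS.
have s2 : s ^+ 2 <= S ^+ 2 by rewrite -[s ^+ 2]real_normK ?num_real// ler_sqr ?nnegrE.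
have h1 : s * y <= S.
  apply: le_trans (ler_norm _) _; rewrite normrM -[leRHS]mulr1; exact: ler_pM.
have h2 : B / 2 * s ^+ 2 <= k * S ^+ 2.
  by apply: ler_pM => //; rewrite ?sqr_ge0//; lra.
have E : N / 2 * v = (N * v) / 2 by field.
rewrite E in h; move: h h1 h2; move: (N * v) (s * y) (B / 2 * _) (k * S ^+ 2) (S ^+ 2) => *; lra.
Qed.

Let C_ge0 (S k : R) : 0 <= S -> 0 <= k -> 0 <= 2 * (S + k * S ^+ 2 + (S ^+ 2 + S + 1)).
Proof.
move=> S0 k0; have S2 := sqr_ge0 S; have := mulr_ge0 k0 S2.
by move: (k * S ^+ 2) (S ^+ 2) S2 => *; lra.
Qed.

(** The restricted estimator cannot do worse than the unrestricted one shifted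
    onto the constraint, and that shift costs O(1 / n), which is O(delta ^ 2). *)
Lemma restricted_rate (M k : R) : 0 <= M -> 0 <= k -> exists K : R, \forall n \near \oo,
  forall (z : 'I_n -> ZT) B a aR, lqa_within 1 z unit B -> 0 <= B <= k ->
  Nosn Mo L n a -> Aos L a -> `|std_score z unit| <= M ->
  `|std_score z unit + lin n a| <= 1 -> Qhat Mo z a <= q * lambda Mo n ->
  approx_min Mo z unit (constrained_sieve Mo n (phi Mo a0)) aR ->
  (Pen Mo aR.2 <= p%:E)%E -> Qhat Mo z aR <= K * delta L n ^+ 2.
Proof.
move=> M_0 k0; have [K [K0 HK]] := wnorm_ustar_bounds.
have [c [c0 Hc]] := delta_lower.
pose S := (M + 1 + 2) * K; pose C := 2 * (S + k * S ^+ 2 + (S ^+ 2 + S + 1)).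
have S0 : 0 <= S by apply: mulr_ge0 (ltW K0); rewrite !addr_ge0.
exists (`|q| + `|M0 L| + (C + 1) / c ^+ 2 + 1).
have l01 : 0 < (1 : R) <= 1 by apply/andP; split; [exact: ltr01|exact: lexx].
have Hs := lqa_scaled S ltr01.
have HT := Tn_scaled S.
have Hps := pen_shift ltr01.
have Hfs := feasible_shift
  (M + 1) l01 K0 HK.
have [[shin _ _ _ _] _] := HLQA.
apply: filterS3 (filterI near_gt0 (filterI Hc lambda_delta)) (filterI Hs HT)
  (filterI Hps (filterI Hfs shin)) => n [n0 [cd [ld td]]] [Hsn Tsc] [pens [fs sieve_sh]].
move=> z B a aR hl hB Na Aa sM foc Qa am paR.
have n0' : 0 < n%:R :> R by rewrite ltr0n.
have rn0 : 0 < Num.sqrt (n%:R : R) by rewrite sqrtr_gt0.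
have [||s [sS phis _]] := fs a (phi Mo a0) 0 Na Aa.
- by rewrite subrr mulr0 mul0r subr0 normr0.
- exact: (lin_bound sM foc).
have q1 := Hsn z unit B a s hl Na sS.
have [pe pd] := pens _ _ Na (Tsc _ sS).
have Ssh : constrained_sieve Mo n (phi Mo a0) (sh n a (s / Num.sqrt n%:R)).
  by split; [exact: (sieve_sh _ _ Na (Tsc _ sS))|exact: phis].
have le := approx_min_le am Ssh (Pen_fin paR) pe.
have pa : lambda Mo n * pen a <= lambda Mo n * M0 L.
  case: (Na) => -[_ _ _ +] _; rewrite (Nosn_Pen Na) -EFinM lee_fin.
  by [].
have cD : c ^+ 2 <= n%:R * delta L n ^+ 2 by exact: (sqr_bound c0 rn0 (ler0n R n) cd).
have hC := quad_bound hB foc sS k0 q1.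
have C0 : 0 <= C by exact: (C_ge0 S0 k0).
exact: (restricted_real n0' (ltW (lambda_pos n)) (exprn_gt0 2 c0) (pen_ge0 _) C0 Qa
  pa pd hC le ld td cD).
Qed.

Context (alphaR : forall n, ('I_n -> ZT) -> par).
Context (HR : restricted_ok Mo (phi Mo a0) alphaR).
Context (HRp : W (fun n z _ => (Pen Mo (alphaR z).2 <= p%:E)%E)).

Let amin_R : W (fun n z _ =>
  approx_min Mo z unit (constrained_sieve Mo n (phi Mo a0)) (alphaR z)).
Proof.
have [_ amin _ _] := HR.
exact: (proj1 (@wpa1_sample _ _ _ P _ ZN WN (fun n z =>
  approx_min Mo z unit (constrained_sieve Mo n (phi Mo a0)) (alphaR z))) amin).
Qed.

Lemma alphaR_Nosn : W (fun n z _ => Aos L (alphaR z) /\ Nosn Mo L n (alphaR z)).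
Proof.
apply: (wpa1_tight_elim (E0 := fun M n z => M < `|std_score z unit|)
  (std_score_tight)) => M.
have [k [k0 Hk]] := Bn_bounded.
pose M' := Num.max M 0; have M'0 : 0 <= M' by rewrite le_max lexx orbT.
have MM' : M <= M' by rewrite le_max lexx.
have [K HK] := restricted_rate M'0 k0.
have WL := lqa_wpa1 (@ltr01 R).
have WA := alphahat_Nosn.
have WF := alphahat_foc
  (@ltr01 R).
have WQ := Nosn_of_Qhat K.
apply: (wpa1_and_mono (wpa1_and (wpa1_and WL Hk) (wpa1_and WA WF))
  (wpa1_and (wpa1_and Hhat WQ) (wpa1_and amin_R HRp))).
have [cR _ _ _] := HR.
apply: filterS2 HK cR => n HK cR z _ [[hl hB] [[Aa Na] foc]] [[[_ Qa] HQ] [am pR]] sM.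
have sM' : `|std_score z unit| <= M' by apply: le_trans MM'; rewrite leNgt; exact/negP.
apply: (HQ _ (proj1 (cR z)) pR).
exact: (HK z (Bn L z) (alphahat Mo z) _ hl hB Na Aa sM' foc Qa am pR).
Qed.

Lemma QLR_close (e : R) : 0 < e -> W (fun n z _ =>
  (`|QLR Mo z (phi Mo a0) - (std_score z unit ^+ 2 / an n)%:E| <= e%:E)%E).
Proof.
move=> e0.
apply: (wpa1_tight_elim (E0 := fun M n z => M < `|std_score z unit|)
  (std_score_tight)) => M.
have [h [tl [h0 tl0 HQ]]] := QLR_expansion M e0.
have WL := lqa_wpa1 tl0.
have WB := Bn_consistent h0.
have WA := alphahat_Nosn.
have [cR _ _ QR] := HR.
have WD := proj1 (@oPP _ _ _ P _ ZN WN (fun n z => (QLR Mo z (phi Mo a0) -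
  (n%:R * (Qhat Mo z (alphaR z) - Qhat Mo z (alphahat Mo z)))%:E)%E)) QR _ h0.
apply: (wpa1_and_mono (wpa1_and (wpa1_and WL WB) (wpa1_and WA alphaR_Nosn))
  (wpa1_and amin_hat WD)).
have [[_ Bpos _ _ _] _] := HLQA.
apply: filterS2 HQ cR => n HQ cR z _ [[hl hB] [[A1 N1] [A2 N2]]] [am hD] sM.
have := HQ z unit (Bn L z) (alphahat Mo z) (alphaR z) (phi Mo a0) 0 hl (Bpos n z) hB
  N1 A1 am N2 A2 (proj2 (cR z)).
rewrite subrr mulr0 mul0r subr0 normr0 addr0; apply => //; first exact: ltW.
by rewrite leNgt; exact/negP.
Qed.

(** ** The bootstrap *)

Context (HLQAB : cond_LQAB Mo L).

Definition boot_score n (z : 'I_n -> ZT) (b : 'I_n -> R) : R :=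
  std_score z (centered b).

(** The score is linear in the weights. *)
Lemma std_score_centered n (z : 'I_n -> ZT) b :
  std_score z b = boot_score z b + std_score z unit.
Proof.
rewrite /boot_score /std_score -mulrDr; congr (_ * _).
rewrite /Zscore -mulrDr; congr (_ * _); rewrite -big_split; apply: eq_bigr => i _.
by rewrite /= /centered /unit_weights mulrBl mul1r subrK.
Qed.

Let sw0 : 0 < sw.
Proof. by have [_ _ h _ _] : weights_ok Mo by case: Hmodel => -[]. Qed.

Lemma measurable_boot_score n (z : 'I_n -> ZT) :
  measurable_fun setT (fun w => boot_score z (@WN n w)).
Proof.
apply: measurable_std_score_weights => i; apply: measurable_funB => //.
Qed.

Lemma boot_abs_close (e : R) : 0 < e ->
  W (fun n z _ => abs_close P (fun w => boot_score z (@WN n w) / sw) e).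
Proof.
move=> e0; have [_ HBL] := HLQAB.
pose h := Num.min 1 (e / 3).
have h01 : 0 < h <= 1 by rewrite lt_min ltr01 divr_gt0// ge_min lexx.
have h2 : 0 < h ^+ 2 by apply: exprn_gt0; case/andP: h01.
have he : 3 * h <= e by rewrite mulrC -ler_pdivlMr// ge_min lexx orbT.
have := proj1 (@oPP _ _ _ P _ ZN WN (fun n z => ereal_sup
    [set (`|boot_mean Mo L f z -
            \int[normal_prob (0 : R) 1]_x f x|)%:E | f in BL1])) HBL _ h2.
apply: wpa1_mono; apply: nearW => n z _ hs.
have mX : measurable_fun setT (fun w => boot_score z (@WN n w) / sw).
  by apply: measurable_funM => //; exact: measurable_boot_score.
have BL f : BL1 f -> `|\int[P]_w f (boot_score z (@WN n w) / sw) -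
     \int[normal_prob (0 : R) 1]_x f x| <= h ^+ 2.
  move=> bf; rewrite -lee_fin; apply: le_trans hs; apply: le_trans (lee_abs _).
  by apply: ereal_sup_ubound; exists f.
by move=> r; apply: le_trans (BL_abs_close mX h01 BL r) he.
Qed.

Let div_le (x M s : R) : 0 < s -> (`|x / s| <= M) = (`|x| <= M * s).
Proof. by move=> s0; rewrite normrM normfV (gtr0_norm s0) ler_pdivrMr. Qed.

Lemma boot_score_tight : cond_tightP P ZN WN (fun M n z b => M < `|boot_score z b|).
Proof.
apply: ctightP_of_wpa1 => e e0; have e2 : 0 < e / 2 by rewrite divr_gt0.
have [M [M0 HM]] := normal_abs_cdf_tail e2; exists (M * sw).
apply: wpa1_mono (boot_abs_close e2); apply: nearW => n z _ hc.
have mX : measurable_fun setT (fun w => boot_score z (@WN n w) / sw).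
  by apply: measurable_funM => //; exact: measurable_boot_score.
have mA := measurable_abs_le M mX.
have -> : condP P WN (fun z b => M * sw < `|boot_score z b|) z =
    outerP P (~` [set w | `|boot_score z (@WN n w) / sw| <= M]).
  congr outerP; apply/seteqP; split => w /=;
    by rewrite (div_le _ M sw0) ltNge => /negP.
rewrite outerP_measurable; last exact: measurableC.
rewrite probability_setC// -abs_cdfE// -EFinB lee_fin.
by move: (hc M); rewrite ler_norml => /andP[h1 h2]; lra.
Qed.

Context (HBom : cond_Bomega Mo L).
Context (q' : R) (Hboot : W (fun n z b => [/\ (Pen Mo (alphaB Mo z b).2 <= p%:E)%E,
     Qhatb Mo z b (alphaB Mo z b) <= q' * lambda Mo n,
     (Pen Mo (alphaRB Mo z b).2 <= p%:E)%E &
     Qhatb Mo z b (alphaRB Mo z b) <= q' * lambda Mo n])).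

Let Hbok : bootstrap_ok Mo. Proof. by case: Hmodel => _ []. Qed.

Lemma bootstrap_Nosn : W (fun n z b =>
  (Aos L (alphaB Mo z b) /\ Nosn Mo L n (alphaB Mo z b)) /\
  (Aos L (alphaRB Mo z b) /\ Nosn Mo L n (alphaRB Mo z b))).
Proof.
have HN := Nosn_of_Qhatb `|q'|.
have [K [K0 HK]] := Pi_rate.
have [sB _ sRB _ _] := Hbok.
apply: (wpa1_and_mono Hboot HN).
apply: filterS HK => n [_ _ ld _ _] z b [p1 Q1 p2 Q2] h.
by split; apply: h => //; [exact: scale_le Q1 (ltW (lambda_pos n)) ld|
  by case: (sRB n z b)|exact: scale_le Q2 (ltW (lambda_pos n)) ld].
Qed.

Let phi_hat (h : R) : 0 < h -> W (fun n z _ =>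
  `|Num.sqrt n%:R * (phi Mo (alphahat Mo z) - phi Mo a0) / sd n
    - lin n (alphahat Mo z)| <= h).
Proof.
move=> h0.
have Hlin := phi_linear 0 h0.
have WA := alphahat_Nosn.
apply: wpa1_mono WA; apply: filterS Hlin => n Hlin z _ [Aa Na].
have Z0 : `|0 : R| <= 0 by rewrite normr0.
by have := Hlin _ 0 Na Aa Z0; rewrite mul0r /Defs.shift scale0r addr0 mul0r addr0.
Qed.

Let close_real (a K X y M h : R) : 0 < a -> K^-1 <= a -> 0 < K -> `|X| <= M ->
  `|y| <= h -> h <= 1 -> `|(X + y) ^+ 2 / a - X ^+ 2 / a| <= K * (2 * M + 1) * h.
Proof.
move=> a0 aK K0 XM yh h1; have -> : (X + y) ^+ 2 / a - X ^+ 2 / a = a^-1 * (2 * X + y) * y.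
  by ring.
have h0 : 0 <= h by exact: le_trans yh.
rewrite !normrM [`|a^-1|]gtr0_norm ?invr_gt0//; apply: ler_pM => //.
  by rewrite mulr_ge0 ?invr_ge0// ltW.
apply: ler_pM => //; first by rewrite invr_ge0 ltW.
  by rewrite -[leRHS]invrK lef_pV2 ?posrE ?invr_gt0.
apply: le_trans (ler_normD _ _) _; apply: lerD; last exact: le_trans h1.
by rewrite normrM ger0_norm// ler_pM2l.
Qed.

Let combine (Q : \bar R) (Y X e : R) : (`|Q - Y%:E| <= (e / 2)%:E)%E ->
  `|Y - X| <= e / 2 -> (`|Q - X%:E| <= e%:E)%E.
Proof.
case: Q => [x||]//=; rewrite !lee_fin !ler_norml => /andP[? ?] /andP[? ?].
by apply/andP; split; lra.
Qed.

Let sum_bound (X y M : R) : `|X| <= M -> `|y| <= 1 -> `|X + y| <= M + 1.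
Proof. by move=> h1 h2; apply: le_trans (ler_normD _ _) _; exact: lerD. Qed.

(** The bootstrap constraint is centred at the estimate, whose linear score
    nearly cancels the sample score: only the centred weights remain. *)
Lemma QLRB_close (e : R) : 0 < e -> W (fun n z b =>
  (`|QLRB Mo z b - (boot_score z b ^+ 2 / an n)%:E| <= e%:E)%E).
Proof.
move=> e0; apply: (wpa1_ctight_elim boot_score_tight) => M.
have e2 : 0 < e / 2 by rewrite divr_gt0.
have [K [K0 HK]] : exists K : R, 0 < K /\ \forall n \near \oo, K^-1 <= an n <= K.
  exact: (wnorm_ustar_bounds).
have [h [tl [h0 tl0 HQ]]] := QLR_expansion (M + 1) e2.
pose c := K * (2 * `|M| + 1).
have c0 : 0 < c by rewrite mulr_gt0// ltr_wpDl// mulr_ge0.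
pose k := Num.min 1 (e / 2 / c).
have k0 : 0 < k by rewrite lt_min ltr01 divr_gt0.
have k1 : k <= 1 by rewrite ge_min lexx.
have kc : c * k <= e / 2 by rewrite mulrC -ler_pdivlMr// ge_min lexx orbT.
have [[_ Bpos _ _ LB] _] := HLQAB.
have WL := proj1 (@cond_oPP _ _ _ P _ ZN WN _) LB _ tl0.
have WB := proj1 (@cond_oPP _ _ _ P _ ZN WN _) HBom _ h0.
have [_ am phiRB _ DB] := Hbok.
have WD := proj1 (@cond_oPP _ _ _ P _ ZN WN _) DB _ h0.
have WF := alphahat_foc k0.
apply: (wpa1_and_mono (wpa1_and (wpa1_and WL WB) (wpa1_and bootstrap_Nosn (phi_hat h0)))
  (wpa1_and (wpa1_and am WD) WF)).
apply: filterS2 HQ HK => n HQ /andP[aK1 _] z b [[hl hB] [[[A1 N1] [A2 N2]] hphi]]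
  [[ham hD] foc] /negP; rewrite -leNgt => XM.
have a0 : 0 < an n by apply: lt_le_trans aK1; rewrite invr_gt0.
have hB' : `|Bomega L z b - an n| <= h by move: hB; rewrite /= normr_id lee_fin.
have sE : std_score z b + lin n (alphahat Mo z) =
    boot_score z b + (std_score z unit + lin n (alphahat Mo z)).
  by rewrite std_score_centered addrA.
have YM : `|std_score z b + lin n (alphahat Mo z)| <= M + 1.
  by rewrite sE; exact: (sum_bound XM (le_trans foc k1)).
have := HQ z b (Bomega L z b) (alphaB Mo z b) (alphaRB Mo z b) _ (lin n (alphahat Mo z))
  hl (Bpos n z b) hB' N1 A1 ham N2 A2 (proj2 (phiRB n z b)) hphi YM hD.
move/combine; apply; rewrite sE.
have XM' := le_trans XM (ler_norm M).
exact: (le_trans (close_real a0 aK1 K0 XM' foc k1) kc).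
Qed.

Let bounded_real (Q : \bar R) (X a K M : R) : 0 < K -> K^-1 <= a -> `|X| <= M ->
  (`|Q - (X ^+ 2 / a)%:E| <= 1%:E)%E -> (`|Q| <= (M ^+ 2 * K + 1)%:E)%E.
Proof.
move=> K0 aK XM; have a0 : 0 < a by apply: lt_le_trans aK; rewrite invr_gt0.
have h : X ^+ 2 / a <= M ^+ 2 * K.
  apply: ler_pM; [exact: sqr_ge0|by rewrite invr_ge0 ltW| |].
    by rewrite -[X ^+ 2]real_normK ?num_real// ler_sqr ?nnegrE//; exact: le_trans XM.
  by rewrite -[leRHS]invrK lef_pV2 ?posrE ?invr_gt0.
have h0 : 0 <= X ^+ 2 / a by rewrite divr_ge0 ?sqr_ge0// ltW.
case: Q => [x||]//=; rewrite !lee_fin !ler_norml => /andP[? ?].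
by apply/andP; split; lra.
Qed.

Lemma QLRB_tight : cond_OP P ZN WN (fun n z b => QLRB Mo z b).
Proof.
apply: (ctightP_transfer boot_score_tight) => M.
have [K [K0 HK]] : exists K : R, 0 < K /\ \forall n \near \oo, K^-1 <= an n <= K.
  exact: (wnorm_ustar_bounds).
exists (M ^+ 2 * K + 1); apply: wpa1_mono (QLRB_close ltr01).
apply: filterS HK => n /andP[aK1 _] z b hc /negP; rewrite -leNgt => XM.
apply/negP; rewrite -leNgt; exact: (bounded_real K0 aK1 XM hc).
Qed.

(** ** Limit distribution *)

Let rescale_sqr (Q : \bar R) (X a s e : R) : 0 < s ->
  (`|Q - (X ^+ 2 / a)%:E| <= (e * s ^+ 2)%:E)%E ->
  (`|Q * ((s ^+ 2)^-1)%:E - ((X / s) ^+ 2 / a)%:E| <= e%:E)%E.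
Proof.
move=> s0; have s2 : 0 < s ^+ 2 by exact: exprn_gt0.
case: Q => [x||]; rewrite ?gt0_mulye ?gt0_mulNye ?lte_fin ?invr_gt0//=.
have sn : s != 0 by rewrite gt_eqF.
rewrite !lee_fin => h; rewrite -(ler_pM2r s2); move: h.
have -> // : `|x / s ^+ 2 - (X / s) ^+ 2 / a| * s ^+ 2 = `|x - X ^+ 2 / a|.
rewrite -[X in _ * X = _](gtr0_norm s2) -normrM; congr `| _ |.
by rewrite mulrBl exprMn exprVn divfK ?gt_eqF// (mulrAC _ _ a^-1) divfK ?gt_eqF.
Qed.

Lemma scaled_QLRB_close (e : R) : 0 < e -> W (fun n z b =>
  (`|scaled_QLRB Mo z b - ((boot_score z b / sw) ^+ 2 / an n)%:E| <= e%:E)%E).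
Proof.
move=> e0; have es : 0 < e * sw ^+ 2 by rewrite mulr_gt0// exprn_gt0.
apply: wpa1_mono (QLRB_close es).
by apply: nearW => n z b; exact: rescale_sqr.
Qed.

Lemma bootstrap_expansion : conclusion_expansion Mo L.
Proof.
split.
  apply/(@cond_oPP _ _ _ P _ ZN WN) => e e0.
  apply: wpa1_mono (scaled_QLRB_close e0); apply: nearW => n z b.
  have -> : (Num.sqrt n%:R * (Zscore Mo L z (centered b) / (sw * wnorm (u n)))) ^+ 2 =
    (boot_score z b / sw) ^+ 2 / an n.
    rewrite /boot_score /std_score; move: (Num.sqrt _) (Zscore _ _ _ _) (wnorm _) => r Z w.
    by rewrite invfM !mulrA exprMn exprVn.
  by [].
apply: (ctightP_transfer (QLRB_tight)) => M.
exists (M / sw ^+ 2); apply: wpa1_near; apply: nearW => n z b.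
have s2 : 0 < (sw ^+ 2)^-1 by rewrite invr_gt0 exprn_gt0.
apply: contra_not; rewrite /scaled_QLRB abseM /= (gtr0_norm s2) EFinM.
by rewrite lte_pmul2r// lte_fin.
Qed.

Let triangle (x y : \bar R) (g k e : R) : x \is a fin_num -> y \is a fin_num ->
  `|fine x - g| <= k -> `|fine y - g| <= k -> k <= e / 2 -> (`|x - y| <= e%:E)%E.
Proof.
move=> /fineK {2}<- /fineK {2}<-; rewrite /= lee_fin => h1 h2 ke.
have -> : fine x - fine y = (fine x - g) - (fine y - g) by ring.
by apply: le_trans (ler_normB _ _) _; rewrite [e]splitr; apply: lerD; exact: le_trans ke.
Qed.

Let tolerance (a K e e1 : R) : 0 < a -> a <= K -> 0 < e -> 0 < e1 -> e1 <= e / 8 ->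
  K * e1 <= (e / 8) ^+ 2 -> e1 + e1 + 2 * Num.sqrt (a * e1) <= e / 2.
Proof.
move=> a0 aK e0 e10 h1 h2; have : Num.sqrt (a * e1) <= e / 8.
  have -> : e / 8 = Num.sqrt ((e / 8) ^+ 2) by rewrite sqrtr_sqr gtr0_norm// divr_gt0.
  by apply: ler_wsqrtr; apply: le_trans h2; rewrite ler_pM2r.
by move: (Num.sqrt _) => s *; lra.
Qed.

(** Both statistics are close to the square of a nearly normal variable divided
    by the same number, hence have nearly the same distribution function. *)
Lemma bootstrap_distribution : conclusion_distribution Mo (phi Mo a0).
Proof.
apply/(@cond_oPP _ _ _ P _ ZN WN) => e e0.
have [K [K0 HK]] : exists K : R, 0 < K /\ \forall n \near \oo, K^-1 <= an n <= K.
  exact: (wnorm_ustar_bounds).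
have e80 : 0 < e / 8 by rewrite divr_gt0.
(* so that 2 * e1 + 2 * sqrt (K * e1) is at most e / 2, the error allowed to
   each of the two distribution functions *)
pose e1 := Num.min (e / 8) ((e / 8) ^+ 2 / K).
have e10 : 0 < e1 by rewrite lt_min e80 divr_gt0// exprn_gt0.
have e18 : e1 <= e / 8 by rewrite ge_min lexx.
have Ke1 : K * e1 <= (e / 8) ^+ 2 by rewrite mulrC -ler_pdivlMr// ge_min lexx orbT.
have HX := score_abs_close e10.
have WX := boot_abs_close e10.
have HQ : oP P (fun n w => (QLR Mo (smp n w) (phi Mo a0) -
    (std_score (smp n w) unit ^+ 2 / an n)%:E)%E).
  apply/(@oPP _ _ _ P _ ZN WN (fun n z => (QLR Mo z (phi Mo a0) -
    (std_score z unit ^+ 2 / an n)%:E)%E)) => r r0.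
  exact: (QLR_close r0).
have {}HQ := proj1 (ecvg0P (fun n => outerP_ge0 P _)) (HQ _ e10) _ e10.
have WQ : W (fun n z _ => (condP P WN (fun z b => (e1%:E <
    `|scaled_QLRB Mo z b - ((boot_score z b / sw) ^+ 2 / an n)%:E|)%E) z <= e1%:E)%E).
  apply: cond_oP_condP e10; apply/(@cond_oPP _ _ _ P _ ZN WN) => r r0.
  exact: scaled_QLRB_close.
apply: (wpa1_and_mono WX WQ).
apply: filterS3 HK HX HQ => n /andP[aK1 aK] HX HQ z _ HXz HQz.
have a0 : 0 < an n by apply: lt_le_trans aK1; rewrite invr_gt0.
have kE := tolerance a0 aK e0 e10 e18 Ke1.
have mX := measurable_std_score n.
have mXz : measurable_fun setT (fun w => boot_score z (@WN n w) / sw).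
  by apply: measurable_funM => //; exact: measurable_boot_score.
have bound t : (`|condP P WN (fun z' b => (scaled_QLRB Mo z' b <= t%:E)%E) z -
       outerP P [set w | (QLR Mo (smp n w) (phi Mo (alpha0 Mo)) <= t%:E)%E]| <= e%:E)%E.
  exact: (triangle (outerP_fin P _) (outerP_fin P _)
    (square_cdf_close (D := fun w => scaled_QLRB Mo z (@WN n w)) t mXz a0 (ltW e10) HXz HQz)
    (square_cdf_close (D := fun w => QLR Mo (smp n w) (phi Mo (alpha0 Mo))) t
       mX a0 (ltW e10) HX HQ) kE).
rewrite gee0_abs.
  by apply: ge_ereal_sup => _ [t _ <-]; exact: bound.
by apply: (le_trans (abse_ge0 _)); apply: ereal_sup_ubound; exists 0.
Qed.

End local_expansion.

Theorem theorem5p3 (R : realType) (d : measure_display) (T : measurableType d)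
    (P : probability T R) (dY dX dt dr : nat) (H : completeNormedModType R)
    (Mo : model P dY dX dt dr H) (phi0 : R)
    (alphaR : forall n, ('I_n -> 'rV[R]_dY * 'rV[R]_dX) -> 'rV[R]_dt * H) :
  model_ok Mo ->
  (phi Mo (alpha0 Mo) = phi0 -> restricted_ok Mo phi0 alphaR) ->
  cond_ID Mo -> cond_PEN Mo -> cond_CRIT_i Mo -> cond_BCRIT_i Mo ->
  (* M_0 is finite and sufficiently large *)
  exists Mlow : R, forall L : local_objects dY dX dt H, Mlow < M0 L ->
    local_ok Mo L ->
    cond_CRIT_ii Mo L -> cond_LOC Mo L -> cond_BCRIT_ii_iii Mo L ->
    cond_PHI Mo L -> cond_LQA Mo L -> cond_LQAB Mo L -> cond_Bomega Mo L ->
    conclusion_expansion Mo L /\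
    (phi Mo (alpha0 Mo) = phi0 -> conclusion_distribution Mo phi0).
Proof.
move=> Hmodel Hrestr HID HPEN HCRIT HBCRIT.
have [p0 [_ H0]] := Pen_Pi_le Hmodel HPEN.
have [p1 [_ H1]] := alphahat_bounds Hmodel HID HPEN HCRIT.
have [p2 [_ H2]] := bootstrap_bounds Hmodel HID HPEN HCRIT HBCRIT.
have [C HC] : exists C : R, phi Mo (alpha0 Mo) = phi0 ->
    wpa1 P (fun n w => (Pen Mo (alphaR n (Zn Mo w)).2 <= C%:E)%E).
  have [h|nh] := pselect (phi Mo (alpha0 Mo) = phi0); last by exists 0.
  by have [_ _ [C HC] _] := Hrestr h; exists C.
pose p := Num.max (Num.max p0 p1) (Num.max p2 C).
have p0p : p0 <= p by rewrite /p !le_max lexx.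
have p1p : p1 <= p by rewrite /p !le_max lexx orbT.
have p2p : p2 <= p by rewrite /p !le_max lexx !orbT.
have Cp : C <= p by rewrite /p !le_max lexx !orbT.
exists p => L pM Hlocal HCRIT2 HLOC HBCRIT2 HPHI HLQA HLQAB HBom.
have up (x y : R) (v : \bar R) : x <= y -> (v <= x%:E)%E -> (v <= y%:E)%E.
  by move=> xy h; apply: le_trans h _; rewrite lee_fin.
have HpPi : \forall n \near \oo, (Pen Mo (Pi_h0 Mo n) <= p%:E)%E.
  by apply: filterS H0 => n; exact: up.
have Hhat : cond_wpa1 P (@Zn _ _ _ P _ _ _ _ _ Mo) (@Wn _ _ _ P _ _ _ _ _ Mo)
    (fun n z _ => (Pen Mo (alphahat Mo z).2 <= p%:E)%E /\
       Qhat Mo z (alphahat Mo z) <= p1 * lambda Mo n).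
  by apply: wpa1_mono H1; apply: nearW => n z _ [h1 h2]; split => //; exact: up h1.
have Hboot : cond_wpa1 P (@Zn _ _ _ P _ _ _ _ _ Mo) (@Wn _ _ _ P _ _ _ _ _ Mo)
    (fun n z b => [/\ (Pen Mo (alphaB Mo z b).2 <= p%:E)%E,
     Qhatb Mo z b (alphaB Mo z b) <= p2 * lambda Mo n,
     (Pen Mo (alphaRB Mo z b).2 <= p%:E)%E &
     Qhatb Mo z b (alphaRB Mo z b) <= p2 * lambda Mo n]).
  apply: wpa1_mono H2; apply: nearW => n z b [h1 h2 h3 h4].
  by split => //; [exact: up h1|exact: up h3].
split.
  exact: (bootstrap_expansion Hmodel HID HPEN HCRIT Hlocal HLOC HPHI HLQA pM HpPi
    HCRIT2 HBCRIT2 Hhat HLQAB HBom Hboot).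
move=> null; have HR := Hrestr null.
have HRp : cond_wpa1 P (@Zn _ _ _ P _ _ _ _ _ Mo) (@Wn _ _ _ P _ _ _ _ _ Mo)
    (fun n z _ => (Pen Mo (alphaR n z).2 <= p%:E)%E).
  apply: wpa1_mono (proj1 (@wpa1_sample _ _ _ P _ _ _
    (fun n z => (Pen Mo (alphaR n z).2 <= C%:E)%E)) (HC null)).
  by apply: nearW => n z _; exact: up.
rewrite -null in HR *.
exact: (bootstrap_distribution Hmodel HID HPEN HCRIT Hlocal HLOC HPHI HLQA pM HpPi
  HCRIT2 HBCRIT2 Hhat HR HRp HLQAB HBom Hboot).
Qed.
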